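(* Let $\xi_\infty$ and $\xi_t$ ($t>0$) be translation-invariant nonnegative functionals as specified in the context. Suppose that the following two conditions hold: (A) as $t\to\infty$, the random variable $\xi_t((0,U),\mathcal X^t,\mathcal V^t)$ converges in probability to the random variable $\xi_\infty((0,U),\mathcal X,\mathcal V)$; (B) for some $p>1$ we have the uniform moment condition $$\sup_{t>0}\mathbb E\left[\xi_t\big((0,U),\mathcal X^t,\mathcal V^t\big)^p\right]<\infty.$$ Then, as $t\to\infty$, we have the following convergence in the $L^1$-sense: $$\frac1t\sum_{\mathbf x\in\mathcal X^t}\xi_t\big(\mathbf x,\mathcal X^t,\mathcal V^t\big)\longrightarrow\mathbb E\big[\xi_\infty((0,U),\mathcal X,\mathcal V)\big]=\mathbb E\big[\xi_\infty(\mathcal X,\mathcal V)\big].$$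
   Context: Setting. For $t\in(0,\infty)$ let $\mathbb T_t=\mathbb R/(t\mathbb Z)$ be the one-dimensional torus of length $t$, identified as a set with $(-t/2,t/2]$. For a set $S=\mathbb R\times(0,1]$ or $S=\mathbb T_t\times(0,1]$, whose points $(x,s)$ have position $x$ and birth time $s$, let $E(S)$ be the set of pairs $(\mathbf y,\mathbf x)$ of points of $S$ such that $\mathbf y$ is younger than $\mathbf x$, i.e. the birth time of $\mathbf y$ is larger than that of $\mathbf x$. Random input. $\mathcal X$ is a Poisson point process of intensity $1$ on $\mathbb R\times(0,1]$; $\mathcal V$ is an independent family of i.i.d. uniform random variables on $[0,1]$ indexed by $E(\mathbb R\times(0,1])$; $\mathcal X^t$ is the restriction of $\mathcal X$ to $\mathbb T_t\times(0,1]$ (with $\mathbb T_t$ identified with $(-t/2,t/2]$) and $\mathcal V^t$ the restriction of $\mathcal V$ to indices in $E(\mathbb T_t\times(0,1])$. $U$ is a random variable uniform on $(0,1]$ and independent of $\mathcal X$ and of $\mathcal V$. Functionals. For $x_0\in\mathbb R$ let $\theta_{x_0}(x,s)=(x+x_0,s)$ on $\mathbb R\times(0,1]$, and for $x_0\in\mathbb T_t$ let $\theta^t_{x_0}(x,s)=(x+x_0,s)$ on $\mathbb T_t\times(0,1]$; these translations act canonically on point sets and on families indexed by potential edges. $\xi_\infty$ is a functional associating a nonnegative real number $\xi_\infty(\mathbf x,\mathcal Z,\mathcal W)$ to a point set $\mathcal Z\subset\mathbb R\times(0,1]$ with a distinguished point $\mathbf x\in\mathcal Z$ and a family $\mathcal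 W$ of numbers in $[0,1]$ indexed by $E(\mathbb R\times(0,1])$; it is translation invariant: $\xi_\infty(\mathbf x,\mathcal Z,\mathcal W)=\xi_\infty(\theta_{x_0}(\mathbf x),\theta_{x_0}(\mathcal Z),\theta_{x_0}(\mathcal W))$ for all $x_0\in\mathbb R$. Similarly, for each $t>0$, $\xi_t$ associates a nonnegative real number $\xi_t(\mathbf x,\mathcal Z,\mathcal W)$ to a point set $\mathcal Z\subset\mathbb T_t\times(0,1]$ with a distinguished point $\mathbf x\in\mathcal Z$ and a family $\mathcal W$ of numbers in $[0,1]$ indexed by $E(\mathbb T_t\times(0,1])$, and is invariant under all translations $\theta^t_{x_0}$, $x_0\in\mathbb T_t$. If $\mathbf x\notin\mathcal Z$, then $\xi_t(\mathbf x,\mathcal Z,\mathcal W)$ means $\xi_t(\mathbf x,\mathcal Z\cup\{\mathbf x\},\mathcal W)$, and likewise for $\xi_\infty$. Finally $\xi_\infty(\mathcal Z,\mathcal W):=\int_0^1\xi_\infty((0,s),\mathcal Z,\mathcal W)\,\mathrm ds$.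
   Formalization: Functionals are assumed measurable; the marks are i.i.d. uniform also along edges selected measurably from (X,U); the last equality is proved as ∫₀¹E[ξ_∞((0,s),X,V)]ds, and as E[ξ_∞(X,V)] when ξ_∞((0,s),X,V) is jointly measurable in s and the randomness. *)

(* Defs.v *)
(* MathComp-Analysis. *)
From HB Require Import structures.
From mathcomp Require Import all_boot all_order all_algebra.
From mathcomp Require Import all_classical all_reals all_analysis.

Set Implicit Arguments.
Unset Strict Implicit.
Unset Printing Implicit Defensive.

Import Order.TTheory GRing.Theory Num.Theory.
Import numFieldNormedType.Exports.

Local Open Scope classical_set_scope.
Local Open Scope ring_scope.

(* A vertex is a pair (position, birth time); an edge is a pair
   (younger endpoint, older endpoint), see [edges]. *)
Definition vertex (R : realType) : Type := (R * R)%type.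
HB.instance Definition _ (R : realType) := Measurable.on (vertex R).

Definition edge (R : realType) : Type := (vertex R * vertex R)%type.
HB.instance Definition _ (R : realType) := Measurable.on (edge R).

(* T_t is represented by its fundamental domain (-t/2, t/2]. *)
Definition torus (R : realType) (t : R) : set R := `]- (t / 2), t / 2]%classic.

Definition strip (R : realType) (G : set R) : set (vertex R) :=
  G `*` `]0, 1]%classic.

Definition edges (R : realType) (S : set (vertex R)) : set (edge R) :=
  [set e | S e.1 /\ S e.2 /\ e.2.2 < e.1.2].

Definition locally_finite (R : realType) (Z : set (vertex R)) : Prop :=
  forall r : R, finite_set (Z `&` [set p | `|p.1| <= r]).

(* These events generate the sigma-algebra of the counting maps
   Z |-> #(Z n B), B Borel. *)
Definition count_events (R : realType) : set (set (set (vertex R))) :=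
  [set C | exists B : set (vertex R), exists k : nat,
     measurable B /\ C = [set Z | (Z `&` B #= `I_k)%card]].

Definition config (R : realType) : Type :=
  g_sigma_algebraType (@count_events R).
HB.instance Definition _ (R : realType) := Measurable.on (config R).

(* A family indexed by the edges of S is a total function on [edge R] of which
   only the values on [edges S] matter. *)
Definition edge_family (R : realType) : Type := edge R -> R.

Definition point_functional (R : realType) : Type :=
  vertex R -> set (vertex R) -> edge_family R -> R.

(* The representative of y + tZ in (-t/2, t/2]. *)
Definition wrap_torus (R : realType) (t y : R) : R :=
  y - t * (Num.ceil (y / t - 2^-1))%:~R.

(* Translation by x0; [red] is the reduction of a real number to the position
   space: [id] for the line and [wrap_torus t] for the torus. *)
Definition translate (R : realType) (red : R -> R) (x0 : R) (p : vertex R) :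
  vertex R := (red (p.1 + x0), p.2).

Definition translate_family (R : realType) (red : R -> R) (x0 : R)
    (W : edge_family R) : edge_family R :=
  fun e => W (translate red (- x0) e.1, translate red (- x0) e.2).

Definition admissible (R : realType) (S : set (vertex R))
    (x : vertex R) (Z : set (vertex R)) (W : edge_family R) : Prop :=
  [/\ Z `<=` S, locally_finite Z, Z x &
      forall e, edges S e -> 0 <= W e <= 1].

(* The sigma-algebra on triples ((x, Z), W) generated by (x, Z) and by all
   evaluations of W at an edge of S that is itself a measurable function of
   (x, Z), for instance at a random edge between points of Z. *)
Definition input (R : realType) : Type :=
  ((vertex R * config R) * edge_family R)%type.

Definition input_events (R : realType) (S : set (vertex R)) :
    set (set (input R)) :=
  [set C | exists2 A : set (vertex R * config R),
     measurable A & C = [set i | A i.1]] `|`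
  [set C | exists e : vertex R * config R -> edge R, exists B : set R,
     [/\ measurable_fun setT e, forall z, edges S (e z), measurable B &
         C = [set i | B (i.2 (e i.1))]]].

(* Measurability for the trace on the admissible inputs, which need not be an
   event themselves. In particular [xi x Z W] only depends on W through its
   values on [edges S]. *)
Definition measurable_functional (R : realType) (S : set (vertex R))
    (xi : point_functional R) : Prop :=
  forall B : set R, measurable B ->
  exists2 A : set (input R), <<s input_events S >> A &
  forall x Z W, admissible S x Z W ->
    (B (xi x Z W) <-> A ((x, Z : config R), W)).

Definition translation_invariant (R : realType) (G : set R) (red : R -> R)
    (xi : point_functional R) : Prop :=
  forall x0 x Z W, G x0 -> admissible (strip G) x Z W ->
    xi x Z W = xi (translate red x0 x) (translate red x0 @` Z)
                  (translate_family red x0 W).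

Definition proper_functional (R : realType) (G : set R) (red : R -> R)
    (xi : point_functional R) : Prop :=
  [/\ forall x Z W, admissible (strip G) x Z W -> 0 <= xi x Z W,
      translation_invariant G red xi &
      measurable_functional (strip G) xi].

(* The convention xi(x, Z, W) := xi(x, Z u {x}, W) when x is not in Z. *)
Definition with_point (R : realType) (xi : point_functional R) :
    point_functional R :=
  fun x Z W => xi x (x |` Z) W.

Section random_input.
Context (R : realType) (d : measure_display) (Omega : measurableType d)
  (P : probability Omega R).

(* Intensity 1 on R x (0, 1]. The mass function below is also correct for
   m = 0, since 0 ^+ 0 = 1. *)
Definition poisson_process (X : Omega -> config R) : Prop :=
  let mu B := (lebesgue_measure \x lebesgue_measure)%E
                (B `&` strip [set: R]) in
  [/\ measurable_fun setT X,
      forall w, X w `<=` strip [set: R] /\ locally_finite (X w),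
      forall (B : set (vertex R)) (m : R) (k : nat),
        measurable B -> mu B = m%:E ->
        P [set w | (X w `&` B #= `I_k)%card] =
          (m ^+ k / k`!%:R * expR (- m))%:E &
      forall (n : nat) (B : 'I_n -> set (vertex R)) (k : 'I_n -> nat),
        (forall i, measurable (B i)) -> trivIset setT B ->
        P [set w | forall i, (X w `&` B i #= `I_(k i))%card] =
          (\prod_(i < n) P [set w | (X w `&` B i #= `I_(k i))%card])%E].

Definition uniform_mark (X : Omega -> config R) (U : Omega -> R) : Prop :=
  [/\ measurable_fun setT U,
      forall w, 0 < U w <= 1,
      forall B : set R, measurable B ->
        P (U @^-1` B) = lebesgue_measure (B `&` `]0, 1]) &
      forall (A : set (config R)) (B : set R), measurable A -> measurable B ->
        P (X @^-1` A `&` U @^-1` B) = (P (X @^-1` A) * P (U @^-1` B))%E].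

(* V is a family of i.i.d. uniform variables indexed by the edges of
   R x (0, 1], independent of (X, U). As V is evaluated at random edges, the
   product rule is required for every finite family of distinct edges selected
   measurably from (X, U), and not only for deterministic ones (the case of
   constant e). *)
Definition iid_uniform_edges (X : Omega -> config R) (U : Omega -> R)
    (V : Omega -> edge_family R) : Prop :=
  (forall w e, edges (strip [set: R]) e -> 0 <= V w e <= 1) /\
  forall (n : nat) (e : 'I_n -> config R * R -> edge R),
    (forall i, measurable_fun setT (e i)) ->
    (forall i z, edges (strip [set: R]) (e i z)) ->
    (forall z, injective (e ^~ z)) ->
    (forall i, measurable_fun setT (fun w => V w (e i (X w, U w)))) /\
    forall (A : set (config R * R)) (B : 'I_n -> set R),
      measurable A -> (forall i, measurable (B i)) ->
      P [set w | A (X w, U w) /\ forall i, B i (V w (e i (X w, U w)))] =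
        (P [set w | A (X w, U w)] *
         \prod_(i < n) lebesgue_measure (B i `&` `[0%R, 1%R]))%E.

Definition restrict_points (t : R) (X : Omega -> config R) :
    Omega -> set (vertex R) :=
  fun w => X w `&` strip (torus t).

Definition restrict_family (t : R) (V : Omega -> edge_family R) :
    Omega -> edge_family R :=
  fun w e => if e \in edges (strip (torus t)) then V w e else 0.

Definition cvg_in_probability (Y : R -> Omega -> R) (Z : Omega -> R) : Prop :=
  forall eps : R, 0 < eps ->
    P [set w | eps < `|Y t w - Z w|] @[t --> +oo] --> 0%E.

End random_input.

Definition averaged (R : realType) (xi : point_functional R)
    (Z : set (vertex R)) (W : edge_family R) : \bar R :=
  (\int[lebesgue_measure]_(s in `]0%R, 1%R])
     (with_point xi (0%R, s) Z W)%:E)%E.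

(* Main.v *)
Require Import Defs.
From HB Require Import structures.
From mathcomp Require Import all_boot all_order all_algebra finmap.
From mathcomp Require Import ring lra zify.
From mathcomp Require Import all_classical all_reals all_analysis.
From mathcomp Require Import measurable_realfun measurable_fun_approximation.
Set Implicit Arguments.
Unset Strict Implicit.
Unset Printing Implicit Defensive.
Import Order.TTheory GRing.Theory Num.Theory.
Import numFieldNormedType.Exports.
Local Open Scope classical_set_scope.
Local Open Scope ring_scope.

(** Call the value of the functional at a point its score. The average of the
scores over the points of the torus splits into an L1 part, which is controlled
by the Mecke formula, and a bounded local part, for which a second moment
computation is possible.

A point process and an i.i.d. family of edge marks are looked at through the
inputs ((x, Z), W): a distinguished point, a configuration and the marks.
Inputs carry the sigma-algebra [input_events], and the law of a random input
is determined by the events that constrain (x, Z) together with the marks at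
finitely many distinct edges ([input_measure_unique]). On such an event the
marks contribute a constant factor, so every identity in law for inputs
reduces to one for the Poisson process alone, where it is checked on the
numbers of points in the cells of a finite partition ([config_unique]). This
gives the Mecke formula for the input seen from a typical point of the torus
([mecke_integral]): summing F over all points, each one moved to the origin,
has expectation t times the expectation of F at the origin with an added
point of uniform birth time. It also gives the independence of disjoint
windows ([integral_independent]) and the disintegration over the birth time of
the added point ([integral_disintegrate]).

The moment bound makes the score at the origin uniformly integrable, hence its
convergence in probability is a convergence in L1 ([cvg_L1]) and the limit is
integrable ([limit_integrable]). Fix a large a and truncate the score of the
torus of length a at a level K. This gives a bounded function g of the input
restricted to a window of length a. For t at least 2a, let g act on the window
of length a around each point of the torus of length t. By the Mecke formula,
the L1 distance between the average of the scores and the average of g is at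
most the L1 distance of the two scores at the origin ([score_mean_local]), which
is small uniformly in t by the choice of a and K.

The average of g obeys a law of large numbers. Its square is a double sum over
pairs of points, and the Mecke formula turns it into the expectation of g at
the origin times a sum over the other points. Points at distance less than a
from the origin contribute O(1). The window of each remaining point misses the
window of the origin, so these points contribute at most the product of the
means, by independence. Thus the variance is O(1/t) ([second_moment]) and the
average of g is close in L1 to its mean ([local_law]), which is close to the
mean of the limit score.

The first formula for the mean is the disintegration over the birth time of the
origin. The second one follows from it by Tonelli's theorem. *)

(** * Counting points and selecting them measurably *)

Section counting.
Variable R : realType.
Implicit Types (B : set (vertex R)) (Z : set (vertex R)).

Definition cnt Z B : \bar R := (\esum_(x in Z) (\1_B x)%:E)%E.

Lemma cnt_ge0 Z B : (0 <= cnt Z B)%E.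
Proof. by apply: esum_ge0 => x _; rewrite lee_fin. Qed.

Lemma cntE Z B : cnt Z B = (\esum_(x in Z `&` B) 1)%E.
Proof.
rewrite /cnt esum_mkcondr; apply: eq_esum => x _.
by rewrite indicE; case: ifPn.
Qed.

Lemma sum1_fset (T : choiceType) (F : {fset T}) :
  (\sum_(x <- F) 1 = #|` F|%:R%:E :> \bar R)%E.
Proof. by rewrite sumEFin big_const_seq count_predT iter_addr_0. Qed.

Lemma cntP Z B k : (Z `&` B #= `I_k)%card <-> cnt Z B = k%:R%:E.
Proof.
rewrite cntE; move: (Z `&` B) => A; split.
  move=> Ak; have finA : finite_set A by apply/finite_setP; exists k.
  rewrite esum_fset// fsbig_finite//= sum1_fset.
  by congr (_%:R%:E); apply/card_eq_fsetP; rewrite fset_setK.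
move=> Ak; have finA : finite_set A.
  apply: contrapT => infA.
  have [F FA Fk] := infinite_set_fset k.+1 infA.
  have : (\sum_(x \in [set` F]) (1 : \bar R) <= k%:R%:E)%E.
    rewrite -Ak; apply: esum_ge. exists [set` F]; last exact: lexx.
    by split => //; exact: finite_fset.
  rewrite fsbig_finite//= set_fsetK sum1_fset lee_fin ler_nat.
  by rewrite leqNgt Fk.
move: Ak; rewrite esum_fset// fsbig_finite//= sum1_fset.
move=> [/eqP]; rewrite eqr_nat => /eqP Ak.
by move/card_eq_fsetP: Ak; rewrite fset_setK.
Qed.

Lemma finite_cnt Z B : finite_set (Z `&` B) -> exists k, cnt Z B = k%:R%:E.
Proof. by move=> /finite_setP[k /cntP]; exists k. Qed.

Lemma cnt_partition (J : finType) (A : J -> set (vertex R)) Z B :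
  trivIset setT A -> (forall x, B x <-> exists j, A j x) ->
  cnt Z B = (\sum_(j : J) cnt Z (A j))%E.
Proof.
move=> tA BA; rewrite -esum_sum; last by move=> *; rewrite lee_fin.
apply: eq_esum => x _; rewrite sumEFin; congr (_%:E).
rewrite indicE; case: (boolP (x \in B)) => [|/negP xB].
  rewrite inE => /BA[j Ajx]; rewrite (bigD1 j)//= indicE mem_set// big1 ?addr0//.
  move=> i ij; rewrite indicE memNset// => Aix.
  by move/negP: ij; apply; apply/eqP; apply: (tA i j) => //; exists x.
rewrite big1// => j _; rewrite indicE memNset// => Ajx; apply: xB.
by rewrite inE; apply/BA; exists j.
Qed.

Lemma has_count_measurable B k : measurable B ->
  measurable [set Z : config R | (Z `&` B #= `I_k)%card].
Proof. by move=> mB; apply: sub_sigma_algebra; exists B, k. Qed.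

Lemma cnt_measurable B k : measurable B ->
  measurable [set Z : config R | cnt Z B = k%:R%:E].
Proof.
move=> mB; rewrite (_ : mkset _ = [set Z : config R | (Z `&` B #= `I_k)%card]).
  exact: has_count_measurable.
by apply/seteqP; split => Z /cntP.
Qed.

End counting.

Section selection.
Variable R : realType.
Implicit Types (B : set (vertex R)) (Z : set (vertex R)) (f : vertex R -> \bar R).

Definition rbox (n : nat) : set (vertex R) :=
  if @choice.unpickle ((rat * rat) * (rat * rat))%type n is Some q then
    `]ratr q.1.1, ratr q.1.2[ `*` `]ratr q.2.1, ratr q.2.2[
  else set0.

Lemma measurable_rbox n : measurable (rbox n).
Proof.
rewrite /rbox; case: choice.unpickle => // q.
by apply: measurableX; exact: measurable_itv.
Qed.

(** A locally finite set has no accumulation point, so a small enough rational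
box around one of its points contains no other point. *)
Lemma rbox_separates Z x : locally_finite Z -> Z x ->
  exists n, Z `&` rbox n = [set x].
Proof.
move=> lfZ Zx.
pose Y : set (R * R) := (Z `&` [set p | `|p.1| <= `|x.1| + 1]) `\ (x : R * R).
have finY : finite_set Y by exact/finite_setD/lfZ.
have cY : closed Y.
  apply: (@accessible_finite_set_closed (R * R)%type).1 finY => x1 y1.
  exact: hausdorff_accessible (@norm_hausdorff R (R * R)%type) x1 y1.
have /nbhs_ballP[e /= e0 xeY] : nbhs (x : R * R) (~` Y).
  by apply: open_nbhs_nbhs; split; [exact: closed_openC|case=> _; exact].
pose r := Num.min e 1.
have r0 : 0 < r by rewrite lt_min e0 ltr01.
have rat_left (y : R) : exists q : rat, y - r < ratr q < y.
  have [q] := @rat_in_itvoo R (y - r) y ltac:(by rewrite ltrBlDr ltrDl).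
  by rewrite in_itv/=; exists q.
have rat_right (y : R) : exists q : rat, y < ratr q < y + r.
  have [q] := @rat_in_itvoo R y (y + r) ltac:(by rewrite ltrDl).
  by rewrite in_itv/=; exists q.
have [a /andP[ra ax]] := rat_left x.1; have [b /andP[xb br]] := rat_right x.1.
have [c /andP[rc cx]] := rat_left x.2; have [d /andP[xd dr]] := rat_right x.2.
exists (choice.pickle ((a, b), (c, d))); rewrite /rbox choice.pickleK/=.
apply/seteqP; split => [p [Zp [/=]]|p ->]; last first.
  by split => //; split; rewrite /= in_itv/= ?ax ?cx.
rewrite !in_itv/= => /andP[ap pb] /andP[cp pd].
apply: contrapT => px; apply: (xeY p).
  split => /=; rewrite /ball/= ltr_norml.
    rewrite ltrBrDl ltrBlDr.
    have : r <= e by rewrite ge_min lexx.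
    by move=> re; apply/andP; split; lra.
  have : r <= e by rewrite ge_min lexx.
  by move=> re; apply/andP; split; lra.
split => //; split => //=.
have r1 : r <= 1 by rewrite ge_min lexx orbT.
rewrite -[p.1](subrK x.1) addrC (le_trans (ler_normD _ _))// lerD2l ler_norml.
by apply/andP; split; lra.
Qed.

Definition isolates n Z : Prop := (Z `&` rbox n #= `I_1)%card.

(** When the n-th box holds exactly one point of the configuration, that point;
the default value is arbitrary. *)
Definition sel n Z : vertex R :=
  if `[< isolates n Z >] then xget (0, 0) (Z `&` rbox n) else (0, 0).

(** Each point is isolated by many boxes. The clause on smaller indices keeps only
the first of them, so that every point is selected exactly once. *)
Definition selects n Z : Prop := isolates n Z /\
  forall j, (j < n)%N ->
    ~ (isolates j Z /\ (Z `&` (rbox j `&` rbox n) #= `I_1)%card).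

Lemma card1P (T : pointedType) (A : set T) :
  (A #= `I_1)%card <-> exists x, A = [set x].
Proof.
split => [|[x ->]]; last exact: card_set1.
move=> /card_set_bijP [f [fS finj fsurj]]; have [x Ax _] := fsurj 0%N isT.
exists x; apply/seteqP; split => [y Ay|_ ->//].
apply: finj; rewrite ?inE//.
by have := fS _ Ay; have := fS _ Ax; case: (f x) (f y) => [|?] [|?].
Qed.

Lemma isolatesP n Z : isolates n Z <-> Z `&` rbox n = [set sel n Z].
Proof.
split => [nZ|e]; last by rewrite /isolates e; exact: card_set1.
rewrite /sel asboolT//; move/card1P: nZ => [x e].
by rewrite e; congr [set _]; apply/esym/xget_unique.
Qed.

Lemma sel_unique n Z x : Z `&` rbox n = [set x] -> isolates n Z /\ sel n Z = x.
Proof.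
move=> e; have iZ : isolates n Z by rewrite /isolates e; exact: card_set1.
by split => //; move/isolatesP: iZ; rewrite e => e'; have : [set x] x by []; rewrite e'.
Qed.

Lemma sel_in n Z : isolates n Z -> (Z `&` rbox n) (sel n Z).
Proof. by move=> /isolatesP ->. Qed.

Lemma selects_bij Z : locally_finite Z -> set_bij [set n | selects n Z] Z (sel ^~ Z).
Proof.
move=> lfZ.
have same j n : isolates j Z -> isolates n Z ->
    (Z `&` (rbox j `&` rbox n) #= `I_1)%card <-> sel j Z = sel n Z.
  move=> jZ nZ; rewrite setIIr; move/isolatesP: (jZ) => ->.
  move/isolatesP: (nZ) => ->; split => [/card1P[x e]|->].
    by have : [set x] x by []; rewrite -e => -[/= -> ->].
  by rewrite setIid; exact: card_set1.
split.
- by move=> n [nZ _]; exact: (sel_in nZ).1.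
- move=> m n; rewrite !inE => -[mZ mm] [nZ nn] /= e.
  apply/eqP; rewrite eqn_leq; apply/andP; split; rewrite leqNgt; apply/negP => lt.
    by apply: (mm n lt); split => //; exact/same.
  by apply: (nn m lt); split => //; exact/same.
- move=> x Zx; have /cid[n0 n0x] := rbox_separates lfZ Zx.
  have ex : exists n, `[< Z `&` rbox n = [set x] >] by exists n0; apply/asboolP.
  case: (ex_minnP ex) => n /asboolP nx nmin.
  have [nZ selx] := sel_unique nx.
  exists n => //; split => // j jn [jZ /same -/(_ jZ nZ)] e.
  have : (n <= j)%N by apply: nmin; apply/asboolP; rewrite -selx -e; exact/isolatesP.
  by rewrite leqNgt jn.
Qed.

(** The reason for the selection: a sum over a random set becomes a series with a
deterministic index set and measurable terms. *)
Lemma sum_sel Z f : locally_finite Z -> (forall x, 0 <= f x)%E ->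
  (\esum_(x in Z) f x =
   \sum_(n <oo) if `[< selects n Z >] then f (sel n Z) else 0)%E.
Proof.
move=> lfZ f0; rewrite (reindex_esum _ _ _ f (selects_bij lfZ)).
rewrite nneseries_esumT; last by move=> n; case: ifP.
rewrite esum_mkcond; apply: eq_esum => n _.
by have [h|h] := pselect (selects n Z); [rewrite mem_set// asboolT|rewrite memNset// asboolF].
Qed.

Lemma measurable_isolates n : measurable [set Z : config R | isolates n Z].
Proof. exact: has_count_measurable (measurable_rbox n). Qed.

Lemma measurable_selects n : measurable [set Z : config R | selects n Z].
Proof.
rewrite (_ : mkset _ = [set Z : config R | isolates n Z] `&` \bigcap_(j in `I_n)
  ~` ([set Z : config R | isolates j Z] `&`
      [set Z : config R | (Z `&` (rbox j `&` rbox n) #= `I_1)%card]))//.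
apply: measurableI; first exact: measurable_isolates.
apply: bigcap_measurableType => j _; apply: measurableC; apply: measurableI.
  exact: measurable_isolates.
by apply: has_count_measurable; apply: measurableI; exact: measurable_rbox.
Qed.

Lemma measurable_sel n : measurable_fun [set: config R] (sel n).
Proof.
move=> _ B mB; rewrite setTI.
rewrite (_ : _ @^-1` B = ([set Z : config R | isolates n Z] `&`
     [set Z : config R | (Z `&` (rbox n `&` B) #= `I_1)%card]) `|`
   (~` [set Z : config R | isolates n Z] `&` (if `[< B (0, 0) >] then setT else set0))).
  apply: measurableU; apply: measurableI.
  - exact: measurable_isolates.
  - by apply: has_count_measurable; apply: measurableI => //; exact: measurable_rbox.
  - by apply: measurableC; exact: measurable_isolates.
  - by case: ifP.
apply/seteqP; split => Z /=.
  have [nZ|nZ] := pselect (isolates n Z).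
    move=> Bs; left; split => //; rewrite setIA; move/isolatesP: (nZ) => ->.
    rewrite (_ : _ `&` _ = [set sel n Z]); first exact: card_set1.
    by apply/seteqP; split => [x []//|_ ->].
  by rewrite /sel asboolF// => B0; right; split => //; rewrite asboolT.
move=> [[nZ]|[nZ]].
  rewrite setIA; move/isolatesP: (nZ) => -> /card1P[x e].
  by have : [set x] x by []; rewrite -e => -[-> ].
by case: ifPn => [/asboolP B0 _|_ //]; rewrite /sel asboolF.
Qed.

End selection.

(** * Measurable maps into the space of configurations *)

Lemma measurable_preimage d1 d2 (T1 : measurableType d1) (T2 : measurableType d2)
  (f : T1 -> T2) (B : set T2) :
  measurable_fun setT f -> measurable B -> measurable (f @^-1` B).
Proof. by move=> mf mB; rewrite -[X in measurable X]setTI; exact: mf. Qed.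

Section config_measurability.
Variable R : realType.
Implicit Types (B : set (vertex R)) (Z : set (vertex R)).

Lemma measurable_locally_finite : measurable [set Z : config R | locally_finite Z].
Proof.
pose W (n : nat) : set (vertex R) := [set p | `|p.1| <= n%:R].
have mW n : measurable (W n).
  rewrite (_ : W n = `[- n%:R, n%:R] `*` setT).
    by apply: measurableX => //; exact: measurable_itv.
  by apply/seteqP; split => p /=; rewrite in_itv/= -ler_norml// => -[].
rewrite (_ : mkset _ = \bigcap_n \bigcup_k
    [set Z : config R | (Z `&` W n #= `I_k)%card]).
  apply: bigcap_measurableType => n _; apply: bigcup_measurable => k _.
  exact: has_count_measurable.
apply/seteqP; split => Z.
  by move=> lfZ n _; have /finite_setP[k Zk] := lfZ n%:R; exists k.
move=> h r; apply: (@sub_finite_set _ _ (Z `&` W (Num.bound `|r|))).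
  apply: setIS => p /= /le_trans; apply.
  by rewrite (le_trans (ler_norm _))// ltW// archi_boundP.
by apply/finite_setP; have [k _ Zk] := h (Num.bound `|r|) I; exists k.
Qed.

Lemma sub_locally_finite Z1 Z2 : Z1 `<=` Z2 -> locally_finite Z2 -> locally_finite Z1.
Proof.
by move=> Z12 lf2 r; apply: sub_finite_set (lf2 r); exact: setSI.
Qed.

Lemma finite_locally_finite Z : finite_set Z -> locally_finite Z.
Proof. by move=> fZ r; exact: finite_setIl. Qed.

Section into_config.
Context d (T : measurableType d).

Lemma measurable_config D (f : T -> config R) : measurable D ->
  (forall B k, measurable B -> measurable (D `&` [set t | cnt (f t) B = k%:R%:E])) ->
  measurable_fun D f.
Proof.
move=> mD h; apply: (@measurability _ _ _ _ D f (@count_events R)) => //.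
move=> _ [_ [B [k [mB ->]]] <-].
rewrite (_ : _ `&` _ = D `&` [set t | cnt (f t) B = k%:R%:E]); first exact: h.
by apply/seteqP; split => t [Dt]; split => //; apply/cntP.
Qed.

Lemma measurable_fun_esum D (z : T -> config R) (f : T * vertex R -> \bar R) :
  measurable D -> measurable_fun setT z -> measurable_fun setT f ->
  (forall q, 0 <= f q)%E -> (forall t, D t -> locally_finite (z t)) ->
  measurable_fun D (fun t => \esum_(p in (z t : set (vertex R))) f (t, p))%E.
Proof.
move=> mD mz mf f0 lf.
apply: (@eq_measurable_fun _ _ _ _ D (fun t => \sum_(n <oo)
    if `[< selects n (z t) >] then f (t, sel n (z t)) else 0)%E).
  by move=> t /[!inE] Dt; rewrite sum_sel//; exact: lf.
apply: (ge0_emeasurable_sum (P := predT)) => [n t _ _|n _]; first by case: ifP.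
apply: (@measurable_funS _ _ _ _ setT) => //.
apply: measurable_fun_ifT => //=.
- apply: (@measurable_fun_bool _ _ _ _ true); rewrite setTI.
  rewrite (_ : _ @^-1` _ = z @^-1` [set Z | selects n Z]).
    exact: measurable_preimage mz (measurable_selects _).
  by apply/seteqP; split => t /=; [move/asboolP|move=> h; apply/asboolP].
- have mg : measurable_fun setT (fun t => (t, sel n (z t))).
    apply: measurable_fun_pair => //; apply: measurableT_comp mz.
    exact: measurable_sel.
  exact: measurableT_comp mf mg.
Qed.

Lemma measurable_cnt D (z : T -> config R) B : measurable D ->
  measurable_fun setT z -> (forall t, D t -> locally_finite (z t)) ->
  measurable B -> measurable_fun D (fun t => cnt (z t) B).
Proof.
move=> mD mz lf mB.
apply: (measurable_fun_esum (f := fun q => (\1_B q.2)%:E)) => //.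
  apply/measurable_EFinP; apply: measurableT_comp => //.
Qed.

Lemma measurable_fun_asbool D (f : T -> Prop) : measurable D ->
  measurable (D `&` [set t | f t]) -> measurable_fun D (fun t => `[< f t >]).
Proof.
move=> mD mf; apply: (@measurable_fun_bool _ _ _ _ true).
rewrite (_ : _ `&` _ = D `&` [set t | f t])//.
by apply/seteqP; split => t /= [Dt /asboolP ft]; split => //; apply/asboolP.
Qed.

Lemma measurable_config_if D (f : T -> config R) : measurable D ->
  (forall B, measurable B -> measurable_fun D (fun t => cnt (f t) B)) ->
  measurable_fun setT (fun t => (if `[< D t >] then f t else set0) : config R).
Proof.
move=> mD h; apply: measurable_config => // B k mB; rewrite setTI.
rewrite (_ : mkset _ = (D `&` (fun t => cnt (f t) B) @^-1` [set k%:R%:E]) `|`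
    (~` D `&` [set _ | cnt (set0 : set (vertex R)) B = k%:R%:E])).
  apply: measurableU; first by apply: h => //; exact: emeasurable_set1.
  apply: measurableI; first exact: measurableC.
  by have [e|e] := pselect (cnt (set0 : set (vertex R)) B = k%:R%:E);
    [rewrite (_ : mkset _ = setT)|rewrite (_ : mkset _ = set0)] => //;
    apply/seteqP; split.
apply/seteqP; split => t /=.
  by have [Dt|Dt] := pselect (D t); [rewrite asboolT//|rewrite asboolF//];
   [left|right].
by move=> [[Dt]|[Dt]]; [rewrite asboolT|rewrite asboolF].
Qed.

End into_config.

(** The points of a locally finite configuration can be selected measurably; the
default value elsewhere keeps the map measurable. *)
Definition ins (y : vertex R) (Z : config R) : config R :=
  if `[< locally_finite Z >] then y |` Z else set0.

Definition restr (S : set (vertex R)) (Z : config R) : config R := Z `&` S.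

Lemma measurable_restr S : measurable S -> measurable_fun setT (restr S).
Proof.
move=> mS; apply: measurable_config => // B k mB; rewrite setTI.
rewrite (_ : mkset _ = [set Z : config R | cnt Z (S `&` B) = k%:R%:E]).
  by apply: cnt_measurable; exact: measurableI.
by apply/seteqP; split => Z /=; rewrite !cntE /restr setIA.
Qed.

Lemma measurable_vertex_eq d (T : measurableType d) (f g : T -> vertex R) :
  measurable_fun setT f -> measurable_fun setT g ->
  measurable [set t | f t = g t].
Proof.
move=> /measurable_fun_pairP[f1 f2] /measurable_fun_pairP[g1 g2].
rewrite (_ : mkset _ = (fun t => (f t).1 == (g t).1) @^-1` [set true] `&`
                       (fun t => (f t).2 == (g t).2) @^-1` [set true]).
  by apply: measurableI; rewrite -[X in measurable X]setTI;
    apply: measurable_fun_eqr.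
apply/seteqP; split => t /=; first by move=> ->; rewrite !eqxx.
by move=> [/eqP e1 /eqP e2]; rewrite [LHS]surjective_pairing e1 e2 -surjective_pairing.
Qed.

(** Membership is visible to the counting events because a point of a locally
finite set is the single point of some rational box. *)
Lemma measurable_mem : measurable [set q : vertex R * config R | locally_finite q.2 /\ q.2 q.1].
Proof.
rewrite (_ : mkset _ = (snd @^-1` [set Z : config R | locally_finite Z]) `&`
   \bigcup_n (snd @^-1` [set Z : config R | isolates n Z] `&`
              [set q : vertex R * config R | sel n q.2 = q.1])).
  apply: measurableI.
    exact: measurable_preimage measurable_snd measurable_locally_finite.
  apply: bigcupT_measurable => n; apply: measurableI.
    exact: measurable_preimage measurable_snd (measurable_isolates _).
  apply: measurable_vertex_eq => //.
  by apply: measurableT_comp => //; exact: measurable_sel.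
apply/seteqP; split => [[y Z]/= [lf Zy]|[y Z]/= [lf [n _ [/= nZ <-]]]]; split => //.
  have [n /sel_unique[nZ ns]] := rbox_separates lf Zy.
  by exists n.
exact: (sel_in nZ).1.
Qed.

Lemma cnt_setU1 y Z B : ~ Z y -> cnt (y |` Z) B = ((\1_B y)%:E + cnt Z B)%E.
Proof.
move=> Zy; rewrite /cnt (esumID [set y]) => [|x _]; last by rewrite lee_fin.
congr (_ + _)%E; last first.
  rewrite (_ : _ `&` ~` _ = Z)//; apply/seteqP; split => [x [[->|//] xy]|x Zx].
    by case: xy.
  by split; [right|move=> e; apply: Zy; rewrite -e].
rewrite (_ : _ `&` _ = [set y]); last first.
  by apply/seteqP; split => [x []//|x ->]; split => //; left.
by rewrite esum_set1// lee_fin.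
Qed.

(** The count of the enlarged set depends on whether the new point is already
present, which is itself a measurable event. *)
Lemma measurable_ins : measurable_fun setT (fun q : vertex R * config R => ins q.1 q.2).
Proof.
have mD : measurable (snd @^-1` [set Z : config R | locally_finite Z] : set (vertex R * config R)).
  exact: measurable_preimage measurable_snd measurable_locally_finite.
apply: (measurable_config_if mD) => B mB.
apply: (@eq_measurable_fun _ _ _ _ _ (fun q : vertex R * config R =>
   if `[< q.2 q.1 >] then cnt q.2 B else (\1_B q.1)%:E + cnt q.2 B)%E).
  move=> q _; case: asboolP => qq; last by rewrite cnt_setU1.
  by congr cnt; apply/seteqP; split => [x|x [->//|//]]; right.
have mc : measurable_fun (snd @^-1` [set Z : config R | locally_finite Z])
    (fun q : vertex R * config R => cnt q.2 B) by exact: measurable_cnt.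
apply: measurable_fun_if => //.
- apply: measurable_fun_asbool => //; rewrite (_ : _ `&` _ =
    [set q : vertex R * config R | locally_finite q.2 /\ q.2 q.1])//.
  exact: measurable_mem.
- by apply: measurable_funS mc => //; exact: subIsetl.
- apply: (@measurable_funS _ _ _ _ (snd @^-1` [set Z : config R | locally_finite Z])) => //.
  apply: emeasurable_funD => //; apply/measurable_EFinP.
  by apply: (@measurable_funS _ _ _ _ setT) => //; apply: measurableT_comp.
Qed.

End config_measurability.

(** * The torus, its area and its translations *)

Section wrap.
Variables (R : realType) (t : R).
Hypothesis t0 : 0 < t.
Local Notation wrap := (wrap_torus t).

Lemma wrap_shift y : exists z : int, wrap y = y + t * z%:~R.
Proof. by exists (- Num.ceil (y / t - 2^-1)); rewrite /wrap_torus rmorphN mulrN. Qed.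

Lemma wrap_in y : torus t (wrap y).
Proof.
rewrite /torus /= in_itv/= /wrap_torus; set c := Num.ceil _.
have h1 : y / t - 2^-1 <= c%:~R by rewrite ceil_ge.
have h2 : c%:~R < y / t - 2^-1 + 1.
  by have := gt_pred_ceil (y / t - 2^-1); rewrite -/c rmorphB/= ltrBlDr.
have e : y = t * (y / t) by field; rewrite gt_eqF.
have a1 : t * (y / t - 2^-1) <= t * c%:~R by rewrite ler_pM2l.
have a2 : t * c%:~R < t * (y / t - 2^-1 + 1) by rewrite ltr_pM2l.
by apply/andP; split; lra.
Qed.

(** The half-open interval meets each class modulo t only once. *)
Lemma torus_shift_uniq y (z : int) : torus t y -> torus t (y + t * z%:~R) -> z = 0.
Proof.
rewrite /torus /= !in_itv/= => /andP[a b] /andP[c e].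
have h1 : t * z%:~R < t * 1 by lra.
have h2 : t * (-1) < t * z%:~R by lra.
move: h1 h2; rewrite !ltr_pM2l// => h1 h2.
have z1 : z < 1 by rewrite -(ltr_int R).
have z2 : -1 < z by rewrite -(ltr_int R).
lia.
Qed.

Lemma wrap_torus_id y : torus t y -> wrap y = y.
Proof.
move=> ty; have [z e] := wrap_shift y.
have := wrap_in y; rewrite e => /(torus_shift_uniq ty) ->.
by rewrite mulr0 addr0.
Qed.

Lemma wrap_mod y (z : int) : wrap (y + t * z%:~R) = wrap y.
Proof.
have [z1 e1] := wrap_shift (y + t * z%:~R); have [z2 e2] := wrap_shift y.
have e : wrap (y + t * z%:~R) = wrap y + t * (z + z1 - z2)%:~R.
  by rewrite e1 e2 !intrD rmorphN; lra.
have := wrap_in (y + t * z%:~R); rewrite e => /(torus_shift_uniq (wrap_in y)) ->.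
by rewrite mulr0 addr0.
Qed.

Lemma wrapDr a b : wrap (a + wrap b) = wrap (a + b).
Proof. by have [z ->] := wrap_shift b; rewrite addrA wrap_mod. Qed.

Lemma wrapBr a b : wrap (a - wrap b) = wrap (a - b).
Proof.
have [z ->] := wrap_shift b; rewrite opprD addrA -(wrap_mod (a - b) (- z)).
by rewrite rmorphN mulrN.
Qed.

Lemma wrapDl a b : wrap (wrap a + b) = wrap (a + b).
Proof. by rewrite addrC wrapDr addrC. Qed.

Lemma measurable_wrap : measurable_fun setT wrap.
Proof.
apply: measurable_funB => //; apply: measurable_funM => //.
apply: nondecreasing_measurable => // x y xy; rewrite ler_int ceil_le// lerD2r.
by rewrite ler_pM2r// invr_gt0.
Qed.

End wrap.

(** Product Lebesgue measure, transported to the measurable structure that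
configurations use for their points. *)
Definition area (R : realType) : set (vertex R) -> \bar R :=
  (lebesgue_measure \x lebesgue_measure)%E.
Section area_measure.
Variable R : realType.
Let m : {measure set (measurableTypeR R * measurableTypeR R)%type -> \bar R} :=
  (@lebesgue_measure R \x @lebesgue_measure R)%E.
Let area0 : @area R set0 = 0%E. Proof. exact: (measure0 m). Qed.
Let area_ge0 A : (0 <= @area R A)%E. Proof. exact: (measure_ge0 m). Qed.
Let area_sigma_additive : semi_sigma_additive (@area R).
Proof. exact: (@measure_semi_sigma_additive _ _ _ m). Qed.
HB.instance Definition _ := isMeasure.Build _ _ _ (@area R)
  area0 area_ge0 area_sigma_additive.
End area_measure.

Section translation_invariance.
Variable R : realType.

Lemma lebesgue_measure_shift (b : R) (A : set R) : measurable A ->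
  lebesgue_measure ((fun x => x + b) @^-1` A) = lebesgue_measure A.
Proof.
move=> mA; have mf : measurable_fun setT (fun x : R => x + b) by exact: measurable_funD.
apply/esym/(@lebesgue_measure_unique _ (pushforward lebesgue_measure
  (fun x : measurableTypeR R => (x + b : measurableTypeR R)))) => //.
move=> _ [[u v] _ <-]; rewrite /pushforward.
rewrite [X in _ = lebesgue_measure X](_ : _ = `]u - b, v - b]%classic).
  rewrite !lebesgue_measure_itv/= !lte_fin ltrD2r.
  by case: ifP => // _; rewrite -!EFinB; congr (_%:E); ring.
by apply/seteqP; split => x /=; rewrite !in_itv/= ltrBlDr lerBrDr.
Qed.

Lemma area_unique (m : {measure set (vertex R) -> \bar R}) :
  (forall A B : set R, measurable A -> measurable B ->
    m (A `*` B) = (lebesgue_measure A * lebesgue_measure B)%E) ->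
  forall E, measurable E -> area E = m E.
Proof.
have m0 : (m : set (measurableTypeR R * measurableTypeR R) -> \bar R) set0 = 0%E.
  exact: measure0.
have mge0 A : (0 <= (m : set (measurableTypeR R * measurableTypeR R) -> \bar R) A)%E.
  exact: measure_ge0.
have msa : semi_sigma_additive (m : set (measurableTypeR R * measurableTypeR R) -> \bar R).
  exact: (@measure_semi_sigma_additive _ _ _ m).
pose mm := isMeasure.Build _ _ _ _ m0 mge0 msa.
pose m' : {measure set (measurableTypeR R * measurableTypeR R)%type -> \bar R} :=
  HB.pack (m : set (measurableTypeR R * measurableTypeR R) -> \bar R) mm.
exact: (@product_measure_unique _ _ _ _ R lebesgue_measure lebesgue_measure m').
Qed.

Lemma area_shift (b : R) (E : set (vertex R)) : measurable E ->
  area ((fun p : vertex R => (p.1 + b, p.2)) @^-1` E) = area E.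
Proof.
move=> mE; have mf : measurable_fun setT (fun p : vertex R => (p.1 + b, p.2) : vertex R).
  by apply: measurable_fun_pair => //; exact: measurable_funD.
apply/esym/(@area_unique
  (pushforward (@area R) (fun p : vertex R => (p.1 + b, p.2) : vertex R))) => //.
move=> A B mA mB; rewrite /pushforward.
rewrite [X in area X = _](_ : _ = ((fun x => x + b) @^-1` A) `*` B)//.
have mA' : measurable ((fun x : R => x + b) @^-1` A).
  by apply: measurable_preimage => //; exact: measurable_funD.
rewrite [LHS]product_measure1E//; congr (_ * _)%E.
exact: lebesgue_measure_shift.
Qed.

Lemma measurable_strip (G : set R) : measurable G -> measurable (strip G).
Proof. by move=> mG; apply: measurableX => //; exact: measurable_itv. Qed.

Lemma measurable_torus (t : R) : measurable (torus t).
Proof. exact: measurable_itv. Qed.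

Lemma measurable_translate (t a : R) : 0 < t ->
  measurable_fun setT (translate (wrap_torus t) a).
Proof.
move=> t0; apply: measurable_fun_pair => //.
apply: measurableT_comp; first exact: measurable_wrap.
exact: measurable_funD.
Qed.

(** A translation of the torus is a shift of the line followed by cutting the
strip into pieces and shifting them back by multiples of t. *)
Lemma area_translate (t a : R) (B : set (vertex R)) : 0 < t -> measurable B ->
  area (strip (torus t) `&` translate (wrap_torus t) a @^-1` B) =
  area (strip (torus t) `&` B).
Proof.
move=> t0 mB; rewrite (_ : translate _ a = translate (wrap_torus t) (wrap_torus t a)); last first.
  by apply/funext => p; rewrite /translate wrapDr.
have := wrap_in t0 a; move: (wrap_torus t a) => b tb.
have mS := measurable_strip (measurable_torus t).
(* For x and b in the torus, x + b is brought back by -t, 0 or t. *)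
pose s (i : nat) := b + t * (i%:Z - 1)%:~R.
pose T c (p : vertex R) : vertex R := (p.1 + c, p.2).
have mT c : measurable_fun setT (T c).
  by apply: measurable_fun_pair => //; exact: measurable_funD.
pose G i := strip (torus t) `&` B `&` T (- s i) @^-1` strip (torus t).
pose F i := T (s i) @^-1` G i.
have mG i : measurable (G i).
  apply: measurableI; first exact: measurableI.
  exact: measurable_preimage.
have mF i : measurable (F i) by exact: measurable_preimage.
have TK c : cancel (T c) (T (- c)) by case=> x y; rewrite /T/= addrK.
have FE i p : F i p <-> [/\ strip (torus t) p, strip (torus t) (T (s i) p) & B (T (s i) p)].
  by rewrite /F /G /= TK; split => [[[]]|[]].
have sB i j : s j = s i + t * (j%:Z - i%:Z)%:~R by rewrite /s !rmorphB/=; ring.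
have uniq i j (x : R) : torus t (x + s i) -> torus t (x + s j) -> i = j.
  rewrite (sB i j) (addrA x (s i)) => h h'.
  by have /eqP := torus_shift_uniq t0 h h'; rewrite subr_eq0 => /eqP[->].
have tG : trivIset setT G.
  move=> i j _ _ [q [[_ [/= qi _]] [_ [/= qj _]]]]; apply: (uniq _ _ (q.1 - s i - s j)).
    by rewrite addrAC subrK.
  by rewrite subrK.
have tF : trivIset setT F.
  move=> i j _ _ [p [/FE[_ [/= pi _] _] /FE[_ [/= pj _] _]]].
  exact: uniq pi pj.
have small (x : R) (z : int) : torus t x -> torus t (x + b + t * z%:~R) ->
    exists2 i : nat, (i < 3)%N & z = i%:Z - 1.
  move: tb; rewrite /torus/= !in_itv/= => /andP[b1 b2] /andP[x1 x2] /andP[z1 z2].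
  have h1 : t * z%:~R < t * 2 by lra.
  have h2 : t * (- 2) < t * z%:~R by lra.
  move: h1 h2; rewrite !ltr_pM2l// => h1 h2.
  have h3 : z < 2 by rewrite -(ltr_int R).
  have h4 : -2 < z by rewrite -(ltr_int R).
  by exists (absz (z + 1)); lia.
have -> : strip (torus t) `&` translate (wrap_torus t) b @^-1` B = \bigcup_(i in `I_3) F i.
  apply/seteqP; split => [p [Sp Bp]|p [i _ /FE[Sp [/= si _] Bp]]].
    have [z e] := wrap_shift t (p.1 + b).
    have zt : torus t (p.1 + b + t * z%:~R) by rewrite -e; exact: wrap_in.
    have [i i3 zi] := small _ _ Sp.1 zt.
    have Te : T (s i) p = translate (wrap_torus t) b p.
      by rewrite /T /s /translate e zi addrA.
    by exists i => //; apply/FE; rewrite Te; split => //; split; [exact: wrap_in|exact: Sp.2].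
  split => //=; rewrite /translate.
  suff -> : wrap_torus t (p.1 + b) = p.1 + s i by [].
  by rewrite -(wrap_mod t0 _ (i%:Z - 1)) -addrA wrap_torus_id.
have -> : strip (torus t) `&` B = \bigcup_(i in `I_3) G i.
  apply/seteqP; split => [p [Sp Bp]|p [i _ []//]].
  have [z e] := wrap_shift t (p.1 - b).
  have zt : torus t (p.1 - b + t * z%:~R) by rewrite -e; exact: wrap_in.
  have [i i3 zi] : exists2 i : nat, (i < 3)%N & - z = i%:Z - 1.
    apply: (small _ _ zt); rewrite rmorphN mulrN.
    by rewrite addrAC addrK subrK; exact: Sp.1.
  exists i => //; split => //; split; last exact: Sp.2.
  suff -> : (T (- s i) p).1 = p.1 - b + t * z%:~R by [].
  by rewrite /T /s /= -zi rmorphN mulrN opprB; ring.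
have bigcupE (H : nat -> set (vertex R)) : (forall i, measurable (H i)) -> trivIset setT H ->
    area (\bigcup_(i in `I_3) H i) = (\sum_(i <oo | i \in `I_3) area (H i))%E.
  move=> mH tH; apply: measure_bigcup => //.
  exact: sub_trivIset tH.
have eF := bigcupE _ mF tF; have eG := bigcupE _ mG tG.
have FG i : area (F i) = area (G i) by apply: area_shift; exact: mG.
by rewrite eF eG; apply: eq_eseriesr => i _.
Qed.

End translation_invariance.

(** * Counts determine the law of a finite configuration *)

Section uniqueness.
Variable R : realType.
Implicit Types (B C : set (vertex R)).

Definition counts_event (I : finType) (B : I -> set (vertex R)) (k : I -> nat) :
  set (config R) := [set Z : config R | forall i, cnt Z (B i) = (k i)%:R%:E].

Lemma measurable_counts_event (I : finType) (B : I -> set (vertex R)) (k : I -> nat) :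
  (forall i, measurable (B i)) -> measurable (counts_event B k).
Proof.
move=> mB; rewrite (_ : counts_event B k =
    \bigcap_(i in [set: I]) [set Z : config R | cnt Z (B i) = (k i)%:R%:E]).
  by apply: fin_bigcap_measurable => // i _; exact: cnt_measurable.
by apply/seteqP; split => [Z h i _|Z h i]; exact: h.
Qed.

Lemma cnt_partition_cond (J : finType) (A : J -> set (vertex R)) (Q : pred J) Z B :
  trivIset setT A -> (forall x, B x <-> exists j, Q j /\ A j x) ->
  cnt Z B = (\sum_(j | Q j) cnt Z (A j))%E.
Proof.
move=> tA BA; rewrite (@cnt_partition _ _ (fun j => if Q j then A j else set0)).
- rewrite [RHS]big_mkcond; apply: eq_bigr => j _; case: ifP => // _.
  by rewrite cntE setI0 esum_set0.
- by move=> i j _ _ [x []]; case: (Q i) => //; case: (Q j) => // Ai Aj; apply: tA => //; exists x.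
- move=> x; rewrite BA; split => [[j [Qj Aj]]|[j]]; first by exists j; rewrite Qj.
  by case: ifP => // Qj Aj; exists j.
Qed.

Definition finite_configs : set (config R) := [set Z : config R | finite_set Z].

Lemma measurable_finite_configs : measurable finite_configs.
Proof.
rewrite (_ : finite_configs = \bigcup_k [set Z : config R | (Z `&` setT #= `I_k)%card]).
  by apply: bigcupT_measurable => k; exact: has_count_measurable.
apply/seteqP; split => Z.
  by move=> /finite_setP[k Zk]; exists k => //; rewrite /= setIT.
by move=> [k _ /=]; rewrite setIT => Zk; apply/finite_setP; exists k.
Qed.

(** Arbitrary counting events reduce to partitions: the cells of the algebra
generated by finitely many sets form a partition, and on finite configurations a
counting event is a countable disjoint union of events that prescribe all cell
counts. The set C is adjoined to the generators so that, for the Mecke formula,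
every cell lies on one side of it. *)
Lemma config_unique C (m1 m2 : {measure set (config R) -> \bar R}) :
  measurable C -> (m1 setT < +oo)%E ->
  m1 (~` finite_configs) = 0%E -> m2 (~` finite_configs) = 0%E ->
  (forall (J : finType) (A : J -> set (vertex R)) (k : J -> nat),
     (forall j, measurable (A j)) -> trivIset setT A -> (forall x, exists j, A j x) ->
     (forall j, A j `<=` C \/ A j `<=` ~` C) ->
     m1 (counts_event A k) = m2 (counts_event A k)) ->
  forall E, measurable E -> m1 E = m2 E.
Proof.
move=> mC m1oo m1fin m2fin agree.
pose G : set (set (config R)) := [set E | exists n (B : 'I_n -> set (vertex R)) (k : 'I_n -> nat),
  (forall i, measurable (B i)) /\ E = counts_event B k].
have Gm : G `<=` measurable.
  by move=> _ [n [B [k [mB ->]]]]; exact: measurable_counts_event.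
have GT : G setT.
  exists 0%N, (fun=> set0), (fun=> 0%N); split => //.
  by apply/seteqP; split => // Z _ [].
apply: (@measure_unique _ _ _ G (fun=> setT)) => //.
- apply/seteqP; split; last exact: smallest_sub (@sigma_algebra_measurable _ _) Gm.
  apply: (@smallest_sub _ _ (@count_events R)).
    exact: smallest_sigma_algebra.
  move=> _ [B [k [mB ->]]]; apply: sub_sigma_algebra.
  exists 1%N, (fun=> B), (fun=> k); split => //.
  by apply/seteqP; split => Z /= => [/cntP h _//|h]; apply/cntP; exact: (h ord0).
- move=> _ _ [n1 [B1 [k1 [mB1 ->]]]] [n2 [B2 [k2 [mB2 ->]]]].
  exists (n1 + n2)%N, (fun i => match fintype.split i with inl i => B1 i | inr i => B2 i end),
    (fun i => match fintype.split i with inl i => k1 i | inr i => k2 i end); split.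
    by move=> i; case: fintype.split.
  apply/seteqP; split => [Z [h1 h2] i|Z h]; first by case: fintype.split.
  split => i; first by have := h (lshift _ i); rewrite (fintype.unsplitK (inl i)).
  by have := h (rshift _ i); rewrite (fintype.unsplitK (inr i)).
- by rewrite bigcup_const//; exists 0%N.
move=> _ [n [B [k [mB ->]]]].
have mE := measurable_counts_event k mB.
pose B' (i : 'I_n.+1) := if unlift ord0 i is Some j then B j else C.
have B'0 : B' ord0 = C by rewrite /B' unlift_none.
have B'S i : B' (lift ord0 i) = B i by rewrite /B' liftK.
have mB' i : measurable (B' i) by rewrite /B'; case: unlift.
(* The cells of the algebra generated by C and the sets B i. *)
pose A (s : {ffun 'I_n.+1 -> bool}) := [set x | forall i, s i = `[< B' i x >]].
have mA s : measurable (A s).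
  rewrite (_ : A s = \bigcap_(i in [set: 'I_n.+1]) (if s i then B' i else ~` B' i)).
    apply: fin_bigcap_measurable => // i _; case: (s i) => //.
    exact: measurableC.
  apply/seteqP; split => [x h i _|x h i].
    by rewrite (h i); case: asboolP.
  by have := h i I; case: (s i) => /asboolP; [move=> ->|rewrite asbool_neg => /negPf ->].
have tA : trivIset setT A.
  by move=> s s' _ _ [x [h h']]; apply/ffunP => i; rewrite h h'.
have cA x : exists s, A s x.
  by exists [ffun i => `[< B' i x >]] => i; rewrite ffunE.
have AC s : A s `<=` C \/ A s `<=` ~` C.
  case e : (s ord0); [left|right] => x /(_ ord0); rewrite e B'0.
    by move=> /esym/asboolP.
  by move=> /esym/asboolPn.
(* Cell counts compatible with the prescribed counts of the sets B i; cell s lies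
   in B i when its coordinate i + 1 is true, coordinate 0 being C. *)
pose ok (m : {ffun {ffun 'I_n.+1 -> bool} -> nat}) :=
  [forall i : 'I_n, (\sum_(s : {ffun 'I_n.+1 -> bool} | s (lift ord0 i)) m s == k i)%N].
pose F (l : nat) := if choice.pickle_inv l is Some m then
  (if ok m then counts_event A m else set0) else set0.
have mF l : measurable (F l).
  rewrite /F; case: choice.pickle_inv => // m; case: ifP => // _.
  exact: measurable_counts_event.
have tF : trivIset setT F.
  move=> l l' _ _ [Z []]; rewrite /F.
  case e : (choice.pickle_inv l) => [m|//]; case: ifP => // _ h.
  case e' : (choice.pickle_inv l') => [m'|//]; case: ifP => // _ h'.
  have mm : m = m'.
    by apply/ffunP => s; apply/eqP; rewrite -(eqr_nat R); have := h s; rewrite (h' s) => -[->].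
  have := @choice.pickle_invK {ffun {ffun 'I_n.+1 -> bool} -> nat} l.
  have := @choice.pickle_invK {ffun {ffun 'I_n.+1 -> bool} -> nat} l'.
  by rewrite e e' /= => <- <-; rewrite mm.
have cB (m : {ffun {ffun 'I_n.+1 -> bool} -> nat}) Z i : counts_event A m Z ->
    cnt Z (B i) = ((\sum_(s : {ffun 'I_n.+1 -> bool} | s (lift ord0 i)) m s)%N%:R)%:E.
  move=> h; rewrite (@cnt_partition_cond _ A (fun s : {ffun 'I_n.+1 -> bool} => s (lift ord0 i)))//.
    by rewrite natr_sum -sumEFin; apply: eq_bigr => s _; exact: h.
  move=> x; split => [Bx|[s [si /(_ (lift ord0 i))]]].
    by have [s As] := cA x; exists s; split => //; rewrite As B'S; apply/asboolP.
  by rewrite si B'S => /esym/asboolP.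
have FE : counts_event B k `&` finite_configs = \bigcup_l F l.
  apply/seteqP; split => [Z [hk fZ]|Z [l _]].
    have /choice[m hm] s : exists q, cnt Z (A s) = q%:R%:E.
      by apply: finite_cnt; exact: finite_setIl.
    have hm' : counts_event A [ffun s => m s] Z by move=> s; rewrite ffunE.
    exists (choice.pickle [ffun s => m s]) => //; rewrite /F choice.pickleK_inv ifT//.
    apply/forallP => i; rewrite -(eqr_nat R).
    by have := hk i; rewrite (cB _ _ _ hm') => -[->].
  rewrite /F; case: choice.pickle_inv => [m|//]; case: ifPn => // /forallP okm h; split.
    by move=> i; rewrite (cB _ _ _ h) (eqP (okm i)).
  apply/finite_setP; exists (\sum_s m s)%N; rewrite -(setIT Z); apply/cntP.
  rewrite (@cnt_partition_cond _ A xpredT)//.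
    by rewrite natr_sum -sumEFin; apply: eq_bigr => s _; exact: h.
  by move=> x; split => // _; have [s As] := cA x; exists s.
have m1F l : m1 (F l) = m2 (F l).
  rewrite /F; case: choice.pickle_inv => [m|]; last by rewrite !measure0.
  by case: ifP => _; [exact: agree|rewrite !measure0].
have fin (m : {measure set (config R) -> \bar R}) : m (~` finite_configs) = 0%E ->
    m (counts_event B k) = m (\bigcup_l F l).
  move=> m0; rewrite -FE -{1}(setIT (counts_event B k)) -(setUv finite_configs) setIUr.
  have mU : measurable (counts_event B k `&` ~` finite_configs).
    by apply: measurableI => //; apply: measurableC; exact: measurable_finite_configs.
  have mI : measurable (counts_event B k `&` finite_configs).
    by apply: measurableI => //; exact: measurable_finite_configs.
  rewrite measureU//; last by rewrite setIACA setICr setI0.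
  have mC' := measurableC measurable_finite_configs.
  by rewrite [X in (_ + X)%E](subset_measure0 mU mC' (@subIsetr _ _ _) m0) ?adde0.
rewrite (fin _ m1fin) (fin _ m2fin) !measure_bigcup//.
by apply: eq_eseriesr => l _.
Qed.
End uniqueness.

(** * Counts of the restricted Poisson process *)

Section poisson.
Context (R : realType) (d : measure_display) (Omega : measurableType d)
  (P : probability Omega R) (X : Omega -> config R).
Hypothesis hX : poisson_process P X.

Definition pois (m : R) (k : nat) : R := m ^+ k / k`!%:R * expR (- m).

(** The identity behind the Mecke formula: a Poisson weight times the parameter is
the next weight times its index. *)
Lemma pois_succ m k : m * pois m k = k.+1%:R * pois m k.+1.
Proof.
rewrite /pois exprS factS natrM.
have h1 : k.+1%:R != 0 :> R by rewrite pnatr_eq0.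
have h2 : k`!%:R != 0 :> R by rewrite pnatr_eq0 -lt0n fact_gt0.
move: (k.+1%:R) (k`!%:R) h1 h2 => a b a0 b0.
by field; rewrite a0 b0.
Qed.

Lemma measurable_X : measurable_fun setT X. Proof. by case: hX. Qed.

Lemma X_locally_finite w : locally_finite (X w).
Proof. by case: hX => _ /(_ w)[]. Qed.

Lemma X_strip w : X w `<=` strip setT.
Proof. by case: hX => _ /(_ w)[]. Qed.

Section restricted.
Variables (S : set (vertex R)) (r : R).
Hypotheses (mS : measurable S) (SU : S `<=` strip setT)
  (Sr : S `<=` [set p | `|p.1| <= r]) (aS : (area S < +oo)%E).

Definition XS (w : Omega) : config R := restr S (X w).

Lemma measurable_XS : measurable_fun setT XS.
Proof. by apply: measurableT_comp measurable_X; exact: measurable_restr. Qed.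

Lemma XS_finite w : finite_set (XS w).
Proof.
apply: sub_finite_set (@X_locally_finite w r).
by apply: setIS.
Qed.

Lemma XS_locally_finite w : locally_finite (XS w).
Proof. exact/finite_locally_finite/XS_finite. Qed.

Lemma counts_law (J : finType) (A : J -> set (vertex R)) (k : J -> nat) :
  (forall j, measurable (A j)) -> trivIset setT A ->
  P (XS @^-1` counts_event A k) =
    (\prod_j (pois (fine (area (S `&` A j))) (k j))%:E)%E.
Proof.
move=> mA tA; have [_ _ h3 h4] := hX.
pose B (i : 'I_#|J|) := S `&` A (enum_val i).
rewrite (_ : XS @^-1` _ = [set w | forall i, (X w `&` B i #= `I_(k (enum_val i)))%card]); last first.
  apply/seteqP; split => w h i.
    by have /cntP := h (enum_val i); rewrite /XS /restr -setIA.
  apply/cntP; rewrite /XS /restr -setIA -(enum_rankK i).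
  exact: h.
rewrite h4; last 2 first.
- by move=> i; apply: measurableI.
- move=> i j _ _ [x [[_ xi] [_ xj]]]; apply: enum_val_inj; apply: tA => //.
  by exists x.
rewrite [RHS](reindex (fun i : 'I_#|J| => enum_val i)) /=; last first.
  exact: (onW_bij _ (@enum_val_bij J)).
apply: eq_bigr => i _; rewrite (h3 _ (fine (area (B i))))//.
  exact: measurableI.
rewrite setIC (setIidr _); last by move=> x [/SU].
rewrite fineK// ge0_fin_numE//; apply: le_lt_trans aS; apply: le_measure; rewrite ?inE//.
  exact: measurableI.
exact: subIsetl.
Qed.

End restricted.
End poisson.

(** * Laws of random and of randomly selected objects *)

Section selection_measure.
Context d1 d2 (T : measurableType d1) (Y : measurableType d2) (R : realType)
  (m : {measure set T -> \bar R}).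

Definition law (f : T -> Y) (mf : measurable_fun setT f) (E : set T) (mE : measurable E) :
  {measure set Y -> \bar R} :=
  measure_function_pushforward__canonical__measure_function_Measure (mrestr m mE) mf.

Lemma lawE f mf E mE A : @law f mf E mE A = m (f @^-1` A `&` E).
Proof. by []. Qed.

Lemma law_lty f mf E mE : (m setT < +oo)%E -> (@law f mf E mE setT < +oo)%E.
Proof.
by move=> moo; rewrite lawE preimage_setT setTI; apply: le_lt_trans moo; apply: le_measure; rewrite ?inE.
Qed.

Variables (E : nat -> set T) (f : nat -> T -> Y).
Hypotheses (mE : forall n, measurable (E n)) (mf : forall n, measurable_fun setT (f n)).

(** The intensity of the objects f n on the events E n: with f and E the n-th
selected point and the event that it exists, it counts all points of a process. *)
Definition sel_measure : {measure set Y -> \bar R} :=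
  mseries (fun n => law (mf n) (mE n)) 0.

Lemma sel_measureE A : sel_measure A = (\sum_(n <oo) m (f n @^-1` A `&` E n))%E.
Proof. by []. Qed.

Lemma integral_mrestr (D : set T) (mD : measurable D) (F : T -> \bar R) :
  measurable_fun setT F -> (forall y, 0 <= F y)%E ->
  (\int[mrestr m mD]_y F y = \int[m]_(x in D) F x)%E.
Proof.
move=> mF F0; rewrite -(setUv D) ge0_integral_setU//=; first last.
- by rewrite disj_set2E setICr.
- by rewrite setUv.
- exact: measurableC.
rewrite [X in (_ + X)%E]null_set_integral ?adde0//.
- by apply: eq_measure_integral => A mA AD; rewrite /= /mrestr setIidl.
- exact: measurableC.
- exact: measurable_funS mF.
- by rewrite /= /mrestr setICl measure0.
Qed.

Lemma integral_law (g : T -> Y) (mg : measurable_fun setT g) (D : set T) (mD : measurable D)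
   (F : Y -> \bar R) : measurable_fun setT F ->
  (forall y, 0 <= F y)%E ->
  (\int[law mg mD]_y F y = \int[m]_(x in D) F (g x))%E.
Proof.
move=> mF F0; rewrite /law ge0_integral_pushforward//=.
rewrite preimage_setT integral_mrestr//; exact: measurableT_comp mF mg.
Qed.

Lemma integral_sel_measure (F : Y -> \bar R) : measurable_fun setT F ->
  (forall y, 0 <= F y)%E ->
  (\int[sel_measure]_y F y =
   \int[m]_x \sum_(n <oo) if `[< E n x >] then F (f n x) else 0)%E.
Proof.
move=> mF F0; rewrite ge0_integral_measure_series//.
rewrite integral_nneseries//.
- apply: eq_eseriesr => n _; rewrite integral_law// integral_mkcond.
  apply: eq_integral => x _; rewrite /patch.
  by have [h|h] := pselect (E n x); [rewrite mem_set// asboolT|rewrite memNset// asboolF].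
- move=> n; apply: measurable_fun_ifT => //; last exact: measurableT_comp mF (mf n).
  by apply: measurable_fun_asbool => //; rewrite setTI; exact: mE.
- by move=> n x _; case: ifP.
Qed.

End selection_measure.

Lemma probability_lty d (T : measurableType d) (R : realType) (P : probability T R) :
  (P setT < +oo)%E.
Proof. by rewrite probability_setT ltry. Qed.

Lemma measure_prod_unique d1 d2 (T1 : measurableType d1) (T2 : measurableType d2) (R : realType)
  (m1 m2 : {measure set (T1 * T2) -> \bar R}) : (m1 setT < +oo)%E ->
  (forall A B, measurable A -> measurable B -> m1 (A `*` B) = m2 (A `*` B)) ->
  forall E, measurable E -> m1 E = m2 E.
Proof.
move=> m1oo h; pose C : set (set (T1 * T2)) :=
  [set C | exists A, measurable A /\ exists B, measurable B /\ C = A `*` B].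
apply: (@measure_unique _ _ _ C (fun=> setT)) => //.
- rewrite measurable_prod_measurableType; congr (<<s _ >>).
  rewrite predeqE => E; split => [[A mA [B mB <-]]|[A [mA [B [mB ->]]]]].
    by exists A; split => //; exists B.
  by exists A => //; exists B.
- move=> /= _ _ [X1 [mX1 [X2 [mX2 ->]]]] [Y1 [mY1 [Y2 [mY2 ->]]]].
  rewrite -setXI; exists (X1 `&` Y1); split; first exact: measurableI.
  by exists (X2 `&` Y2); split => //; exact: measurableI.
- by move=> _; exists setT; split => //; exists setT; split => //; rewrite setXTT.
- by rewrite bigcup_const//; exists 0%N.
- by move=> _ [A [mA [B [mB ->]]]]; exact: h.
Qed.

(** * The Mecke formula for configurations *)

Section mecke.
Context (R : realType) (d : measure_display) (Omega : measurableType d)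
  (P : probability Omega R) (X : Omega -> config R).
Hypothesis hX : poisson_process P X.
Variables (S : set (vertex R)) (r : R).
Hypotheses (mS : measurable S) (SU : S `<=` strip setT)
  (Sr : S `<=` [set p | `|p.1| <= r]) (aS : (area S < +oo)%E).

Local Notation XS := (XS X S).
Let mXS : measurable_fun setT XS := measurable_XS hX mS.

Definition sel_event n : set Omega := XS @^-1` [set Z | selects n Z].

Lemma measurable_sel_event n : measurable (sel_event n).
Proof. exact: measurable_preimage mXS (measurable_selects n). Qed.

Definition sel_map n (w : Omega) : vertex R * config R := (sel n (XS w), XS w).

Lemma measurable_sel_map n : measurable_fun setT (sel_map n).
Proof.
by apply: measurable_fun_pair => //; apply: measurableT_comp mXS; exact: measurable_sel.
Qed.

(** The Campbell measure of the process: the expected number of its points x for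
which (x, configuration) lies in a given event. *)
Definition palm_measure : {measure set (vertex R * config R) -> \bar R} :=
  sel_measure P measurable_sel_event measurable_sel_map.

Lemma palm_esum (f : vertex R * config R -> \bar R) : (forall q, 0 <= f q)%E ->
  forall w, ((\sum_(n <oo) if `[< sel_event n w >] then f (sel_map n w) else 0) =
   \esum_(x in (XS w : set (vertex R))) f (x, XS w))%E.
Proof.
move=> f0 w; rewrite (@sum_sel _ _ (fun x => f (x, XS w)))//.
exact: (XS_locally_finite hX Sr).
Qed.

Definition ins_map (q : vertex R * Omega) : vertex R * config R := (q.1, ins q.1 (XS q.2)).

Lemma measurable_ins_map : measurable_fun setT ins_map.
Proof.
apply: measurable_fun_pair => //.
have m1 : measurable_fun setT (fun q : vertex R * Omega => (q.1, XS q.2) : vertex R * config R).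
  by apply: measurable_fun_pair => //; apply: measurableT_comp mXS _.
exact: measurableT_comp (@measurable_ins R) m1.
Qed.

(** The law of a configuration with an extra point, placed according to the area
and independently of the process. *)
Definition ins_measure : {measure set (vertex R * config R) -> \bar R} :=
  law (mrestr (@area R) mS \x P)%E measurable_ins_map measurableT.

Lemma ins_measureE D : measurable D ->
  ins_measure D = (\int[@area R]_(y in S) P [set w | D (y, ins y (XS w))])%E.
Proof.
move=> mD; rewrite /ins_measure lawE setIT.
have mA := measurable_preimage measurable_ins_map mD.
transitivity (\int[mrestr (@area R) mS]_y P (xsection (ins_map @^-1` D) y))%E; first by [].
rewrite integral_mrestr//.
- apply: eq_integral => y _ /=; congr (P _).
  by apply/seteqP; split => w /=; rewrite /xsection/= inE.
- exact: measurable_fun_xsection.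
Qed.

Lemma area_set1 (y : vertex R) : area [set y] = 0%E.
Proof.
rewrite (_ : [set y] = [set y.1] `*` [set y.2]).
  have e0 : @lebesgue_measure R [set y.1] = 0%E by exact: lebesgue_measure_set1.
  by rewrite [LHS]product_measure1E//; transitivity (0 * lebesgue_measure [set y.2])%E;
    [congr (_ * _)%E|rewrite mul0e].
by apply/seteqP; split => [_ ->//|[a b] [/= -> ->]]; rewrite -surjective_pairing.
Qed.

Lemma measurable_vertex1 (y : vertex R) : measurable [set y].
Proof.
rewrite (_ : [set y] = [set y.1] `*` [set y.2]).
  by apply: measurableX; exact: measurable_set1.
by apply/seteqP; split => [_ ->//|[a b] [/= -> ->]]; rewrite -surjective_pairing.
Qed.

Let meas_in (y : vertex R) : measurable [set w | (XS w : set _) y].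
Proof.
rewrite (_ : mkset _ = ~` (XS @^-1` [set Z : config R | (Z `&` [set y] #= `I_0)%card])).
  apply: measurableC; apply: measurable_preimage mXS _.
  by apply: has_count_measurable; exact: measurable_vertex1.
apply/seteqP; split => w /=; rewrite II0 card_eq0.
  by move=> yw /eqP e; have : (XS w `&` [set y]) y by []; rewrite e.
by apply: contra_notP => yw; apply/eqP/seteqP; split => // x [xw /= e]; apply: yw; rewrite -e.
Qed.

(** The process has no fixed atoms, since a single point has area zero. *)
Lemma not_in_XS (y : vertex R) : P [set w | (XS w : set _) y] = 0%E.
Proof.
have : P (XS @^-1` counts_event (fun _ : unit => [set y]) (fun=> 0%N)) = 1%E.
  rewrite (counts_law hX mS SU aS) => [|_|]; last 2 first.
  - exact: measurable_vertex1.
  - by move=> [] [].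
  rewrite big_const cardT enumT unlock/= mule1.
  have -> : area (S `&` [set y]) = 0%E.
    apply: (subset_measure0 _ (measurable_vertex1 y) (@subIsetr _ _ _) (area_set1 y)).
    by apply: measurableI => //; exact: measurable_vertex1.
  by rewrite /pois expr0 fact0 divr1 oppr0 expR0 mulr1.
rewrite -[X in P X = _ -> _]setCK probability_setC; last first.
  apply: measurableC; apply: measurable_preimage mXS _.
  by apply: measurable_counts_event => _; exact: measurable_vertex1.
rewrite (_ : ~` _ = [set w | (XS w : set _) y]).
  have := fin_num_measure P _ (meas_in y).
  move=> /fineK <-; rewrite -EFinB => -[] /eqP.
  by rewrite subr_eq addrC -subr_eq subrr eq_sym => /eqP ->.
apply/seteqP; split => w /=.
  apply: contra_notP => yw _; apply/cntP; rewrite II0 card_eq0; apply/eqP/seteqP.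
  by split => // x [xw /= e]; apply: yw; rewrite -e.
by move=> yw /(_ tt) /cntP; rewrite II0 card_eq0 => /eqP e; have : (XS w `&` [set y]) y by []; rewrite e.
Qed.

Lemma eq_mod_null (A B N : set Omega) : measurable A -> measurable B -> measurable N ->
  P N = 0%E -> A `\` N = B `\` N -> P A = P B.
Proof.
move=> mA mB mN N0 AB.
have h E : measurable E -> P E = P (E `\` N).
  move=> mE; rewrite -{1}(setIT E) -(setUv N) setIUr measureU//; last 3 first.
  - exact: measurableI.
  - by apply: measurableI => //; exact: measurableC.
  - by rewrite setIACA setICr setI0.
  rewrite (@subset_measure0 _ _ _ P (E `&` N) N)// ?add0e// ?setDE//.
  exact: measurableI.
by rewrite (h A)// (h B)// AB.
Qed.

Section partition.
Variables (J : finType) (A : J -> set (vertex R)) (k : J -> nat) (C : set (vertex R)).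
Hypotheses (mA : forall j, measurable (A j)) (tA : trivIset setT A)
  (cA : forall x, exists j, A j x) (AC : forall j, A j `<=` C \/ A j `<=` ~` C)
  (mC : measurable C).

Let a j := fine (area (S `&` A j)).
Let inC j := `[< A j `<=` C >].
Let E := counts_event A k.

(** The probability that the process has the prescribed counts once a point has
been added to cell j. *)
Definition palm_weight j := \prod_i pois (a i) (if i == j then (k i).-1 else k i) *+ (0 < k j)%N.

Lemma palm_weightE j : a j * palm_weight j = (k j)%:R * \prod_i pois (a i) (k i).
Proof.
rewrite /palm_weight; case kj : (k j) => [|n]; first by rewrite mulr0 mul0r.
rewrite mulr1n (bigD1 j)//= eqxx [in RHS](bigD1 j)//= kj/= [LHS]mulrA [RHS]mulrA.
congr (_ * _); first exact: pois_succ.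
by apply: eq_bigr => i /negPf ->.
Qed.

Lemma ins_counts j (y : vertex R) : A j y ->
  P [set w | E (ins y (XS w))] = (palm_weight j)%:E.
Proof.
move=> Ay; pose k' i := if i == j then (k i).-1 else k i.
(* The counts before the insertion; there are none if cell j must be empty. *)
pose E' : set Omega := if (0 < k j)%N then XS @^-1` counts_event A k' else set0.
have mE : measurable E by exact: measurable_counts_event.
have mE' : measurable E'.
  rewrite /E'; case: ifP => // _; apply: measurable_preimage mXS _.
  exact: measurable_counts_event.
rewrite (@eq_mod_null _ E' [set w | (XS w : set _) y])//; last 3 first.
- have m1 : measurable_fun setT (fun w => ins y (XS w)).
    have m2 : measurable_fun setT (fun w => (y, XS w) : vertex R * config R).
      by apply: measurable_fun_pair.
    exact: measurableT_comp (@measurable_ins R) m2.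
  exact: measurable_preimage m1 mE.
- exact: not_in_XS.
- apply/seteqP; split => w [h yw]; split => //; move: h;
    rewrite /E' /E /counts_event /= /ins asboolT; do ?exact: (XS_locally_finite hX Sr).
  + have [q eq] : exists q, cnt (XS w) (A j) = q%:R%:E.
      by apply: finite_cnt; apply: finite_setIl; exact: (XS_finite hX Sr).
    move=> h; have kj : (0 < k j)%N.
      rewrite lt0n; apply/eqP => k0; have := h j; rewrite cnt_setU1// k0 indicE mem_set//=.
      rewrite eq -EFinD => -[] /eqP; rewrite nat1r pnatr_eq0//.
    rewrite kj => i; have := h i; rewrite cnt_setU1// /k'; case: eqP => [->|ij].
      rewrite indicE mem_set//= eq -EFinD nat1r => -[] /eqP.
      by rewrite eqr_nat => /eqP <-.
    rewrite indicE memNset ?add0e// => Ai; apply: ij; apply: tA => //.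
    by exists y.
  + case: ifP => // kj h i; rewrite cnt_setU1// (h i) /k'; case: eqP => [->|ij].
      by rewrite indicE mem_set//= -EFinD nat1r prednK.
    rewrite indicE memNset ?add0e// => Ai; apply: ij; apply: tA => //.
    by exists y.
rewrite /E' /palm_weight; case: ifP => _; last by rewrite measure0.
by rewrite (counts_law hX mS SU aS)// mulr1n prodEFin.
Qed.

Let inCP j : inC j -> S `&` A j `&` C = S `&` A j.
Proof. by move=> /asboolP jC; rewrite setIidl// => x [_ /jC]. Qed.

Let ninCP j : ~~ inC j -> S `&` A j `&` C = set0.
Proof.
move=> /asboolPn jC; have [//|jnC] := AC j.
by apply/seteqP; split => // x [[_ /jnC]].
Qed.

Let cntC Z : E Z -> cnt Z C = ((\sum_(j | inC j) k j)%N%:R)%:E.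
Proof.
move=> EZ; rewrite (@cnt_partition_cond _ _ A inC)//.
  by rewrite natr_sum -sumEFin; apply: eq_bigr => j _; exact: EZ.
move=> x; split => [Cx|[j [/asboolP jC /jC//]]].
have [j Ajx] := cA x; exists j; split => //; apply/asboolP.
by have [//|jnC] := AC j; case: (jnC _ Ajx).
Qed.

(** Given the counts, the number of points in C is a constant, namely the sum of
the counts of the cells inside C. *)
Lemma palm_counts :
  palm_measure (C `*` E) = ((\sum_(j | inC j) k j)%N%:R * \prod_i pois (a i) (k i))%:E.
Proof.
have mE : measurable E by exact: measurable_counts_event.
have mCE : measurable (C `*` E) by exact: measurableX.
rewrite -(setIT (C `*` E)) -integral_indic// integral_sel_measure//; last first.
  by apply/measurable_EFinP; exact: measurable_indic.
have h0 (q : vertex R * config R) : (0 <= (\1_(C `*` E) q : R)%:E)%E by rewrite lee_fin.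
set K := (\sum_(j | inC j) k j)%N.
transitivity (\int[P]_w (K%:R * \1_(XS @^-1` E) w)%:E)%E.
  apply: eq_integral => w _; rewrite (palm_esum h0).
  have [Ew|Ew] := pselect (E (XS w)).
    rewrite [in RHS]indicE mem_set// mulr1 -(cntC Ew); apply: eq_esum => x _.
    by congr (_%:E); rewrite !indicE in_setX/= (mem_set Ew) andbT.
  rewrite [in RHS]indicE memNset// mulr0 esum1// => x _.
  by rewrite indicE in_setX/= (memNset Ew) andbF.
have mXE := measurable_preimage mXS mE.
under eq_integral do rewrite EFinM.
rewrite ge0_integralZl//; last by exact/measurable_EFinP.
  rewrite integral_indic// setIT EFinM -prodEFin; congr (_ * _)%E.
  exact: (counts_law hX mS SU aS).
Qed.

(** Both sides are sums over the cells inside C, and they agree cell by cell by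
[palm_weightE]. *)
Lemma ins_palm_counts : ins_measure (C `*` E) = palm_measure (C `*` E).
Proof.
have mE : measurable E by exact: measurable_counts_event.
have mCE : measurable (C `*` E) by exact: measurableX.
have w0 j : 0 <= palm_weight j.
  rewrite /palm_weight mulrn_wge0// prodr_ge0// => i _.
  by rewrite mulr_ge0 ?expR_ge0// divr_ge0// exprn_ge0// fine_ge0// measure_ge0//.
rewrite palm_counts ins_measureE//.
transitivity (\int[@area R]_(y in S) \sum_j ((palm_weight j) * \1_(A j `&` C) y)%:E)%E.
  apply: eq_integral => y _; have [j Ajy] := cA y.
  rewrite (bigD1 j)//= big1 ?adde0 => [|i /negP ij]; last first.
    rewrite indicE memNset ?mulr0// => -[Aiy _]; apply: ij; apply/eqP.
    by apply: tA => //; exists y.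
  have [Cy|Cy] := pselect (C y).
    rewrite indicE mem_set// mulr1 -(ins_counts Ajy); congr (P _).
    by apply/seteqP; split => w /= => [[]|].
  rewrite indicE memNset ?mulr0 => [|[]//].
  by rewrite (_ : mkset _ = set0) ?measure0//; apply/seteqP; split => w // [].
rewrite ge0_integral_sum//; last 2 first.
- move=> j; apply/measurable_EFinP; apply: measurable_funM => //.
  by apply: measurable_indic; exact: measurableI.
- by move=> j y _; rewrite lee_fin mulr_ge0.
transitivity (\sum_(j | inC j) (a j * palm_weight j)%:E)%E; last first.
  rewrite sumEFin natr_sum mulr_suml; congr (_%:E).
  by apply: eq_bigr => j _; rewrite palm_weightE.
rewrite [RHS]big_mkcond; apply: eq_bigr => j _.
under eq_integral do rewrite EFinM.
rewrite ge0_integralZl//; last 2 first.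
- by apply/measurable_EFinP; apply: measurable_indic; exact: measurableI.
- by rewrite lee_fin.
rewrite integral_indic//; last exact: measurableI.
rewrite setIC setIA; case: ifPn => jC.
  rewrite (inCP jC) EFinM muleC /a fineK// ge0_fin_numE//.
  apply: le_lt_trans aS; apply: le_measure; rewrite ?inE//; first exact: measurableI.
by rewrite (ninCP jC) measure0 mule0.
Qed.

End partition.

Lemma ins_measure_fin : (ins_measure setT < +oo)%E.
Proof.
rewrite ins_measureE// (eq_integral (cst 1%E)) ?integral_cst ?mul1e//.
by move=> y _ /=; rewrite (_ : mkset _ = setT) ?probability_setT//.
Qed.

(** Rectangles in the position of the point and the configuration suffice, and for
each set C of positions the second factor is settled by [config_unique]. *)
Lemma mecke D : measurable D -> ins_measure D = palm_measure D.
Proof.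
move: D; apply: measure_prod_unique; first exact: ins_measure_fin.
move=> C F mC; move: F.
have mC' : measurable (C `*` [set: config R]) by exact: measurableX.
have e (m : {measure set (vertex R * config R) -> \bar R}) F :
    m (C `*` F) = law m (@measurable_snd _ _ _ _) mC' F.
  by rewrite lawE; congr (m _); apply/seteqP; split => -[y Z] /=; tauto.
move=> F mF; rewrite !e; move: F mF.
have mfin : measurable (C `*` ~` @finite_configs R).
  by apply: measurableX => //; apply: measurableC; exact: measurable_finite_configs.
apply: (@config_unique _ C) => //.
- rewrite -e; apply: le_lt_trans ins_measure_fin.
  by apply: le_measure; rewrite ?inE.
- rewrite -e ins_measureE// integral0_eq// => y _.
  rewrite (_ : mkset _ = set0) ?measure0//; apply/seteqP; split => // w [_] /=; apply.
  rewrite /ins asboolT; last exact: (XS_locally_finite hX Sr).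
  by rewrite /finite_configs/= finite_setU; split => //; exact: (XS_finite hX Sr).
- rewrite -e sel_measureE eseries0// => n _ _.
  rewrite (_ : _ `&` _ = set0) ?measure0//; apply/seteqP; split => // w [[_ /=] h _].
  by apply: h; exact: (XS_finite hX Sr).
- by move=> J A k mA tA cA AC; rewrite -!e; exact: ins_palm_counts.
Qed.

End mecke.

(** * Moving a point of the torus to the origin *)

Section shift.
Variables (R : realType) (t : R).
Hypothesis t0 : 0 < t.
Local Notation S := (strip (torus t)).
Local Notation tr := (translate (wrap_torus t)).

Lemma translate_in a p : S p -> S (tr a p).
Proof. by move=> [_ p2]; split => //; exact: wrap_in. Qed.

Lemma translateD a b p : tr a (tr b p) = tr (a + b) p.
Proof. by rewrite /translate/= wrapDl// -addrA (addrC b). Qed.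

Lemma translate_id p : S p -> tr 0 p = p.
Proof.
by move=> [p1 _]; rewrite /translate addr0 wrap_torus_id// -surjective_pairing.
Qed.

Lemma translate_inj a p q : S p -> S q -> tr a p = tr a q -> p = q.
Proof.
move=> Sp Sq /(congr1 (tr (- a))); rewrite !translateD addNr.
by rewrite !translate_id.
Qed.

Definition shiftable : set (config R) := [set Z : config R | Z `<=` S /\ locally_finite Z].

(** The default value makes the map total and measurable; the process
on the torus always passes the test. *)
Definition shiftc (a : R) (Z : config R) : config R :=
  if `[< shiftable Z >] then tr a @` Z else set0.

Lemma measurable_strip_torus : measurable S.
Proof. exact: measurable_strip (measurable_torus t). Qed.

Lemma measurable_shiftable : measurable shiftable.
Proof.
rewrite (_ : shiftable = [set Z : config R | (Z `&` ~` S #= `I_0)%card] `&`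
   [set Z : config R | locally_finite Z]).
  apply: measurableI; last exact: measurable_locally_finite.
  by apply: has_count_measurable; apply: measurableC; exact: measurable_strip_torus.
apply/seteqP; split => Z /=; rewrite II0 card_eq0.
  by move=> [ZS lf]; split => //; apply/eqP/disjoints_subset; rewrite setCK.
by move=> [/eqP/disjoints_subset]; rewrite setCK.
Qed.

Lemma strip_torus_bounded : S `<=` [set p | `|p.1| <= t / 2].
Proof.
move=> p [/= + _]; rewrite /torus/= in_itv/= => /andP[a b].
by rewrite ler_norml b andbT ltW.
Qed.

Lemma shiftable_finite Z : shiftable Z -> finite_set Z.
Proof.
move=> [ZS /(_ (t / 2))]; apply: sub_finite_set => p Zp; split => //.
exact/strip_torus_bounded/ZS.
Qed.

Lemma finite_shiftable Z : finite_set Z -> Z `<=` S -> shiftable Z.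
Proof. by move=> fZ ZS; split => //; exact: finite_locally_finite. Qed.

Lemma cnt_translate a Z B : Z `<=` S ->
  cnt (tr a @` Z) B = (\esum_(p in Z) (\1_B (tr a p))%:E)%E.
Proof.
move=> ZS; rewrite /cnt esum_image// => p q; rewrite !inE => Zp Zq.
by apply: translate_inj; exact: ZS.
Qed.

Lemma measurable_shiftc : measurable_fun setT (fun q : R * config R => shiftc q.1 q.2).
Proof.
have mD : measurable (snd @^-1` shiftable : set (R * config R)).
  exact: measurable_preimage measurable_snd measurable_shiftable.
apply: (measurable_config_if mD) => B mB.
apply: (@eq_measurable_fun _ _ _ _ _ (fun q : R * config R =>
   (\esum_(p in (q.2 : set (vertex R))) (\1_B (tr q.1 p))%:E)%E)).
  by move=> q /[!inE] -[qS _]; rewrite cnt_translate.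
apply: (measurable_fun_esum (f := fun x => (\1_B (tr x.1.1 x.2))%:E)) => //.
- apply/measurable_EFinP.
  have m1 : measurable_fun setT (fun x : (R * config R) * vertex R => tr x.1.1 x.2).
    apply: measurable_fun_pair => /=; last by apply: measurableT_comp => //.
    apply: measurableT_comp; first exact: measurable_wrap.
    apply: measurable_funD; first by apply: measurableT_comp.
    by apply: measurableT_comp => //; apply: measurableT_comp.
  exact: measurableT_comp (measurable_indic mB) m1.
- by move=> q [].
Qed.

(** The whole configuration is translated so that the distinguished point is moved
to the origin; its birth time is kept. *)
Definition centre (q : vertex R * config R) : vertex R * config R :=
  ((0, q.1.2), shiftc (- q.1.1) q.2).

Lemma measurable_centre : measurable_fun setT centre.
Proof.
apply: measurable_fun_pair.
  apply: measurable_fun_pair => //.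
  by apply: measurableT_comp => //.
have m1 : measurable_fun setT (fun q : vertex R * config R => (- q.1.1, q.2)).
  apply: measurable_fun_pair => //.
  by apply: measurableT_comp => //; apply: measurableT_comp.
exact: measurableT_comp measurable_shiftc m1.
Qed.

Lemma torus0 : torus t 0.
Proof. by rewrite /torus/= in_itv/=; rewrite oppr_lt0 divr_gt0//= ltW// divr_gt0. Qed.

Lemma centre_ins y Z : S y -> shiftable Z ->
  centre (y, ins y Z) = ((0, y.2), ins (0, y.2) (shiftc (- y.1) Z)).
Proof.
move=> Sy sZ; have [ZS lf] := sZ; have lfy : locally_finite (y |` Z).
  by move=> r; rewrite setIUl finite_setU; split => //; exact: finite_setIl.
have sfy : shiftable (y |` Z) by split => // p [->|/ZS].
rewrite /centre /shiftc /ins (asboolT lf) (asboolT sfy) (asboolT sZ) asboolT.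
  congr (_, _); rewrite image_setU image_set1 (_ : tr (- y.1) y = (0, y.2))//.
  by rewrite /translate subrr wrap_torus_id//; exact: torus0.
by apply: finite_locally_finite; apply: finite_image; exact: shiftable_finite.
Qed.

End shift.

(** * Stationarity and the centred Mecke formula *)

Section mark.
Context (R : realType) (d : measure_display) (Omega : measurableType d)
  (P : probability Omega R) (X : Omega -> config R) (U : Omega -> R).
Hypotheses (hX : poisson_process P X) (hU : uniform_mark P X U).

Lemma measurable_U : measurable_fun setT U. Proof. by case: hU. Qed.

Lemma measurable_XU : measurable_fun setT (fun w => (X w, U w)).
Proof. by apply: measurable_fun_pair; [exact: measurable_X hX|exact: measurable_U]. Qed.

(** The joint law of the process and the independent mark is a product, realised
here on two independent copies of the probability space. *)
Lemma mark_law (D : set (config R * R)) : measurable D ->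
  P [set w | D (X w, U w)] = (\int[P]_u P [set w | D (X w, U u)])%E.
Proof.
move=> mD.
have mX := measurable_X hX; have mU := measurable_U.
have m2 : measurable_fun setT (fun q : Omega * Omega => (X q.2, U q.1)).
  apply: measurable_fun_pair; first exact: measurableT_comp mX measurable_snd.
  exact: measurableT_comp mU measurable_fst.
have -> : P [set w | D (X w, U w)] = law P measurable_XU measurableT D.
  by rewrite lawE setIT.
have <- : law (P \x P)%E m2 measurableT D = (\int[P]_u P [set w | D (X w, U u)])%E.
  rewrite lawE setIT.
  transitivity (\int[P]_u P (xsection ((fun q : Omega * Omega => (X q.2, U q.1)) @^-1` D) u))%E; first by [].
  apply: eq_integral => u _; congr (P _).
  by apply/seteqP; split => w /=; rewrite /xsection/= inE.
apply: measure_prod_unique mD.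
  exact: (law_lty measurable_XU measurableT (probability_lty P)).
move=> A B mA mB; rewrite !lawE !setIT.
have [_ _ _ hind] := hU.
transitivity (P (X @^-1` A) * P (U @^-1` B))%E; first by rewrite -hind.
rewrite (_ : _ @^-1` _ = (U @^-1` B) `*` (X @^-1` A)); last first.
  by apply/seteqP; split => -[u w] /= [].
rewrite muleC; apply/esym; apply: product_measure1E.
  exact: measurable_preimage.
exact: measurable_preimage.
Qed.

Lemma mark_law_pair (D : set (vertex R * config R)) : measurable D ->
  P [set w | D ((0%R, U w), X w)] = (\int[P]_u P [set w | D ((0%R, U u), X w)])%E.
Proof.
move=> mD.
have m1 : measurable_fun setT (fun q : config R * R => ((0, q.2), q.1) : vertex R * config R).
  apply: measurable_fun_pair => //.
  by apply: measurable_fun_pair => //; exact: measurable_snd.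
exact: (mark_law (measurable_preimage m1 mD)).
Qed.
End mark.

Section centred.
Context (R : realType) (d : measure_display) (Omega : measurableType d)
  (P : probability Omega R) (X : Omega -> config R) (U : Omega -> R).
Hypotheses (hX : poisson_process P X) (hU : uniform_mark P X U).
Variable t : R.
Hypothesis t0 : 0 < t.
Local Notation S := (strip (torus t)).
Local Notation XS := (XS X S).
Let mS := measurable_strip_torus t.
Let Sr := @strip_torus_bounded R t.

Lemma strip_torus_sub : S `<=` strip setT.
Proof. by move=> p [_ p2]; split. Qed.

Lemma lebesgue_torus : lebesgue_measure (torus t) = t%:E.
Proof.
rewrite /torus; transitivity (@lebesgue_measure R `]- (t / 2), t / 2]%classic); first by [].
rewrite lebesgue_measure_itv/= lte_fin.
rewrite ifT; last by rewrite -subr_gt0 opprK -splitr.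
by rewrite -EFinD opprK -splitr.
Qed.

Lemma area_strip_torus (B : set R) : measurable B ->
  area (S `&` [set y | B y.2]) = (t%:E * P (U @^-1` B))%E.
Proof.
move=> mB; rewrite (_ : _ `&` _ = torus t `*` (B `&` `]0, 1])); last first.
  by apply/seteqP; split => [[a b] [[/= ? ?] ?]|[a b] [/= ? [? ?]]]; split.
have [_ _ hu _] := hU.
rewrite [LHS]product_measure1E//; first last.
- exact: measurableI.
- exact: measurable_torus.
rewrite hu//; congr (_ * _)%E; exact: lebesgue_torus.
Qed.

Lemma area_torus : area S = t%:E.
Proof.
have mI : measurable (`]0, 1] : set R) by exact: measurable_itv.
have e1 : @lebesgue_measure R `]0%R, 1%R] = 1%E.
  by rewrite lebesgue_measure_itv/= lte_fin ltr01 -EFinB subr0.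
rewrite [LHS]product_measure1E//; last exact: measurable_torus.
by rewrite -[RHS]mule1; congr (_ * _)%E; [exact: lebesgue_torus|exact: e1].
Qed.

Let aS : (area S < +oo)%E. Proof. by rewrite area_torus ltry. Qed.

Lemma integral_strip_torus (h : R -> \bar R) : measurable_fun setT h ->
  (forall s, 0 <= h s)%E ->
  (\int[@area R]_(y in S) h y.2 = t%:E * \int[P]_u h (U u))%E.
Proof.
move=> mh h0.
have mU := measurable_U hU.
have m2 : measurable_fun setT (snd : vertex R -> R) by exact: measurable_snd.
rewrite -(integral_law (@area R) m2 mS)//.
transitivity (\int[mscale (NngNum (ltW t0)) (law P mU measurableT)]_s h s)%E.
  apply: eq_measure_integral => B mB _.
  rewrite lawE; transitivity (t%:E * P (U @^-1` B))%E.
    by rewrite -area_strip_torus// setIC.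
  by rewrite -[in LHS](setIT (U @^-1` B)).
by rewrite ge0_integral_mscale//= integral_law.
Qed.

Lemma XS_shiftable w : shiftable t (XS w).
Proof.
by apply: finite_shiftable; [exact: (XS_finite hX Sr)|exact: subIsetr].
Qed.

(** The counts of the shifted process are those of the process in the shifted
cells, and torus translations preserve the area. *)
Lemma stationary (a : R) (E : set (config R)) : measurable E ->
  P [set w | E (shiftc t a (XS w))] = P [set w | E (XS w)].
Proof.
move=> mE; have mXS := measurable_XS hX mS.
have mshift : measurable_fun setT (fun w => shiftc t a (XS w)).
  have m1 : measurable_fun setT (fun w => (a, XS w)) by exact: measurable_fun_pair.
  exact: measurableT_comp (measurable_shiftc t0) m1.
transitivity (law P mshift measurableT E); first by rewrite lawE setIT.
transitivity (law P mXS measurableT E); last by rewrite lawE setIT.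
apply: (@config_unique _ set0) mE => //.
- exact: (law_lty mshift measurableT (probability_lty P)).
- rewrite lawE (_ : _ `&` _ = set0) ?measure0//; apply/seteqP; split => // w [h _]; apply: h.
  rewrite /= /shiftc asboolT; last exact: XS_shiftable.
  by apply: finite_image; exact: (XS_finite hX Sr).
- rewrite lawE (_ : _ `&` _ = set0) ?measure0//; apply/seteqP; split => // w [h _]; apply: h.
  exact: (XS_finite hX Sr).
- move=> J A k mA tA cA _; rewrite !lawE !setIT.
  pose A' j := translate (wrap_torus t) a @^-1` A j.
  have mA' j : measurable (A' j).
    by apply: measurable_preimage (mA j); exact: measurable_translate.
  rewrite (_ : _ @^-1` _ = XS @^-1` counts_event A' k).
    have tA' : trivIset setT A'.
      move=> i j _ _ [x [Ai Aj]]; apply: tA => //.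
      by exists (translate (wrap_torus t) a x).
    apply: (etrans (counts_law hX mS strip_torus_sub aS k mA' tA')).
    apply: etrans (esym (counts_law hX mS strip_torus_sub aS k mA tA)).
    by apply: eq_bigr => j _; rewrite area_translate.
  have e w j : cnt (shiftc t a (XS w)) (A j) = cnt (XS w) (A' j).
    rewrite /shiftc asboolT; last exact: XS_shiftable.
    by rewrite cnt_translate//; exact: subIsetr.
  by apply/seteqP; split => w h j; have := h j; rewrite e.
Qed.

(** After the Mecke formula the added point is uniform on the strip. By
stationarity its position may be taken to be the origin, and integrating the
position out leaves the factor t and a uniform birth time. *)
Lemma centred_mecke (D : set (vertex R * config R)) : measurable D ->
  palm_measure hX mS (centre t @^-1` D) =
  (t%:E * P [set w | D ((0%R, U w), ins (0%R, U w) (XS w))])%E.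
Proof.
move=> mD; have mXS := measurable_XS hX mS.
have mcD := measurable_preimage (measurable_centre t0) mD.
rewrite -(mecke hX mS strip_torus_sub Sr aS)// ins_measureE//.
pose h (s : R) := P [set w | D ((0, s), ins (0, s) (XS w))].
have mins (D' : set (vertex R * config R)) : measurable D' ->
    measurable [set q : vertex R * config R | D' (q.1, ins q.1 q.2)].
  move=> mD'; apply: (measurable_preimage _ mD').
  by apply: measurable_fun_pair => //; exact: measurable_ins.
have mh : measurable_fun setT h.
  pose B := [set q : R * Omega | D ((0, q.1), ins (0, q.1) (XS q.2))].
  have mB : measurable B.
    have m1 : measurable_fun setT (fun q : R * Omega => ((0, q.1), XS q.2) : vertex R * config R).
      apply: measurable_fun_pair; first exact: measurable_fun_pair.
      exact: measurableT_comp mXS measurable_snd.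
    exact: (measurable_preimage m1 (mins _ mD)).
  apply: (@eq_measurable_fun _ _ _ _ _ (P \o xsection B)).
    move=> s _ /=; congr (P _).
    by apply/seteqP; split => w /=; rewrite /xsection/= inE.
  exact: measurable_fun_xsection.
transitivity (\int[@area R]_(y in S) h y.2)%E.
  apply: eq_integral => y; rewrite inE => Sy.
  pose E := [set Z | D ((0, y.2), ins (0, y.2) Z)].
  have mE : measurable E.
    have m1 : measurable_fun setT (fun Z : config R => ((0, y.2), Z) : vertex R * config R).
      exact: measurable_fun_pair.
    exact: (measurable_preimage m1 (mins _ mD)).
  apply: etrans (stationary (- y.1) mE).
  congr (P _); apply/seteqP; split => w /=; rewrite (centre_ins t0 Sy)//; exact: XS_shiftable.
rewrite integral_strip_torus//; congr (_ * _)%E.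
pose D' : set (vertex R * config R) := [set q | D (q.1, ins q.1 (restr S q.2))].
have mD' : measurable D'.
  have m1 : measurable_fun setT (fun q : vertex R * config R => (q.1, restr S q.2)).
    apply: measurable_fun_pair => //.
    exact: measurableT_comp (measurable_restr mS) measurable_snd.
  exact: (measurable_preimage m1 (mins _ mD)).
by rewrite -(mark_law_pair hX hU mD').
Qed.

End centred.

(** * Independence of disjoint windows *)

Section scaled_law.
Context d1 d2 (T : measurableType d1) (Y : measurableType d2) (R : realType)
  (P : probability T R).

(** The right-hand side of a product rule P(A n F) = P(A) P(F) as a measure in A,
so that uniqueness theorems for measures prove independence. *)
Definition scaled_law (f : T -> Y) (mf : measurable_fun setT f) (F : set T) :
  {measure set Y -> \bar R} :=
  mscale (NngNum (fine_ge0 (measure_ge0 P F))) (law P mf measurableT).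

Lemma scaled_lawE f mf F A : measurable F ->
  @scaled_law f mf F A = (P (f @^-1` A) * P F)%E.
Proof.
move=> mF; transitivity ((fine (P F))%:E * P (f @^-1` A `&` setT))%E; first by [].
by rewrite setIT fineK ?fin_num_measure// muleC.
Qed.
End scaled_law.

Section independence.
Context (R : realType) (d : measure_display) (Omega : measurableType d)
  (P : probability Omega R) (X : Omega -> config R) (U : Omega -> R).
Hypotheses (hX : poisson_process P X) (hU : uniform_mark P X U).
Variables (S0 S1 : set (vertex R)) (r : R).
Hypotheses (mS0 : measurable S0) (mS1 : measurable S1)
  (S0U : S0 `<=` strip setT) (S1U : S1 `<=` strip setT)
  (S0r : S0 `<=` [set p | `|p.1| <= r]) (S1r : S1 `<=` [set p | `|p.1| <= r])
  (aS : (area (S0 `|` S1) < +oo)%E) (S01 : S0 `&` S1 = set0).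
Local Notation X0 := (XS X S0).
Local Notation X1 := (XS X S1).

Let mX0 := measurable_XS hX mS0.
Let mX1 := measurable_XS hX mS1.
Let mS : measurable (S0 `|` S1). Proof. exact: measurableU. Qed.
Let SU : S0 `|` S1 `<=` strip setT. Proof. by move=> p [/S0U|/S1U]. Qed.
Let aS0 : (area S0 < +oo)%E.
Proof. by apply: le_lt_trans aS; apply: le_measure; rewrite ?inE//; exact: subsetUl. Qed.
Let aS1 : (area S1 < +oo)%E.
Proof. by apply: le_lt_trans aS; apply: le_measure; rewrite ?inE//; exact: subsetUr. Qed.

Lemma independent_counts (J K : finType) (A : J -> set (vertex R)) (B : K -> set (vertex R))
   (k : J -> nat) (l : K -> nat) :
  (forall j, measurable (A j)) -> trivIset setT A ->
  (forall j, measurable (B j)) -> trivIset setT B ->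
  P (X0 @^-1` counts_event A k `&` X1 @^-1` counts_event B l) =
  (P (X0 @^-1` counts_event A k) * P (X1 @^-1` counts_event B l))%E.
Proof.
move=> mA tA mB tB.
pose C (i : J + K) := match i with inl j => S0 `&` A j | inr j => S1 `&` B j end.
pose m (i : J + K) := match i with inl j => k j | inr j => l j end.
have mC i : measurable (C i) by case: i => j; exact: measurableI.
have tC : trivIset setT C.
  move=> [i|i] [j|j] _ _ [x [[xi Ai] [xj Aj]]].
  - by congr inl; apply: tA => //; exists x.
  - by have : (S0 `&` S1) x by []; rewrite S01.
  - by have : (S0 `&` S1) x by []; rewrite S01.
  - by congr inr; apply: tB => //; exists x.
have e0 : X0 @^-1` counts_event A k `&` X1 @^-1` counts_event B l =
    XS X (S0 `|` S1) @^-1` counts_event C m.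
  have c0 w j : cnt (XS X (S0 `|` S1) w) (C (inl j)) = cnt (X0 w) (A j).
    by rewrite !cntE /C /XS /restr setIA -(setIA (X w)) (setIidr (@subsetUl _ S0 S1)).
  have c1 w j : cnt (XS X (S0 `|` S1) w) (C (inr j)) = cnt (X1 w) (B j).
    by rewrite !cntE /C /XS /restr setIA -(setIA (X w)) (setIidr (@subsetUr _ S0 S1)).
  apply/seteqP; split => [w [h0 h1] [j|j]|w h]; [by rewrite c0; exact: h0|by rewrite c1; exact: h1|].
  by split => j; [have := h (inl j); rewrite c0|have := h (inr j); rewrite c1].
have c0 j : (S0 `|` S1) `&` C (inl j) = S0 `&` A j.
  by rewrite /C setIA (setIidr (@subsetUl _ S0 S1)).
have c1 j : (S0 `|` S1) `&` C (inr j) = S1 `&` B j.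
  by rewrite /C setIA (setIidr (@subsetUr _ S0 S1)).
have f0 : (\prod_j (pois (fine (area ((S0 `|` S1) `&` C (inl j)))) (m (inl j)))%:E)%E =
    P (X0 @^-1` counts_event A k).
  rewrite (counts_law hX mS0 S0U aS0 k mA tA).
  by apply: eq_bigr => j _; rewrite c0.
have f1 : (\prod_j (pois (fine (area ((S0 `|` S1) `&` C (inr j)))) (m (inr j)))%:E)%E =
    P (X1 @^-1` counts_event B l).
  rewrite (counts_law hX mS1 S1U aS1 l mB tB).
  by apply: eq_bigr => j _; rewrite c1.
rewrite e0 (counts_law hX mS SU aS m mC tC) big_sumType.
by rewrite -f0 -f1.
Qed.

(** Uniqueness of laws is used twice, once for each factor. *)
Lemma independent_configs E F : measurable E -> measurable F ->
  P (X0 @^-1` E `&` X1 @^-1` F) = (P (X0 @^-1` E) * P (X1 @^-1` F))%E.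
Proof.
have nul0 (m : {measure set Omega -> \bar R}) D : m (X0 @^-1` (~` @finite_configs R) `&` D) = 0%E.
  rewrite (_ : _ `&` _ = set0) ?measure0//; apply/seteqP; split => // w [h _]; apply: h.
  exact: (XS_finite hX S0r).
have nul1 (m : {measure set Omega -> \bar R}) D : m (X1 @^-1` (~` @finite_configs R) `&` D) = 0%E.
  rewrite (_ : _ `&` _ = set0) ?measure0//; apply/seteqP; split => // w [h _]; apply: h.
  exact: (XS_finite hX S1r).
have step (J : finType) (A : J -> set (vertex R)) (k : J -> nat) F' :
    (forall j, measurable (A j)) -> trivIset setT A -> measurable F' ->
    P (X0 @^-1` counts_event A k `&` X1 @^-1` F') =
    (P (X0 @^-1` counts_event A k) * P (X1 @^-1` F'))%E.
  move=> mA tA mF'.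
  have mE := measurable_preimage mX0 (measurable_counts_event k mA).
  rewrite setIC muleC -[RHS](scaled_lawE P mX1)//.
  transitivity (law P mX1 mE F'); first by [].
  apply: (@config_unique _ set0) mF' => //.
  - exact: (law_lty mX1 mE (probability_lty P)).
  - by rewrite lawE nul1.
  - by rewrite scaled_lawE// -(setIT (_ @^-1` _)) nul1 mul0e.
  - move=> K B l mB tB cB _; rewrite scaled_lawE// lawE setIC.
    by apply: etrans (independent_counts k l mA tA mB tB) _; exact: muleC.
move=> mE mF; have mF1 := measurable_preimage mX1 mF.
rewrite -[RHS](scaled_lawE P mX0)//.
transitivity (law P mX0 mF1 E); first by [].
apply: (@config_unique _ set0) mE => //.
- exact: (law_lty mX0 mF1 (probability_lty P)).
- by rewrite lawE nul0.
- by rewrite scaled_lawE// -(setIT (_ @^-1` _)) nul0 mul0e.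
- by move=> J A k mA tA cA _; rewrite scaled_lawE// lawE; exact: step.
Qed.

Lemma independent_marked (D : set (config R * R)) F : measurable D -> measurable F ->
  P [set w | D (X0 w, U w) /\ F (X1 w)] =
  (P [set w | D (X0 w, U w)] * P [set w | F (X1 w)])%E.
Proof.
move=> mD mF; have mF1 := measurable_preimage mX1 mF.
have [mU _ _ hind] := hU.
have mf : measurable_fun setT (fun w => (X0 w, U w)) by exact: measurable_fun_pair.
rewrite -[RHS](scaled_lawE P mf)//.
transitivity (law P mf mF1 D); first by [].
apply: measure_prod_unique mD; first exact: (law_lty mf mF1 (probability_lty P)).
move=> E B mE mB; rewrite scaled_lawE// lawE.
have mR0 := measurable_preimage (measurable_restr mS0) mE.
have mR1 := measurable_preimage (measurable_restr mS1) mF.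
transitivity (P (X0 @^-1` E `&` X1 @^-1` F) * P (U @^-1` B))%E.
  rewrite -[X in (P X * _)%E]/(X @^-1` (restr S0 @^-1` E `&` restr S1 @^-1` F)) -hind//; last exact: measurableI.
  by congr (P _); apply/seteqP; split => w /=; tauto.
transitivity (P (X0 @^-1` E) * P (U @^-1` B) * P (X1 @^-1` F))%E.
  by rewrite independent_configs// muleAC.
rewrite -[X in (P X * _ * _)%E]/(X @^-1` (restr S0 @^-1` E)) -hind//.
Qed.

End independence.

(** * The sigma-algebra of inputs *)

Section inputs.
Variable R : realType.
Implicit Types (S : set (vertex R)).

Definition input_space S : Type := g_sigma_algebraType (@input_events R S).
HB.instance Definition _ S := Measurable.on (input_space S).

Definition cylinder (n : nat) (D : set (vertex R * config R))
    (e : 'I_n -> vertex R * config R -> edge R) (B : 'I_n -> set R) : set (input R) :=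
  [set a | D a.1 /\ forall i, B i (a.2 (e i a.1))].

Lemma input_fst_measurable S (D : set (vertex R * config R)) : measurable D ->
  measurable ([set a | D a.1] : set (input_space S)).
Proof. by move=> mD; apply: sub_sigma_algebra; left; exists D. Qed.

Lemma input_eval_measurable S (e : vertex R * config R -> edge R) (B : set R) :
  measurable_fun setT e -> (forall z, edges S (e z)) -> measurable B ->
  measurable ([set a | B (a.2 (e a.1))] : set (input_space S)).
Proof. by move=> me Se mB; apply: sub_sigma_algebra; right; exists e, B. Qed.

Lemma measurable_cylinder S n D (e : 'I_n -> vertex R * config R -> edge R) B :
  measurable D -> (forall i, measurable_fun setT (e i)) -> (forall i z, edges S (e i z)) ->
  (forall i, measurable (B i)) -> measurable (cylinder D e B : set (input_space S)).
Proof.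
move=> mD me Se mB; rewrite (_ : cylinder D e B = [set a | D a.1] `&`
   \bigcap_(i in [set: 'I_n]) [set a | B i (a.2 (e i a.1))]).
  apply: measurableI; first exact: input_fst_measurable.
  by apply: fin_bigcap_measurable => // i _; exact: (input_eval_measurable (me i) (Se i) (mB i)).
apply/seteqP; split => [a [Da h]|a [Da h]]; split => //.
  by move=> i _; exact: (h i).
by move=> i; exact: (h i).
Qed.

Lemma measurable_into_input S d (T : measurableType d) (f : T -> input_space S) :
  measurable_fun setT (fun t => (f t).1) ->
  (forall e : vertex R * config R -> edge R, measurable_fun setT e ->
     (forall z, edges S (e z)) -> measurable_fun setT (fun t => (f t).2 (e (f t).1))) ->
  measurable_fun setT f.
Proof.
move=> m1 m2; apply: (@measurability _ _ _ _ setT f (@input_events R S)) => //.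
move=> _ [_ [[D mD ->]|[e [B [me Se mB ->]]]] <-]; rewrite setTI.
  exact: (measurable_preimage m1 mD).
exact: (measurable_preimage (m2 e me Se) mB).
Qed.

Lemma measurable_edge_eq d (T : measurableType d) (f g : T -> edge R) :
  measurable_fun setT f -> measurable_fun setT g -> measurable [set t | f t = g t].
Proof.
move=> /measurable_fun_pairP[f1 f2] /measurable_fun_pairP[g1 g2].
rewrite (_ : mkset _ = [set t | (f t).1 = (g t).1] `&` [set t | (f t).2 = (g t).2]).
  by apply: measurableI; exact: measurable_vertex_eq.
apply/seteqP; split => t /=; first by move=> ->.
by move=> [e1 e2]; rewrite [LHS]surjective_pairing e1 e2 -surjective_pairing.
Qed.

(** Cylinders form a pi-system, but the edges of an intersection of two cylinders
may coincide, whereas the marks are independent only at distinct edges. Each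
cylinder is therefore cut according to which of its edges are equal; on each
piece, edges are kept once and their constraints are intersected. *)
Lemma input_dynkin S (e0 : nat -> edge R) (Q : set (set (input_space S))) :
  injective e0 -> (forall n, edges S (e0 n)) ->
  Q setT -> (forall A, measurable A -> Q A -> Q (~` A)) ->
  (forall F : (set (input_space S))^nat, (forall n, measurable (F n)) ->
     trivIset setT F -> (forall n, Q (F n)) -> Q (\bigcup_n F n)) ->
  (forall n D (e : 'I_n -> vertex R * config R -> edge R) B,
     measurable D -> (forall i, measurable_fun setT (e i)) -> (forall i z, edges S (e i z)) ->
     (forall z, injective (e ^~ z)) -> (forall i, measurable (B i)) ->
     Q (cylinder D e B)) ->
  forall A, measurable A -> Q A.
Proof.
move=> e0inj Se0 QT QC QU Qcyl.
pose G : set (set (input_space S)) := [set A | exists n D (e : 'I_n -> vertex R * config R -> edge R) B,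
  [/\ measurable D, forall i, measurable_fun setT (e i), forall i z, edges S (e i z),
   forall i, measurable (B i) & A = cylinder D e B]].
have Gm : G `<=` measurable.
  by move=> _ [n [D [e [B [mD me Se mB ->]]]]]; exact: measurable_cylinder.
have GE : measurable = <<s G >>.
  apply/seteqP; split; last exact: smallest_sub (@sigma_algebra_measurable _ _) Gm.
  apply: (@smallest_sub _ _ (@input_events R S)).
    exact: smallest_sigma_algebra.
  move=> _ [[D mD ->]|[e [B [me Se mB ->]]]]; apply: sub_sigma_algebra.
    exists 0%N, D, (fun _ _ => e0 0%N), (fun=> setT); split => //.
    by apply/seteqP; split => [a Da|a []//]; split.
  exists 1%N, setT, (fun=> e), (fun=> B); split => //.
  by apply/seteqP; split => [a Ba|a [_ /(_ ord0)]//]; split.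
move=> A; rewrite [X in X A]GE; apply: (@dynkin_induction _ _ G Q) => //.
  move=> _ _ [n1 [D1 [e1 [B1 [mD1 me1 Se1 mB1 ->]]]]] [n2 [D2 [e2 [B2 [mD2 me2 Se2 mB2 ->]]]]].
  exists (n1 + n2)%N, (D1 `&` D2),
    (fun i => match fintype.split i with inl i => e1 i | inr i => e2 i end),
    (fun i => match fintype.split i with inl i => B1 i | inr i => B2 i end).
  split; first exact: measurableI.
  - by move=> i; case: fintype.split.
  - by move=> i z; case: fintype.split.
  - by move=> i; case: fintype.split.
  apply/seteqP; split => [a [[D1a h1] [D2a h2]]|a [[D1a D2a] h]].
    by split => // i; case: fintype.split.
  split; split => // i; first by have := h (lshift _ i); rewrite (fintype.unsplitK (inl i)).
  by have := h (rshift _ i); rewrite (fintype.unsplitK (inr i)).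
move=> _ [n [D [e [B [mD me Se mB ->]]]]].
have Q0 : Q set0 by rewrite -setCT; apply: QC.
(* The inputs on which the pattern of equal edges is k. *)
pose Dk (k : {ffun 'I_n * 'I_n -> bool}) : set (vertex R * config R) :=
  [set z | D z /\ forall i j, (e i z == e j z) = k (i, j)].
have mDk k : measurable (Dk k).
  rewrite (_ : Dk k = D `&` \bigcap_(p in [set: 'I_n * 'I_n])
      (if k p then [set z | e p.1 z = e p.2 z] else ~` [set z | e p.1 z = e p.2 z])).
    apply: measurableI => //; apply: fin_bigcap_measurable => // p _.
    case: (k p); first exact: measurable_edge_eq.
    by apply: measurableC; exact: measurable_edge_eq.
  apply/seteqP; split => [z [Dz h]|z [Dz h]]; split => //.
    by move=> [i j] _ /=; rewrite -h; case: ifPn => /eqP.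
  by move=> i j; have := h (i, j) I; case: (k (i, j)) => /= [->|/eqP/negPf ->//]; rewrite eqxx.
suff Qk k : Q (cylinder (Dk k) e B).
  pose F l : set (input_space S) := if choice.pickle_inv l is Some k then cylinder (Dk k) e B else set0.
  rewrite (_ : cylinder D e B = \bigcup_l F l).
    apply: QU.
    - by move=> l; rewrite /F; case: choice.pickle_inv => // k; exact: measurable_cylinder.
    - move=> l l' _ _ [a []]; rewrite /F.
      case el : (choice.pickle_inv l) => [k|//] [[_ h] _].
      case el' : (choice.pickle_inv l') => [k'|//] [[_ h'] _].
      have kk : k = k' by apply/ffunP => -[i j]; rewrite -h -h'.
      have := @choice.pickle_invK {ffun 'I_n * 'I_n -> bool} l.
      have := @choice.pickle_invK {ffun 'I_n * 'I_n -> bool} l'.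
      by rewrite el el' /= => <- <-; rewrite kk.
    - by move=> l; rewrite /F; case: choice.pickle_inv.
  apply/seteqP; split => [a [Da h]|a [l _]].
    exists (choice.pickle [ffun p => e p.1 a.1 == e p.2 a.1]) => //.
    by rewrite /F choice.pickleK_inv; split => //; split => // i j; rewrite ffunE.
  by rewrite /F; case: choice.pickle_inv => // k [[Da _] h].
have [[z0 [Dz0 hz0]]|noz] := pselect (exists z, Dk k z); last first.
  rewrite (_ : cylinder (Dk k) e B = set0)//; apply/seteqP; split => // a [ha _].
  by apply: noz; exists a.1.
(* The first index of every class of equal edges. *)
pose J : {set 'I_n} := finset (fun j : 'I_n => [forall i : 'I_n, (i < j)%N ==> ~~ k (i, j)]).
pose m := #|J|.
pose e' (i : 'I_m) z := if `[< Dk k z >] then e (enum_val i) z else e0 i.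
pose B' (i : 'I_m) := \bigcap_(l in [set: 'I_n]) (if k (l, enum_val i) then B l else setT).
rewrite (_ : cylinder (Dk k) e B = cylinder (Dk k) e' B'); last first.
  apply/seteqP; split => [a [Da h]|a [Da h]]; split => //.
    move=> i l _; rewrite /e' asboolT//; case: ifPn => // kl.
    have := h l; case: Da => _ hk; have := hk l (enum_val i).
    by rewrite kl => /eqP ->.
  move=> l; have [Daa hk] := Da.
  have ex : exists j : nat, [exists i : 'I_n, (i == j :> nat) && k (l, i)].
    by exists l; apply/existsP; exists l; rewrite eqxx -hk eqxx.
  case: (ex_minnP ex) => j /existsP[i /andP[/eqP ij kli]] jmin.
  have iJ : i \in J.
    rewrite inE; apply/forallP => i'; apply/implyP => lt; apply/negP => ki'.
    have /jmin : [exists i0 : 'I_n, (i0 == i' :> nat) && k (l, i0)].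
      apply/existsP; exists i'; rewrite eqxx/= -hk.
      move: kli ki'; rewrite -!hk => /eqP -> /eqP ->; exact: eqxx.
    by rewrite -ij leqNgt lt.
  have := h (enum_rank_in iJ i) l I; rewrite /e' asboolT// enum_rankK_in// kli.
  by move: kli; rewrite -hk => /eqP ->.
apply: Qcyl => //.
- move=> i; apply: measurable_fun_ifT => //.
  by apply: measurable_fun_asbool => //; rewrite setTI; exact: mDk.
- by move=> i z; rewrite /e'; case: ifP.
- move=> z i j; rewrite /e'; case: ifPn => [/asboolP [_ hz]|_ /e0inj /ord_inj//] /eqP.
  rewrite hz => kij; apply: enum_val_inj; apply/eqP; rewrite -val_eqE eqn_leq.
  have := enum_valP i; have := enum_valP j; rewrite !inE => /forallP jJ /forallP iJ.
  apply/andP; split; rewrite leqNgt; apply/negP => lt.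
    have := implyP (iJ (enum_val j)) lt.
    by rewrite -hz eq_sym hz kij.
  by have := implyP (jJ (enum_val i)) lt; rewrite kij.
- by move=> i; apply: fin_bigcap_measurable => // l _; case: ifP.
Qed.

End inputs.

(** * Random inputs and their laws on cylinders *)

Section input_maps.
Context (R : realType) (d : measure_display) (Omega : measurableType d)
  (P : probability Omega R) (X : Omega -> config R) (U : Omega -> R)
  (V : Omega -> edge_family R).
Hypotheses (hX : poisson_process P X) (hU : uniform_mark P X U)
  (hV : iid_uniform_edges P X U V).

(** Infinitely many distinct edges at one position, used to fill in for edges that
are undefined or repeated. *)
Definition base_edge (x : R) (n : nat) : edge R := ((x, 1), (x, n.+2%:R^-1)).

Lemma base_edge_inj x : injective (base_edge x).
Proof. by move=> m n [] /invr_inj /eqP; rewrite eqr_nat => /eqP[]. Qed.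

Lemma base_edge_edges (G : set R) x n : G x -> edges (strip G) (base_edge x n).
Proof.
move=> Gx; split; first by split => //=; rewrite in_itv/= ltr01 lexx.
split; last by rewrite /= invf_lt1// ltr1n.
by split => //=; rewrite in_itv/= invr_gt0 ltr0n/= invf_le1// ler1n.
Qed.

Lemma input_measure_unique (G : set R) (m1 m2 : {measure set (input_space (strip G)) -> \bar R}) :
  G !=set0 -> (m1 setT < +oo)%E ->
  (forall n D (e : 'I_n -> vertex R * config R -> edge R) B,
     measurable D -> (forall i, measurable_fun setT (e i)) ->
     (forall i z, edges (strip G) (e i z)) ->
     (forall z, injective (e ^~ z)) -> (forall i, measurable (B i)) ->
     m1 (cylinder D e B) = m2 (cylinder D e B)) ->
  forall A, measurable A -> m1 A = m2 A.
Proof.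
move=> [x Gx] m1oo h.
have setTE : setT = cylinder setT (fun (_ : 'I_0) _ => base_edge x 0) (fun=> setT).
  by apply/seteqP; split => // a _; split => // -[].
have m12T : m1 setT = m2 setT.
  rewrite setTE; apply: h => //.
  - by move=> _ z; exact: base_edge_edges.
  - by move=> z [].
have fin1 A : measurable A -> m1 A \is a fin_num.
  move=> mA; rewrite ge0_fin_numE//; apply: le_lt_trans m1oo.
  by apply: le_measure; rewrite ?inE.
have fin2 A : measurable A -> m2 A \is a fin_num.
  move=> mA; rewrite ge0_fin_numE//; apply: le_lt_trans m1oo; rewrite m12T.
  by apply: le_measure; rewrite ?inE.
apply: (input_dynkin (e0 := base_edge x) (Q := fun A => m1 A = m2 A)) => //.
- exact: base_edge_inj.
- by move=> n; exact: base_edge_edges.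
- move=> A mA e; have mCA := measurableC mA.
  have e1 : (m1 A + m1 (~` A) = m1 setT)%E.
    by rewrite -measureU// ?setUv// setICr.
  have e2 : (m2 A + m2 (~` A) = m2 setT)%E.
    by rewrite -measureU// ?setUv// setICr.
  have : (m1 A + m1 (~` A) = m1 A + m2 (~` A))%E by rewrite e1 m12T -e2 e.
  move: (fin1 _ mA) (fin1 _ mCA) (fin2 _ mCA).
  case: (m1 A) => // a _; case: (m1 (~` A)) => // b _; case: (m2 (~` A)) => // c _.
  by rewrite -!EFinD => -[] /addrI ->.
- move=> F mF tF eF; rewrite !measure_bigcup//.
  by apply: eq_eseriesr => n _.
Qed.

(** A way to build an input from the process and the mark: the point and the
configuration, and a relabelling of the edges along which the marks are read.
Injectivity keeps the marks at distinct edges independent. *)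
Record input_map (S : set (vertex R)) := InputMap {
  im_pt : config R * R -> vertex R * config R;
  im_edge : config R * R -> edge R -> edge R;
  im_pt_measurable : measurable_fun setT im_pt;
  im_edge_measurable : forall e : vertex R * config R -> edge R,
    measurable_fun setT e -> (forall z, edges S (e z)) ->
    measurable_fun setT (fun z => im_edge z (e (im_pt z)));
  im_edge_edges : forall z e, edges S e -> edges (strip setT) (im_edge z e);
  im_edge_inj : forall z e e', edges S e -> edges S e' ->
    im_edge z e = im_edge z e' -> e = e' }.

Section input_of.
Variables (S : set (vertex R)) (f : input_map S).

Definition input_of (w : Omega) : input_space S :=
  (im_pt f (X w, U w), fun e => V w (im_edge f (X w, U w) e)).

Let eff (e : vertex R * config R -> edge R) (z : config R * R) := im_edge f z (e (im_pt f z)).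

Lemma measurable_input_of : measurable_fun setT input_of.
Proof.
apply: measurable_into_input => [|e me Se] /=.
  exact: measurableT_comp (im_pt_measurable f) (measurable_XU hX hU).
have [_ hV2] := hV.
have [] // := hV2 1%N (fun=> eff e).
- by move=> _; exact: im_edge_measurable.
- by move=> _ z; apply: im_edge_edges.
- by move=> z i j _; rewrite !ord1.
- by move=> /(_ ord0).
Qed.

(** The marks along distinct edges are independent of (X, U) even though the edges
depend on it, so they contribute a factor that depends on the sets B only. *)
Lemma law_cylinder (A : set (config R * R)) n D
    (e : 'I_n -> vertex R * config R -> edge R) B :
  measurable A -> measurable D -> (forall i, measurable_fun setT (e i)) ->
  (forall i z, edges S (e i z)) ->
  (forall z, injective (e ^~ z)) -> (forall i, measurable (B i)) ->
  P [set w | A (X w, U w) /\ cylinder D e B (input_of w)] =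
  (P [set w | A (X w, U w) /\ D (im_pt f (X w, U w))] *
   \prod_(i < n) lebesgue_measure (B i `&` `[0%R, 1%R]))%E.
Proof.
move=> mA mD me Se einj mB; have [_ hV2] := hV.
have [|||_ h] := hV2 n (fun i => eff (e i)).
- by move=> i; exact: im_edge_measurable.
- by move=> i z; apply: im_edge_edges.
- by move=> z i j /im_edge_inj h; apply: (einj (im_pt f z)); exact: h.
have mAD : measurable (A `&` im_pt f @^-1` D).
  by apply: measurableI => //; exact: measurable_preimage (im_pt_measurable f) mD.
rewrite -[RHS](h (A `&` im_pt f @^-1` D) B mAD mB); congr (P _).
by apply/seteqP; split => w /= => [[Aw [Dw hw]]|[[Aw Dw] hw]].
Qed.

End input_of.
End input_maps.

(** * The inputs seen from typical points and their Mecke formula *)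

Section maps.
Variable R : realType.

Lemma edges_sub (S S' : set (vertex R)) : S `<=` S' -> edges S `<=` edges S'.
Proof. by move=> SS' e [e1 [e2 e12]]; split; [exact: SS'|split => //; exact: SS']. Qed.

Section id_maps.
Variables (S : set (vertex R)).
Hypothesis SU : S `<=` strip setT.

Definition id_map (f : config R * R -> vertex R * config R) (mf : measurable_fun setT f) :
  input_map S.
Proof.
apply: (@InputMap _ S f (fun _ e => e)) => //.
- by move=> e me _; exact: measurableT_comp me mf.
- by move=> _ e; exact: edges_sub.
Defined.
End id_maps.

Lemma measurable_ins_restr (S : set (vertex R)) (g : config R * R -> vertex R) :
  measurable S -> measurable_fun setT g ->
  measurable_fun setT (fun z : config R * R => (g z, ins (g z) (restr S z.1))).
Proof.
move=> mS mg; apply: measurable_fun_pair => //.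
have m1 : measurable_fun setT (fun z : config R * R => (g z, restr S z.1) : vertex R * config R).
  by apply: measurable_fun_pair => //; exact: measurableT_comp (measurable_restr mS) measurable_fst.
exact: measurableT_comp (@measurable_ins R) m1.
Qed.

Lemma measurable_origin : measurable_fun setT (fun z : config R * R => (0, z.2) : vertex R).
Proof. by apply: measurable_fun_pair => //; exact: measurable_snd. Qed.

(** The origin with the uniform birth time added to the process on S. *)
Definition palm_input S (SU : S `<=` strip setT) (mS : measurable S) : input_map S :=
  id_map SU (measurable_ins_restr mS measurable_origin).

(** The origin with the given birth time s added to the process on S. *)
Definition fixed_input S (SU : S `<=` strip setT) (mS : measurable S) (s : R) : input_map S :=
  id_map SU (measurable_ins_restr mS (measurable_cst ((0, s) : vertex R))).

Lemma measurable_outer S (mS : measurable S) :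
  measurable_fun setT (fun z : config R * R => ((0, 1) : vertex R, restr S z.1)).
Proof.
apply: measurable_fun_pair => //.
exact: measurableT_comp (measurable_restr mS) measurable_fst.
Qed.

(** The unmodified process on S; the distinguished point (0, 1) is a dummy. *)
Definition outer_input S (SU : S `<=` strip setT) (mS : measurable S) : input_map S :=
  id_map SU (measurable_outer mS).

Section centre_map.
Variable t : R.
Hypothesis t0 : 0 < t.
Local Notation S := (strip (torus t)).
Local Notation tr := (translate (wrap_torus t)).

Definition sel_pt n (z : config R * R) : vertex R := sel n (restr S z.1).

Lemma measurable_sel_pt n : measurable_fun setT (sel_pt n).
Proof.
have m1 := measurableT_comp (measurable_restr (measurable_strip_torus t)) (@measurable_fst _ _ (config R) R).
exact: measurableT_comp (measurable_sel n) m1.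
Qed.

(** Moves an edge seen from a centred point at position x back to where it lies on
the torus. *)
Definition shift_edge (x : R) (e : edge R) : edge R := (tr x e.1, tr x e.2).

Lemma shift_edge_edges x e : edges S e -> edges S (shift_edge x e).
Proof. by move=> [e1 [e2 e12]]; split; [exact: translate_in|split => //; exact: translate_in]. Qed.

Lemma shift_edge_inj x e e' : edges S e -> edges S e' -> shift_edge x e = shift_edge x e' -> e = e'.
Proof.
case: e e' => [a b] [a' b'] [/= Sa [Sb _]] [/= Sa' [Sb' _]] h.
have := congr1 fst h; have := congr1 snd h.
by move=> /(translate_inj t0 Sb Sb') /= -> /(translate_inj t0 Sa Sa') /= ->.
Qed.

Lemma measurable_shift_edge d (T : measurableType d) (g : T -> R) (h : T -> edge R) :
  measurable_fun setT g -> measurable_fun setT h ->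
  measurable_fun setT (fun z => shift_edge (g z) (h z)).
Proof.
move=> mg /measurable_fun_pairP[h1 h2].
have mtr (k : T -> vertex R) : measurable_fun setT k -> measurable_fun setT (fun z => tr (g z) (k z)).
  move=> /measurable_fun_pairP[k1 k2]; apply: measurable_fun_pair => //.
  apply: measurableT_comp; first exact: measurable_wrap.
  exact: measurable_funD.
by apply: measurable_fun_pair; exact: mtr.
Qed.

(** The process seen from its n-th selected point, together with the marks read
along the translated edges. *)
Definition centre_input (n : nat) : input_map S.
Proof.
apply: (@InputMap _ S (fun z => centre t (sel_pt n z, restr S z.1))
  (fun z => shift_edge (sel_pt n z).1)).
- apply: measurableT_comp; first exact: measurable_centre.
  apply: measurable_fun_pair; first exact: measurable_sel_pt.
  exact: measurableT_comp (measurable_restr (measurable_strip_torus t)) measurable_fst.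
- move=> e me _; apply: measurable_shift_edge.
    by have /measurable_fun_pairP[] := measurable_sel_pt n.
  apply: measurableT_comp me _; apply: measurableT_comp; first exact: measurable_centre.
  apply: measurable_fun_pair; first exact: measurable_sel_pt.
  exact: measurableT_comp (measurable_restr (measurable_strip_torus t)) measurable_fst.
- move=> z e /(shift_edge_edges (sel_pt n z).1); apply: edges_sub; exact: strip_torus_sub.
- by move=> z e e'; exact: shift_edge_inj.
Defined.

End centre_map.
End maps.

Section input_mecke.
Context (R : realType) (d : measure_display) (Omega : measurableType d)
  (P : probability Omega R) (X : Omega -> config R) (U : Omega -> R)
  (V : Omega -> edge_family R).
Hypotheses (hX : poisson_process P X) (hU : uniform_mark P X U)
  (hV : iid_uniform_edges P X U V).
Variable t : R.
Hypothesis t0 : 0 < t.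
Local Notation S := (strip (torus t)).
Local Notation XS := (XS X S).
Let mS := measurable_strip_torus t.

Let palm_in := input_of X U V (palm_input (@strip_torus_sub R t) mS).
Let centre_in n := input_of X U V (centre_input t0 n).

(** The Campbell measure of the inputs seen from the points of the process. *)
Definition centred_palm : {measure set (input_space S) -> \bar R} :=
  sel_measure P (measurable_sel_event hX mS)
    (fun n => measurable_input_of hX hU hV (centre_input t0 n)).

(** On cylinders the marks give the same constant factor on both sides, and what
remains is [centred_mecke]. *)
Lemma input_mecke (A : set (input_space S)) : measurable A ->
  centred_palm A = (t%:E * P [set w | A (palm_in w)])%E.
Proof.
have mp := measurable_input_of hX hU hV (palm_input (@strip_torus_sub R t) mS).
pose m2 : {measure set (input_space S) -> \bar R} := mscale (NngNum (ltW t0)) (law P mp measurableT).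
have m2E B : m2 B = (t%:E * P [set w | B (palm_in w)])%E.
  by transitivity (t%:E * P ([set w | B (palm_in w)] `&` setT))%E; [|rewrite setIT].
rewrite -m2E; move: A; apply: input_measure_unique.
- by exists 0; exact: torus0.
- have aS : (area S < +oo)%E by rewrite (area_torus t0) ltry.
  apply: le_lt_trans (ins_measure_fin hX mS aS).
  rewrite (mecke hX mS (@strip_torus_sub R t) (@strip_torus_bounded R t) aS)//.
move=> n D e B mD me Se einj mB; rewrite m2E /centred_palm sel_measureE.
pose c := (\prod_(i < n) lebesgue_measure (B i `&` `[0%R, 1%R]))%E.
have cyl (f : input_map S) A' (mA' : measurable A') := law_cylinder hV f mA' mD me Se einj mB.
have cfin : c \is a fin_num.
  rewrite /c; apply: (big_ind (fun x : \bar R => x \is a fin_num)) => // [x y|i _]; first exact: fin_numM.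
  rewrite ge0_fin_numE; last exact: (measure_ge0 (@lebesgue_measure R)).
  apply: (@le_lt_trans _ _ (@lebesgue_measure R `[0%R, 1%R])).
    by apply: le_measure; rewrite ?inE//; exact: (measurableI _ _ (mB i) (measurable_itv _)).
  by rewrite lebesgue_measure_itv/= lte_fin ltr01 ltry.
transitivity (\sum_(k <oo) ((fine c)%:E * P (sel_map X S k @^-1` (centre t @^-1` D) `&` sel_event X S k)))%E.
  apply: eq_eseriesr => k _.
  have mA := measurable_preimage (measurable_fst : measurable_fun setT (fst : config R * R -> _))
    (measurable_preimage (measurable_restr mS) (measurable_selects k)).
  rewrite fineK// muleC.
  have := cyl (centre_input t0 k) _ mA.
  rewrite -/c.
  rewrite (_ : [set w | _ /\ cylinder _ _ _ _] =
    centre_in k @^-1` cylinder D e B `&` sel_event X S k); last first.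
    by apply/seteqP; split => w [].
  move=> e1; apply: etrans e1 _; congr (P _ * _)%E.
  by apply/seteqP; split => w [].
rewrite nneseriesZl// fineK// muleC.
rewrite -(sel_measureE P (measurable_sel_event hX mS) (measurable_sel_map hX mS)).
rewrite [X in (X * _)%E](centred_mecke hX hU t0 mD) -muleA; congr (_ * _)%E.
have := cyl (palm_input (@strip_torus_sub R t) mS) _ measurableT.
rewrite (_ : [set w | _ /\ cylinder _ _ _ _] = palm_in @^-1` cylinder D e B).
  move=> e1; apply: etrans (esym e1); congr (P _ * _)%E.
  by apply/seteqP; split => w // [].
by apply/seteqP; split => w // [].
Qed.

End input_mecke.

(** * Integral forms of the three identities in law *)

Section mixture.
Context d1 d2 (T : measurableType d1) (Y : measurableType d2) (R : realType)
  (P : {measure set T -> \bar R}) (k : T -> {measure set Y -> \bar R})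
  (m : {measure set Y -> \bar R}).
Hypotheses (mk : forall A, measurable A -> measurable_fun setT (fun u => k u A))
  (mE : forall A, measurable A -> m A = (\int[P]_u k u A)%E).
Import HBNNSimple.

Let integral_mixture_nnsfun (f : {nnsfun Y >-> R}) :
  (\int[m]_y (f y)%:E = \int[P]_u \int[k u]_y (f y)%:E)%E.
Proof.
have mf r : measurable (f @^-1` [set r]) by exact: measurable_sfunP.
have e (n : {measure set Y -> \bar R}) : (\int[n]_y (f y)%:E =
    \sum_(r \in range f) r%:E * n (f @^-1` [set r]))%E.
  by rewrite integralT_nnsfun sintegralE.
rewrite e; under [RHS]eq_integral do rewrite e.
rewrite ge0_integral_fsum//; last 2 first.
- by move=> r; apply: measurable_funeM; exact: mk.
- move=> r u _; have [r0|r0] := leP 0 r; first by rewrite mule_ge0.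
  by rewrite preimage_nnfun0// measure0 mule0.
apply: eq_fsbigr => r _; rewrite mE//.
have [r0|r0] := leP 0 r; first by rewrite ge0_integralZl//; exact: mk.
rewrite preimage_nnfun0//; under [in LHS]eq_integral do rewrite measure0.
under [in RHS]eq_integral do rewrite measure0 mule0.
by rewrite !integral0 mule0.
Qed.

(** The identity for the masses of events extends to integrals through simple
functions and monotone convergence. *)
Lemma integral_mixture (F : Y -> \bar R) :
  measurable_fun setT F -> (forall y, 0 <= F y)%E ->
  (\int[m]_y F y = \int[P]_u \int[k u]_y F y)%E.
Proof.
move=> mF F0; pose f_ := nnsfun_approx measurableT mF.
have conv (n : {measure set Y -> \bar R}) :
    (\int[n]_y F y = limn (fun i => \int[n]_y (f_ i y)%:E))%E.
  transitivity (\int[n]_y lim ((f_ i y)%:E @[i --> \oo]))%E.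
    by apply: eq_integral => y _; apply/esym/cvg_lim => //; apply: cvg_nnsfun_approx.
  rewrite monotone_convergence//.
  - by move=> i; exact/measurable_EFinP.
  - by move=> i y _; rewrite lee_fin.
  - by move=> y _ a b ab; rewrite lee_fin; exact/lefP/nd_nnsfun_approx.
rewrite conv; under [RHS]eq_integral do rewrite conv.
rewrite monotone_convergence//.
- by apply: congr_lim; apply/funext => i; exact: integral_mixture_nnsfun.
- move=> i; apply: measurable_fun_integral_kernel => //.
    by move=> y; rewrite lee_fin.
  exact/measurable_EFinP.
- by move=> i u _; apply: integral_ge0 => y _; rewrite lee_fin.
- move=> u _ a b ab; apply: ge0_le_integral => //.
  + by move=> y _; rewrite lee_fin.
  + exact/measurable_EFinP.
  + exact/measurable_EFinP.
  + by move=> y _; rewrite lee_fin; exact/lefP/nd_nnsfun_approx.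
Qed.

End mixture.

Lemma trivIset_preimage T1 T2 (f : T1 -> T2) (F : (set T2)^nat) :
  trivIset setT F -> trivIset setT (fun n => f @^-1` F n).
Proof. by move=> tF i j _ _ [x [xi xj]]; apply: tF => //; exists (f x). Qed.

Lemma measure_preimage_bigcup d1 d2 (T1 : measurableType d1) (T2 : measurableType d2)
  (R : realType) (m : {measure set T1 -> \bar R}) (f : T1 -> T2) (F : (set T2)^nat) :
  measurable_fun setT f -> (forall n, measurable (F n)) -> trivIset setT F ->
  m (f @^-1` \bigcup_n F n) = (\sum_(n <oo) m (f @^-1` F n))%E.
Proof.
move=> mf mF tF; rewrite preimage_bigcup measure_bigcup//.
- by apply: eq_eseriesl => n; rewrite in_setT.
- by move=> n _; exact: measurable_preimage.
- exact: trivIset_preimage.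
Qed.

Section functional_mecke.
Context (R : realType) (d : measure_display) (Omega : measurableType d)
  (P : probability Omega R) (X : Omega -> config R) (U : Omega -> R)
  (V : Omega -> edge_family R).
Hypotheses (hX : poisson_process P X) (hU : uniform_mark P X U)
  (hV : iid_uniform_edges P X U V).

(** The input seen from the point x of the torus. *)
Definition centred (t : R) (x : vertex R) (Z : config R) (W : edge_family R) : input R :=
  (centre t (x, Z), fun e => W (shift_edge t x.1 e)).

(** The Mecke formula in the form in which it is applied: the added point sits at
the origin and the marks are those of the original family. *)
Lemma mecke_integral (t : R) (t0 : 0 < t) (F : input_space (strip (torus t)) -> \bar R) :
  measurable_fun setT F -> (forall a, 0 <= F a)%E ->
  ((\int[P]_w \esum_(x in (XS X (strip (torus t)) w : set (vertex R)))
     F (centred t x (XS X (strip (torus t)) w) (V w))) =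
   t%:E * \int[P]_w F (input_of X U V (palm_input (@strip_torus_sub R t) (measurable_strip_torus t)) w))%E.
Proof.
move=> mF F0.
have mp := measurable_input_of hX hU hV (palm_input (@strip_torus_sub R t) (measurable_strip_torus t)).
transitivity (\int[centred_palm hX hU hV t0]_a F a)%E.
  rewrite integral_sel_measure//; apply: eq_integral => w _.
  rewrite (sum_sel (XS_locally_finite hX (@strip_torus_bounded R t) w) (fun x => F0 _)).
  by apply: eq_eseriesr => n _.
transitivity (\int[mscale (NngNum (ltW t0)) (law P mp measurableT)]_a F a)%E.
  apply: eq_measure_integral => A mA _; rewrite (input_mecke hX hU hV t0 mA).
  transitivity (t%:E * P ([set w | A (input_of X U V (palm_input (@strip_torus_sub R t) (measurable_strip_torus t)) w)] `&` setT))%E; last by [].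
  by rewrite setIT.
by rewrite ge0_integral_mscale//= integral_law.
Qed.

Section independence.
Variables (G0 G1 : set R) (r : R).
Local Notation S0 := (strip G0).
Local Notation S1 := (strip G1).
Hypotheses (mS0 : measurable S0) (mS1 : measurable S1)
  (S0U : S0 `<=` strip setT) (S1U : S1 `<=` strip setT)
  (S0r : S0 `<=` [set p | `|p.1| <= r]) (S1r : S1 `<=` [set p | `|p.1| <= r])
  (aS : (area (S0 `|` S1) < +oo)%E) (G01 : G0 `&` G1 = set0)
  (G0n : G0 !=set0) (G1n : G1 !=set0).

Let in0 := input_of X U V (palm_input S0U mS0).
Let in1 := input_of X U V (outer_input S1U mS1).
Let m0 : measurable_fun setT in0 := measurable_input_of hX hU hV (palm_input S0U mS0).
Let m1 : measurable_fun setT in1 := measurable_input_of hX hU hV (outer_input S1U mS1).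

(** The edges of disjoint strips are distinct, so both cylinders can be read off
one family of distinct edges. This factors the marks; the configurations are
independent by [independent_marked]. *)
Lemma independent_cylinders n D (e : 'I_n -> vertex R * config R -> edge R) B
    n' D' (e' : 'I_n' -> vertex R * config R -> edge R) B' :
  measurable D -> (forall i, measurable_fun setT (e i)) ->
  (forall i z, edges S0 (e i z)) -> (forall z, injective (e ^~ z)) ->
  (forall i, measurable (B i)) ->
  measurable D' -> (forall i, measurable_fun setT (e' i)) ->
  (forall i z, edges S1 (e' i z)) -> (forall z, injective (e' ^~ z)) ->
  (forall i, measurable (B' i)) ->
  P (in0 @^-1` cylinder D e B `&` in1 @^-1` cylinder D' e' B') =
  (P (in0 @^-1` cylinder D e B) * P (in1 @^-1` cylinder D' e' B'))%E.
Proof.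
move=> mD me Se einj mB mD' me' Se' einj' mB'.
have S01 : S0 `&` S1 = set0.
  apply/seteqP; split => // p [[p0 _] [p1 _]].
  by have : (G0 `&` G1) p.1 by []; rewrite G01.
pose f := palm_input S0U mS0; pose g := outer_input S1U mS1.
(* The edges of both cylinders as a single family. *)
pose ee (i : 'I_(n + n')) z := match fintype.split i with
  inl i => e i (im_pt f z) | inr i => e' i (im_pt g z) end.
pose BB (i : 'I_(n + n')) := match fintype.split i with inl i => B i | inr i => B' i end.
pose A := im_pt f @^-1` D `&` im_pt g @^-1` D'.
have mA : measurable A.
  by apply: measurableI; [exact: measurable_preimage (im_pt_measurable f) mD|
    exact: measurable_preimage (im_pt_measurable g) mD'].
have [_ hV2] := hV; have [|||_ h] := hV2 (n + n')%N ee.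
- move=> i; rewrite /ee; case: fintype.split => j.
    exact: measurableT_comp (me j) (im_pt_measurable f).
  exact: measurableT_comp (me' j) (im_pt_measurable g).
- by move=> i z; rewrite /ee; case: fintype.split => j; [apply: (edges_sub S0U)|apply: (edges_sub S1U)].
- have cross (i : 'I_n) (j : 'I_n') z z' : e i z = e' j z' -> False.
    move=> eij; have [i1 _] := Se i z; have [j1 _] := Se' j z'.
    have : (S0 `&` S1) (e i z).1 by split => //; rewrite eij.
    by rewrite S01.
  move=> z i j; rewrite /ee -{2}(fintype.splitK i) -{2}(fintype.splitK j).
  case: fintype.split => i'; case: fintype.split => j' //=.
  + by move=> /einj ->.
  + by move=> /cross.
  + by move=> /esym/cross.
  + by move=> /einj' ->.
have mBB i : measurable (BB i) by rewrite /BB; case: fintype.split.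
have := h A BB mA mBB.
rewrite (_ : [set w | _ /\ _] = in0 @^-1` cylinder D e B `&` in1 @^-1` cylinder D' e' B'); last first.
  apply/seteqP; split => [w [[Aw Aw'] hw]|w [[Dw hw] [Dw' hw']]].
    split; split => // i; first by have := hw (lshift _ i); rewrite /ee /BB (fintype.unsplitK (inl i)).
    by have := hw (rshift _ i); rewrite /ee /BB (fintype.unsplitK (inr i)).
  by split => // i; rewrite /ee /BB; case: fintype.split => j; [exact: hw|exact: hw'].
move=> e1; apply: (etrans e1) => {e1 h}.
have c0 := law_cylinder hV f measurableT mD me Se einj mB.
have c1 := law_cylinder hV g measurableT mD' me' Se' einj' mB'.
have e0 : P (in0 @^-1` cylinder D e B) =
    P [set w | setT (X w, U w) /\ cylinder D e B (input_of X U V f w)].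
  by congr (P _); apply/seteqP; split => w // [].
have e1 : P (in1 @^-1` cylinder D' e' B') =
    P [set w | setT (X w, U w) /\ cylinder D' e' B' (input_of X U V g w)].
  by congr (P _); apply/seteqP; split => w // [].
rewrite e0 e1 c0 c1 big_split_ord/=.
have -> : (\prod_(i < n) lebesgue_measure (BB (lshift n' i) `&` `[0%R, 1%R]) =
   \prod_(i < n) lebesgue_measure (B i `&` `[0%R, 1%R]))%E.
  by apply: eq_bigr => i _; rewrite /BB (fintype.unsplitK (inl i)).
have -> : (\prod_(i < n') lebesgue_measure (BB (rshift n i) `&` `[0%R, 1%R]) =
   \prod_(i < n') lebesgue_measure (B' i `&` `[0%R, 1%R]))%E.
  by apply: eq_bigr => i _; rewrite /BB (fintype.unsplitK (inr i)).
rewrite muleACA; congr (_ * _)%E.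
pose D0 : set (config R * R) := [set q | D ((0, q.2), ins (0, q.2) q.1)].
pose D1 : set (config R) := [set c | D' ((0, 1), c)].
have mD0 : measurable D0.
  have m2 : measurable_fun setT (fun q : config R * R => ((0, q.2), q.1) : vertex R * config R).
    by apply: measurable_fun_pair => //; exact: measurable_origin.
  have m3 : measurable_fun setT (fun q : vertex R * config R => (q.1, ins q.1 q.2)).
    by apply: measurable_fun_pair => //; exact: measurable_ins.
  exact: measurable_preimage (measurableT_comp m3 m2) mD.
have mD1 : measurable D1.
  have m2 : measurable_fun setT (fun c : config R => ((0, 1), c) : vertex R * config R).
    exact: measurable_fun_pair.
  exact: measurable_preimage m2 mD'.
apply: etrans (etrans (independent_marked hX hU mS0 mS1 S0U S1U S0r S1r aS S01 mD0 mD1) _).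
  by [].
congr (P _ * P _)%E; apply/seteqP; split => w //; by case.
Qed.

Lemma input_independence A0 A1 : measurable A0 -> measurable A1 ->
  P (in0 @^-1` A0 `&` in1 @^-1` A1) = (P (in0 @^-1` A0) * P (in1 @^-1` A1))%E.
Proof.
have step n D (e : 'I_n -> vertex R * config R -> edge R) B (A : set (input_space S1)) :
  measurable D -> (forall i, measurable_fun setT (e i)) ->
  (forall i z, edges S0 (e i z)) -> (forall z, injective (e ^~ z)) ->
  (forall i, measurable (B i)) -> measurable A ->
  P (in0 @^-1` cylinder D e B `&` in1 @^-1` A) =
  (P (in0 @^-1` cylinder D e B) * P (in1 @^-1` A))%E.
  move=> mD me Se einj mB mA.
  have mE := measurable_preimage m0 (measurable_cylinder mD me Se mB).
  rewrite setIC muleC -[RHS](scaled_lawE P m1)//.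
  transitivity (law P m1 mE A); first by [].
  move: A mA; apply: input_measure_unique => //.
    exact: (law_lty m1 mE (probability_lty P)).
  move=> n' D' e' B' mD' me' Se' einj' mB'; rewrite scaled_lawE// lawE setIC.
  apply: etrans (independent_cylinders mD me Se einj mB mD' me' Se' einj' mB') _.
  exact: muleC.
move=> mA0 mA1; have mF := measurable_preimage m1 mA1.
rewrite -[RHS](scaled_lawE P m0)//.
transitivity (law P m0 mF A0); first by [].
move: A0 mA0; apply: input_measure_unique => //.
  exact: (law_lty m0 mF (probability_lty P)).
move=> n D e B mD me Se einj mB; rewrite scaled_lawE// lawE.
exact: step.
Qed.

Lemma integral_independent (F0 : input_space S0 -> \bar R) (F1 : input_space S1 -> \bar R) :
  measurable_fun setT F0 -> measurable_fun setT F1 ->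
  (forall a, 0 <= F0 a)%E -> (forall a, 0 <= F1 a)%E ->
  (\int[P]_w (F0 (in0 w) * F1 (in1 w)) =
   (\int[P]_w F0 (in0 w)) * (\int[P]_w F1 (in1 w)))%E.
Proof.
move=> mF0 mF1 F00 F10.
pose f0 : {mfun Omega >-> input_space S0} := HB.pack in0 (isMeasurableFun.Build _ _ _ _ in0 m0).
pose f1 : {mfun Omega >-> input_space S1} := HB.pack in1 (isMeasurableFun.Build _ _ _ _ in1 m1).
pose nu0 := distribution P f0; pose nu1 := distribution P f1.
have m01 : measurable_fun setT (fun w => (in0 w, in1 w)) by exact: measurable_fun_pair.
have mFF : measurable_fun setT (fun a : input_space S0 * input_space S1 => F0 a.1 * F1 a.2)%E.
  apply: emeasurable_funM; first exact: measurableT_comp mF0 measurable_fst.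
  exact: measurableT_comp mF1 measurable_snd.
transitivity (\int[law P m01 measurableT]_a (F0 a.1 * F1 a.2))%E.
  by rewrite integral_law// => a; exact: mule_ge0.
transitivity (\int[nu0 \x nu1]_a (F0 a.1 * F1 a.2))%E.
  apply: eq_measure_integral => A mA _; apply: measure_prod_unique mA.
    exact: (law_lty m01 measurableT (probability_lty P)).
  move=> C B mC mB; rewrite lawE setIT.
  transitivity (nu0 C * nu1 B)%E; last by apply/esym; exact: product_measure1E.
  exact: input_independence.
rewrite fubini_tonelli1//; last by move=> a; exact: mule_ge0.
transitivity (\int[nu0]_a (F0 a * \int[nu1]_b F1 b))%E.
  by apply: eq_integral => a _; rewrite /fubini_F/= ge0_integralZl.
rewrite ge0_integralZr//; last exact: integral_ge0.
by rewrite !ge0_integral_distribution.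
Qed.

End independence.

Section disintegration.
Local Notation S := (strip [set: R]).
Let SUT : S `<=` strip setT. Proof. by []. Qed.
Let mS : measurable S. Proof. exact: measurable_strip. Qed.

Let palm_in := input_of X U V (palm_input SUT mS).
Let fixed_in s := input_of X U V (fixed_input SUT mS s).
Let mpalm : measurable_fun setT palm_in := measurable_input_of hX hU hV (palm_input SUT mS).
Let mfixed s : measurable_fun setT (fixed_in s) := measurable_input_of hX hU hV (fixed_input SUT mS s).

(** On cylinders the mark factor does not depend on the birth time, and the rest is
the independence of the mark U and the process. *)
Lemma disintegrate (A : set (input_space S)) : measurable A ->
  measurable_fun setT (fun s => P (fixed_in s @^-1` A)) /\
  P (palm_in @^-1` A) = (\int[P]_u P (fixed_in (U u) @^-1` A))%E.
Proof.
move: A; have mU := measurable_U hU.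
apply: (input_dynkin (e0 := base_edge 0)
  (Q := fun A => measurable_fun setT (fun s => P (fixed_in s @^-1` A)) /\
    P (palm_in @^-1` A) = (\int[P]_u P (fixed_in (U u) @^-1` A))%E)).
- exact: base_edge_inj.
- by move=> n; exact: base_edge_edges.
- have eT s : P (fixed_in s @^-1` setT) = 1%E by rewrite preimage_setT probability_setT.
  split; first exact: (eq_measurable_fun (cst 1%E)).
  transitivity (\int[P]_u (cst 1%E u))%E.
    by rewrite integral_cst// mul1e preimage_setT.
  by apply: eq_integral => u _; rewrite eT.
- move=> A mA [h1 h2].
  have mA1 s := measurable_preimage (mfixed s) mA.
  have eC s : P (fixed_in s @^-1` (~` A)) = (1 - P (fixed_in s @^-1` A))%E.
    by rewrite preimage_setC probability_setC//; exact: mA1.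
  split.
    by under eq_fun do rewrite eC; exact: emeasurable_funB.
  rewrite preimage_setC probability_setC; last exact: measurable_preimage.
  rewrite h2; under [RHS]eq_integral do rewrite eC.
  have mg := measurableT_comp h1 mU.
  have g0 u : (0 <= P (fixed_in (U u) @^-1` A))%E by exact: measure_ge0.
  have g1 u : (P (fixed_in (U u) @^-1` A) <= 1)%E by exact: probability_le1.
  have bounded_fin_num u : P (fixed_in (U u) @^-1` A) \is a fin_num by exact: fin_num_measure.
  have Ig1 : (\int[P]_u P (fixed_in (U u) @^-1` A) \is a fin_num)%E.
    rewrite ge0_fin_numE ?integral_ge0//.
    apply: (@le_lt_trans _ _ (\int[P]_u 1)%E); first exact: ge0_le_integral.
    by rewrite integral_cst// mul1e; exact: (probability_lty P).
  have : (\int[P]_u (1 - P (fixed_in (U u) @^-1` A)) + \int[P]_u P (fixed_in (U u) @^-1` A) = 1)%E.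
    rewrite -ge0_integralD//; last 2 first.
    - by move=> u _; rewrite sube_ge0 ?bounded_fin_num// g1.
    - exact: emeasurable_funB.
    under eq_integral do rewrite subeK//.
    by rewrite integral_cst// mul1e; exact: probability_setT.
  by move=> e; rewrite -[X in (X - _)%E = _]e addeK.
- move=> F mF tF h.
  have mF1 s n := measurable_preimage (mfixed s) (mF n).
  have eU s : P (fixed_in s @^-1` \bigcup_n F n) = (\sum_(n <oo) P (fixed_in s @^-1` F n))%E.
    exact: measure_preimage_bigcup.
  split.
    under eq_fun do rewrite eU.
    apply: (ge0_emeasurable_sum (P := predT)) => // n _; exact: (h n).1.
  under eq_integral do rewrite eU.
  rewrite integral_nneseries//; last first.
    by move=> n; exact: measurableT_comp (h n).1 mU.
  rewrite measure_preimage_bigcup//.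
  by apply: eq_eseriesr => n _; exact: (h n).2.
- move=> n D e B mD me Se einj mB.
  pose c := (\prod_(i < n) lebesgue_measure (B i `&` `[0%R, 1%R]))%E.
  have cyl (f : input_map S) : P (input_of X U V f @^-1` cylinder D e B) =
      (P [set w | D (im_pt f (X w, U w))] * c)%E.
    transitivity (P [set w | setT (X w, U w) /\ cylinder D e B (input_of X U V f w)]).
      by congr (P _); apply/seteqP; split => w // [].
    apply: etrans (law_cylinder hV f measurableT mD me Se einj mB) _.
    by congr (P _ * _)%E; apply/seteqP; split => w // [].
  pose D' : set (vertex R * config R) := [set q | D (q.1, ins q.1 (restr S q.2))].
  have mD' : measurable D'.
    have m1 : measurable_fun setT (fun q : vertex R * config R => (q.1, restr S q.2)).
      apply: measurable_fun_pair => //.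
      exact: measurableT_comp (measurable_restr mS) measurable_snd.
    have m3 : measurable_fun setT (fun q : vertex R * config R => (q.1, ins q.1 q.2)).
      by apply: measurable_fun_pair => //; exact: measurable_ins.
    exact: (measurable_preimage (measurableT_comp m3 m1) mD).
  pose B' := [set q : R * Omega | D' ((0, q.1), X q.2)].
  have mB' : measurable B'.
    have m1 : measurable_fun setT (fun q : R * Omega => ((0, q.1), X q.2) : vertex R * config R).
      apply: measurable_fun_pair; first exact: measurable_fun_pair.
      exact: measurableT_comp (measurable_X hX) measurable_snd.
    exact: (measurable_preimage m1 mD').
  have mh : measurable_fun setT (fun s => P [set w | D' ((0, s), X w)]).
    apply: (@eq_measurable_fun _ _ _ _ _ (P \o xsection B')).
      move=> s _ /=; congr (P _).
      by apply/seteqP; split => w /=; rewrite /xsection/= inE.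
    exact: measurable_fun_xsection.
  split.
    apply: (@eq_measurable_fun _ _ _ _ _ (fun s => P [set w | D' ((0%R, s), X w)] * c)%E).
      by move=> s _; rewrite cyl.
    exact: emeasurable_funM.
  rewrite cyl; under eq_integral do rewrite cyl.
  rewrite ge0_integralZr//; last 2 first.
  - exact: measurableT_comp mh mU.
  - by apply: prode_ge0 => i _; exact: (measure_ge0 (@lebesgue_measure R)).
  congr (_ * _)%E; exact: (mark_law_pair hX hU mD').
Qed.

Lemma integral_disintegrate (F : input_space S -> \bar R) :
  measurable_fun setT F -> (forall a, 0 <= F a)%E ->
  measurable_fun setT (fun s => \int[P]_w F (fixed_in s w))%E /\
  (\int[P]_w F (palm_in w) = \int[P]_u \int[P]_w F (fixed_in (U u) w))%E.
Proof.
move=> mF F0.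
pose k s : {measure set (input_space S) -> \bar R} := law P (mfixed s) measurableT.
have kE s G : measurable_fun setT G -> (forall a, 0 <= G a)%E ->
    (\int[k s]_a G a = \int[P]_w G (fixed_in s w))%E.
  by move=> mG G0; rewrite integral_law.
have mk A : measurable A -> measurable_fun setT (fun s => k s A).
  move=> mA; apply: (@eq_measurable_fun _ _ _ _ _ (fun s => P (fixed_in s @^-1` A))).
    by move=> s _; rewrite /k lawE setIT.
  exact: (disintegrate mA).1.
split.
  apply: (@eq_measurable_fun _ _ _ _ _ (fun s => \int[k s]_a F a)%E).
    by move=> s _; rewrite kE.
  exact: measurable_fun_integral_kernel.
have -> : (\int[P]_w F (palm_in w) = \int[law P mpalm measurableT]_a F a)%E.
  by rewrite integral_law.
rewrite (@integral_mixture _ _ _ _ _ P (fun u => k (U u)))//.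
- by apply: eq_integral => u _; rewrite kE.
- by move=> A mA; exact: measurableT_comp (mk A mA) (measurable_U hU).
- move=> A mA; rewrite lawE setIT; apply: etrans (disintegrate mA).2 _.
  by apply: eq_integral => u _; rewrite lawE setIT.
Qed.

End disintegration.
End functional_mecke.

(** * Functionals as measurable functions of inputs *)

Section representation.
Variable R : realType.

(** Functionals are constrained only on admissible inputs, which need not form a
measurable set. A measurable function that agrees with the functional there is
the supremum over rational q of q on the events witnessing that the functional
exceeds q. *)
Lemma represent (S : set (vertex R)) (xi : point_functional R) :
  (forall x Z W, admissible S x Z W -> 0 <= xi x Z W) -> measurable_functional S xi ->
  exists F : input_space S -> \bar R, [/\ measurable_fun setT F, (forall a, 0 <= F a)%E &
    forall x Z W, admissible S x Z W -> F ((x, Z), W) = (xi x Z W)%:E].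
Proof.
move=> xi0 mxi.
have /choice[A hA] (n : nat) : exists A : set (input_space S), measurable A /\
    forall x Z W, admissible S x Z W ->
      (A ((x, Z : config R), W) <-> `]ratr (odflt 0 (choice.unpickle n)), +oo[%classic (xi x Z W)).
  have [|A mA h] := mxi `]ratr (odflt 0 (choice.unpickle n)), +oo[%classic.
    exact: measurable_itv.
  by exists A; split => // x Z W adm; rewrite h.
(* Levels are cut off at 0, a lower bound of the functional. *)
pose q n : R := Num.max 0 (ratr (odflt 0 (choice.unpickle n))).
have q0 n : 0 <= q n by rewrite le_max lexx.
pose h n (a : input_space S) := (q n * \1_(A n) a)%:E.
have h0 n a : (0 <= h n a)%E by rewrite lee_fin mulr_ge0.
have F0 a : (0 <= ereal_sup (range (h ^~ a)))%E.
  by apply: (le_trans (h0 0%N a)); apply: ereal_sup_ubound; exists 0%N.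
exists (fun a => ereal_sup (range (h ^~ a))); split => //.
- apply: (@eq_measurable_fun _ _ _ _ _ (fun a => esups (h ^~ a) 0)).
    move=> a _; rewrite /esups /sdrop; congr ereal_sup; apply/seteqP; split => [_ [n _ <-]|_ [n _ <-]];
    by exists n.
  apply: measurable_fun_esups => n; apply/measurable_EFinP; apply: measurable_funM => //.
  by apply: measurable_indic; exact: (hA n).1.
move=> x Z W adm; have x0 := xi0 _ _ _ adm; apply/eqP; rewrite eq_le; apply/andP; split.
  apply: ge_ereal_sup => _ [n _ <-]; rewrite lee_fin indicE; case: (boolP (_ \in _)) => [|_]; last by rewrite mulr0.
  rewrite inE (hA n).2// mulr1 /= in_itv/= andbT => lt.
  by rewrite ge_max x0 ltW.
apply/lee_addgt0Pr => e e0; have [//|x1] := leP (xi x Z W) 0.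
  move=> xle; rewrite (le_trans (y := 0%E))// ?lee_fin//.
  by rewrite adde_ge0 ?F0// lee_fin ltW.
have [r] := @rat_in_itvoo R (Num.max 0 (xi x Z W - e)) (xi x Z W) ltac:(by rewrite gt_max x1 ltrBlDr ltrDl).
rewrite in_itv/= gt_max => /andP[/andP[r0 re] rx].
rewrite (le_trans (y := ((ratr r)%:E + e%:E)%E))//.
  by rewrite -EFinD lee_fin -lerBlDr ltW.
rewrite leeD2r//; apply: ereal_sup_ubound; exists (choice.pickle r) => //.
have qr : q (choice.pickle r) = ratr r.
  by rewrite /q choice.pickleK/= max_r// ltW.
rewrite /h qr indicE mem_set ?mulr1//; apply/(hA _).2 => //.
by rewrite choice.pickleK/= in_itv/= rx.
Qed.

Lemma input_event_ext (S : set (vertex R)) (A : set (input_space S)) z (W W' : edge_family R) :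
  measurable A -> (forall e, edges S e -> W e = W' e) -> A (z, W) <-> A (z, W').
Proof.
move=> mA WW'; pose Q := [set A : set (input R) | A (z, W) <-> A (z, W')].
suff : <<s input_events S >> `<=` Q by apply.
apply: smallest_sub; first split.
- by [].
- by move=> B [h1 h2]; split => -[_ nB]; split => // b; apply: nB; [exact: h2|exact: h1].
- move=> F QF; rewrite /Q /=; split => -[n _ h]; exists n => //; exact/(QF n).
by move=> _ [[D mD ->]|[e [B [me Se mB ->]]]]; rewrite /Q/= // WW'.
Qed.

(** Every event of the sigma-algebra reads the marks only along the edges of S. *)
Lemma input_fun_ext (S : set (vertex R)) (F : input_space S -> \bar R) z (W W' : edge_family R) :
  measurable_fun setT F -> (forall e, edges S e -> W e = W' e) -> F (z, W) = F (z, W').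
Proof.
move=> mF WW'; have mA := measurable_preimage mF (emeasurable_set1 (F (z, W))).
have [h _] := input_event_ext z mA WW'.
by have /= -> := h erefl.
Qed.

Section torus_functional.
Context (d : measure_display) (Omega : measurableType d)
  (P : probability Omega R) (X : Omega -> config R) (U : Omega -> R)
  (V : Omega -> edge_family R).
Hypotheses (hX : poisson_process P X) (hU : uniform_mark P X U)
  (hV : iid_uniform_edges P X U V).

Let V01 w e : edges (strip setT) e -> 0 <= V w e <= 1.
Proof. by case: hV => + _; exact. Qed.

Let U01 w : 0 < U w <= 1. Proof. by case: hU. Qed.

Section torus.
Variables (t : R) (xi : point_functional R) (F : input_space (strip (torus t)) -> \bar R).
Hypotheses (t0 : 0 < t) (hxi : proper_functional (torus t) (wrap_torus t) xi).
Local Notation S := (strip (torus t)).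
Hypotheses (mF : measurable_fun setT F)
  (FE : forall x Z W, admissible S x Z W -> F ((x, Z), W) = (xi x Z W)%:E).

Lemma restrict_family_edges w e : edges S e -> restrict_family t V w e = V w e.
Proof. by move=> Se; rewrite /restrict_family mem_set. Qed.

Lemma restrict_family01 w e : edges S e -> 0 <= restrict_family t V w e <= 1.
Proof.
by move=> Se; rewrite restrict_family_edges//; apply: V01; exact: (edges_sub (@strip_torus_sub R t)).
Qed.

(** The score of the added point at the origin, as it appears in the hypotheses. *)
Lemma palm_functional w :
  (with_point xi (0, U w) (restrict_points t X w) (restrict_family t V w))%:E =
  F (input_of X U V (palm_input (@strip_torus_sub R t) (measurable_strip_torus t)) w).
Proof.
have lf : locally_finite (XS X S w) by exact: (XS_locally_finite hX (@strip_torus_bounded R t)).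
have S0 : S (0, U w) by split; [exact: torus0|rewrite /= in_itv/= U01].
rewrite /with_point -FE.
  rewrite /input_of /= /ins asboolT//; apply: input_fun_ext => // e Se.
  exact: restrict_family_edges.
split.
- by move=> p [->|[]].
- by move=> r; rewrite setIUl finite_setU; split => //; exact: finite_setIl.
- by left.
- exact: restrict_family01.
Qed.

(** Translation invariance replaces the score of a point of the torus by the score
of the origin in the centred input. *)
Lemma centred_functional w x : XS X S w x ->
  (xi x (restrict_points t X w) (restrict_family t V w))%:E =
  F (centred t x (XS X S w) (V w)).
Proof.
move=> Xx; have [_ inv _] := hxi.
have sh := XS_shiftable hX t w.
have Sx : S x by exact: sh.1.
have adm : admissible S x (XS X S w) (restrict_family t V w).
  by split; [exact: sh.1|exact: sh.2|exact: Xx|exact: restrict_family01].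
have trE p : translate (wrap_torus t) (wrap_torus t (- x.1)) p = translate (wrap_torus t) (- x.1) p.
  by rewrite /translate wrapDr.
have trE' p : translate (wrap_torus t) (- wrap_torus t (- x.1)) p = translate (wrap_torus t) x.1 p.
  by rewrite /translate wrapBr// opprK.
rewrite -/(XS X S w) (inv (wrap_torus t (- x.1)) _ _ _ _ adm); last exact: wrap_in.
rewrite trE (_ : translate (wrap_torus t) _ @` _ = translate (wrap_torus t) (- x.1) @` XS X S w); last first.
  by apply: eq_imagel => p _; exact: trE.
have tx : translate (wrap_torus t) (- x.1) x = (0, x.2).
  by rewrite /translate subrr wrap_torus_id//; exact: torus0.
rewrite -FE.
  rewrite /centred /centre /shiftc asboolT// tx; apply: input_fun_ext => // e Se.
  rewrite /translate_family !trE' restrict_family_edges//.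
  exact: (shift_edge_edges t0 x.1 Se).
split.
- by move=> _ [p Xp <-]; apply: translate_in => //; exact: sh.1.
- apply: finite_locally_finite; apply: finite_image; exact: shiftable_finite sh.
- by exists x.
- move=> e Se; rewrite /translate_family !trE'; apply: restrict_family01.
  exact: (shift_edge_edges t0 x.1 Se).
Qed.

End torus.

Lemma line_functional (xi : point_functional R) (F : input_space (strip setT) -> \bar R)
    (SUT : strip [set: R] `<=` strip setT) (mS : measurable (strip [set: R])) s w :
  (forall x Z W, admissible (strip setT) x Z W -> F ((x, Z), W) = (xi x Z W)%:E) ->
  0 < s <= 1 ->
  (with_point xi (0, s) (X w) (V w))%:E = F (input_of X U V (fixed_input SUT mS s) w).
Proof.
move=> FE s01.
have XE : restr (strip setT) (X w) = X w.
  by apply/seteqP; split => [p []//|p Xp]; split => //; exact: (X_strip hX) Xp.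
have lf := X_locally_finite hX w.
rewrite /with_point -FE.
  by rewrite /input_of /= /ins XE asboolT.
split.
- by move=> p [->|/(X_strip hX)//]; split => //=; rewrite in_itv.
- by move=> r; rewrite setIUl finite_setU; split => //; exact: finite_setIl.
- by left.
- exact: V01.
Qed.

Lemma line_palm (SUT : strip [set: R] `<=` strip setT) (mS : measurable (strip [set: R])) w :
  input_of X U V (palm_input SUT mS) w = input_of X U V (fixed_input SUT mS (U w)) w.
Proof. by []. Qed.

End torus_functional.
End representation.

(** * Sums of local functions and their measurability *)

Section transform.
Variable R : realType.

Lemma measurable_input_fst S : measurable_fun setT (fun b : @input_space R S => b.1).
Proof. by move=> _ D mD; rewrite setTI; exact: input_fst_measurable. Qed.

(** Serves for maps that move the points and relabel the edges accordingly: only the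
edges chosen measurably from an input have to be followed. *)
Lemma measurable_transform (S S' : set (vertex R)) (T : vertex R * config R -> vertex R * config R)
   (s : vertex R * config R -> edge R -> edge R) : measurable_fun setT T ->
  (forall e : vertex R * config R -> edge R, measurable_fun setT e -> (forall z, edges S' (e z)) ->
     measurable_fun setT (fun z => s z (e (T z))) /\ forall z, edges S (s z (e (T z)))) ->
  measurable_fun setT (fun b : input_space S => ((T b.1, fun e => b.2 (s b.1 e)) : input_space S')).
Proof.
move=> mT h; apply: measurable_into_input => /=.
  exact: measurableT_comp mT (@measurable_input_fst S).
move=> e me Se; have [ms Ss] := h e me Se.
by move=> _ B mB; rewrite setTI; exact: (input_eval_measurable ms Ss mB).
Qed.

Lemma torusS (a t : R) : a <= t -> torus a `<=` torus t.
Proof. by move=> at_ x; rewrite /torus /= !in_itv/= => /andP[x1 x2]; apply/andP; split; lra. Qed.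

Lemma stripS (G G' : set R) : G `<=` G' -> strip G `<=` strip G'.
Proof. by move=> GG' p [p1 p2]; split => //; exact: GG'. Qed.

(** If x is at distance at least a from the origin on the torus, its window of
length a does not meet the one around the origin. The hypothesis 2a <= t keeps
the windows from meeting around the torus. *)
Lemma far_translate (a t x p : R) : 0 < a -> a *+ 2 <= t ->
  torus t x -> ~ torus (a *+ 2) x -> torus t p -> torus a (wrap_torus t (p - x)) -> ~ torus a p.
Proof.
move=> a0 at2 tx nx tp; have [z ->] := wrap_shift t (p - x) => h hp; apply: nx.
have t0 : 0 < t by apply: lt_le_trans at2; rewrite (mulr2n a); lra.
move: tx tp h hp at2; rewrite /torus /= !in_itv/= (mulr2n a).
move=> /andP[x1 x2] /andP[p1 p2] /andP[h1 h2] /andP[p3 p4] at2.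
have z0 : z = 0.
  have h3 : t * z%:~R < t * 1 by lra.
  have h4 : t * (- 1) < t * z%:~R by lra.
  move: h3 h4; rewrite !ltr_pM2l// => h3 h4.
  have z1 : z < 1 by rewrite -(ltr_int R).
  have z2 : -1 < z by rewrite -(ltr_int R).
  lia.
move: h1 h2; rewrite z0 mulr0 addr0 => h1 h2.
by apply/andP; split; lra.
Qed.

End transform.

Section local_sums.
Context (R : realType).
Variables (a t : R) (K : R).
Hypotheses (a0 : 0 < a) (at2 : a *+ 2 <= t).
Local Notation Sa := (strip (torus a)).
Local Notation St := (strip (torus t)).
Definition far : set (vertex R) := St `\` strip (torus (a *+ 2)).
(** Disjoint from the window of length a around the origin, hence independent of it. *)
Definition ring_strip : set (vertex R) := strip (torus t `\` torus a).
Variable g : input_space Sa -> \bar R.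
Hypotheses (mg : measurable_fun setT g) (g0 : forall b, (0 <= g b)%E)
  (gK : forall b, (g b <= K%:E)%E).

Let t0 : 0 < t.
Proof. by apply: lt_le_trans at2; rewrite (mulr2n a) addr_gt0. Qed.

Let aSt : Sa `<=` St.
Proof. by apply: stripS; apply: torusS; by move: at2; rewrite (mulr2n a) => h; move: (a0); lra. Qed.

Definition localize (b : input R) : input_space Sa := ((b.1.1, restr Sa b.1.2), b.2).

Let T1 (z : vertex R * config R) : vertex R * config R := (z.1, restr Sa z.2).

Let mT1 : measurable_fun setT T1.
Proof.
apply: measurable_fun_pair => //.
exact: measurableT_comp (measurable_restr (measurable_strip_torus a)) measurable_snd.
Qed.

Lemma measurable_localize : measurable_fun setT (localize : input_space St -> input_space Sa).
Proof.
apply: (@measurable_transform _ _ _ T1 (fun _ e => e)) => // e me Se; split.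
  exact: measurableT_comp me mT1.
by move=> z; exact: (edges_sub aSt).
Qed.

Definition local_sum (Z : config R) (W : edge_family R) : \bar R :=
  (\esum_(x in (Z : set (vertex R))) g (localize (centred t x Z W)))%E.

Definition far_sum (Z : config R) (W : edge_family R) : \bar R :=
  (\esum_(x in (Z : set (vertex R)) `&` far) g (localize (centred t x Z W)))%E.

Let csel n (z : vertex R * config R) := centre t (sel n z.2, z.2).

Let msel n : measurable_fun setT (fun z : vertex R * config R => sel n z.2).
Proof. exact: measurableT_comp (measurable_sel n) measurable_snd. Qed.

Let mcsel n : measurable_fun setT (csel n).
Proof.
apply: measurableT_comp; first exact: measurable_centre.
exact: measurable_fun_pair.
Qed.

Let mshift n (e : vertex R * config R -> edge R) : measurable_fun setT e ->
  measurable_fun setT (fun z : vertex R * config R => shift_edge t (sel n z.2).1 (e z)).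
Proof.
move=> me; apply: measurable_shift_edge => //.
by have /measurable_fun_pairP[] := msel n.
Qed.

(** The sum is itself a functional of inputs, to which the Mecke formula applies in
the computation of its second moment. *)
Lemma measurable_local_sum : exists G : input_space St -> \bar R,
  [/\ measurable_fun setT G, (forall b, 0 <= G b)%E &
   forall x Z W, locally_finite Z -> G ((x, Z), W) = local_sum Z W].
Proof.
exists (fun b => \sum_(n <oo) if `[< selects n b.1.2 >] then
   g (localize (centred t (sel n b.1.2) b.1.2 b.2)) else 0)%E; split.
- apply: (ge0_emeasurable_sum (P := predT)) => [n b _ _|n _]; first by case: ifP.
  apply: measurable_fun_ifT => //.
    apply: measurable_fun_asbool => //; rewrite setTI.
    have m1 : measurable_fun setT (fun b : input_space St => b.1.2).
      exact: measurableT_comp measurable_snd (@measurable_input_fst _ St).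
    exact: measurable_preimage m1 (measurable_selects n).
  apply: measurableT_comp mg _; apply: measurableT_comp measurable_localize _.
  apply: (@measurable_transform _ _ _ (csel n) (fun z : vertex R * config R => shift_edge t (sel n z.2).1)) => // e me Se.
  split; last by move=> z; apply: shift_edge_edges.
  by apply: mshift; exact: measurableT_comp me (mcsel n).
- by move=> b; apply: nneseries_ge0 => n _ _; case: ifP.
- by move=> x Z W lf; rewrite /local_sum sum_sel.
Qed.

Lemma measurable_far : measurable far.
Proof. by apply: measurableD; exact: measurable_strip_torus. Qed.

Lemma far_torus x : far x -> torus t x.1 /\ ~ torus (a *+ 2) x.1.
Proof. by move=> [[tx x2] nx]; split => // h; apply: nx. Qed.

Lemma far_window x p : far x -> St p -> Sa (translate (wrap_torus t) (- x.1) p) -> ring_strip p.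
Proof.
move=> /far_torus[tx nx] [tp p2] [ap _]; split => //; split => //.
exact: (far_translate a0 at2 tx nx tp ap).
Qed.

Lemma shift_far x e : far x -> edges Sa e -> edges ring_strip (shift_edge t x.1 e).
Proof.
move=> fx [Se1 [Se2 e12]].
have h p : Sa p -> ring_strip (translate (wrap_torus t) x.1 p).
  move=> Sp; apply: (far_window fx); first by apply: translate_in => //; exact: aSt.
  by rewrite translateD// addNr translate_id//; exact: aSt.
by split; [exact: h|split => //; exact: h].
Qed.

(** The restricted sum is a functional of the process on the ring only, because
the windows of its points lie there. *)
Lemma measurable_far_sum : exists H : input_space ring_strip -> \bar R,
  [/\ measurable_fun setT H, (forall b, 0 <= H b)%E &
   forall x Z W, locally_finite Z -> H ((x, Z), W) = far_sum Z W].
Proof.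
pose fs n (z : vertex R * config R) e :=
  if `[< far (sel n z.2) >] then shift_edge t (sel n z.2).1 e else base_edge (t / 2) 0.
(* Far points shift the edges of the window into the ring; other points are given
   a dummy edge of the ring. *)
exists (fun b => \sum_(n <oo) if `[< selects n b.1.2 /\ far (sel n b.1.2) >] then
   g (T1 (csel n b.1), fun e => b.2 (fs n b.1 e)) else 0)%E; split.
- apply: (ge0_emeasurable_sum (P := predT)) => [n b _ _|n _]; first by case: ifP.
  have m1 : measurable_fun setT (fun b : input_space ring_strip => b.1.2).
    exact: measurableT_comp measurable_snd (@measurable_input_fst _ ring_strip).
  have mfar : measurable [set z : vertex R * config R | far (sel n z.2)].
    exact: measurable_preimage (msel n) measurable_far.
  apply: measurable_fun_ifT => //.
    apply: measurable_fun_asbool => //; rewrite setTI.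
    apply: measurableI; first exact: measurable_preimage m1 (measurable_selects n).
    exact: measurable_preimage (measurableT_comp (measurable_sel n) m1) measurable_far.
  apply: measurableT_comp mg _.
  apply: (@measurable_transform _ _ _ (fun z : vertex R * config R => T1 (csel n z)) (fs n)).
    exact: measurableT_comp mT1 (mcsel n).
  move=> e me Se; split.
    apply: measurable_fun_ifT => //.
      by apply: measurable_fun_asbool => //; rewrite setTI.
    apply: mshift; apply: measurableT_comp me _.
    exact: measurableT_comp mT1 (mcsel n).
  move=> z; rewrite /fs; case: ifPn => [/asboolP fz|_]; first exact: shift_far.
  apply: base_edge_edges; split; rewrite /torus /= in_itv/=.
    by rewrite lexx andbT; move: t0; lra.
  by move=> /andP[_]; move: (a0) at2; rewrite (mulr2n a); lra.
- by move=> b; apply: nneseries_ge0 => n _ _; case: ifP.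
- move=> x Z W lf; rewrite /far_sum esum_mkcondr sum_sel//; last first.
    by move=> y; case: ifP.
  apply: eq_eseriesr => n _ /=.
  have [sn|sn] := pselect (selects n Z); last first.
    by rewrite (asboolF sn) asboolF// => -[].
  rewrite (asboolT sn); have [fn|fn] := pselect (far (sel n Z)); last first.
    by rewrite memNset// asboolF// => -[].
  rewrite mem_set// asboolT//; congr g; congr (_, _).
  by apply/funext => e; rewrite /fs /= asboolT.
Qed.

End local_sums.

(** * The second moment of a local sum *)

Section recentring.
Context (R : realType).
Variables (a t : R).
Hypothesis t0 : 0 < t.
Local Notation St := (strip (torus t)).
Local Notation tr := (translate (wrap_torus t)).
Variable g : input_space (strip (torus a)) -> \bar R.

(** Translations of the torus compose, for points and for edges alike. *)
Lemma centred_centred x x' Z W : shiftable t Z ->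
  centred t (tr (- x.1) x') (centre t (x, Z)).2 (fun e => W (shift_edge t x.1 e)) =
  centred t x' Z W.
Proof.
move=> sZ; have [ZS _] := sZ.
have sZ' : shiftable t (tr (- x.1) @` Z).
  apply: finite_shiftable; first by apply: finite_image; exact: shiftable_finite sZ.
  by move=> _ [p Zp <-]; apply: translate_in => //; exact: ZS.
rewrite /centred /centre /shiftc /= (asboolT sZ) (asboolT sZ'); congr (_, _, _).
  rewrite image_comp; apply: eq_imagel => p _ /=.
  rewrite translateD// /translate; congr (_, _).
  rewrite /= (_ : p.1 + _ = p.1 - x.1 - wrap_torus t (x'.1 - x.1)); last by lra.
  by rewrite wrapBr//; congr (wrap_torus _ _); lra.
apply/funext => e; congr W; rewrite /shift_edge/= !translateD//.
have h p : wrap_torus t (p + (x.1 + wrap_torus t (x'.1 - x.1))) = wrap_torus t (p + x'.1).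
  by rewrite addrA wrapDr//; congr (wrap_torus _ _); lra.
by rewrite /translate /= !h.
Qed.

(** Centring translates all points at once, which only reindexes the sum. *)
Lemma local_sum_centred x Z W : shiftable t Z ->
  local_sum t g (centre t (x, Z)).2 (fun e => W (shift_edge t x.1 e)) = local_sum t g Z W.
Proof.
move=> sZ; have [ZS _] := sZ.
rewrite /local_sum {1}/centre /shiftc /= (asboolT sZ) esum_image; last first.
  by move=> p q; rewrite !inE => Zp Zq; apply: translate_inj => //; exact: ZS.
apply: eq_esum => p _; rewrite -(@centred_centred x p Z W)//; by rewrite /centre /shiftc /= (asboolT sZ).
Qed.

Hypothesis g0 : forall b, (0 <= g b)%E.

(** Puts the square in the form of a sum over the points of the process, with a
summand that is a function of the centred input: by translation invariance the
second factor can be computed after centring. *)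
Lemma local_sum_sq Z W (G : input_space St -> \bar R) : shiftable t Z ->
  (forall x Z W, locally_finite Z -> G ((x, Z), W) = local_sum t g Z W) ->
  (local_sum t g Z W * local_sum t g Z W =
   \esum_(x in (Z : set (vertex R))) (g (localize a (centred t x Z W)) * G (centred t x Z W)))%E.
Proof.
move=> sZ GE; have fZ := shiftable_finite sZ.
have lsE x : G (centred t x Z W) = local_sum t g Z W.
  rewrite -[RHS](@local_sum_centred x)// -(GE (0, x.2)) //.
  rewrite /centre /shiftc /= (asboolT sZ); apply: finite_locally_finite; exact: finite_image.
under [RHS]eq_esum do rewrite lsE.
have ls0 : (0 <= local_sum t g Z W)%E by apply: esum_ge0.
rewrite {1}/local_sum !esum_fset//; last by move=> x _; rewrite mule_ge0.
by rewrite ge0_mule_fsuml.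
Qed.

End recentring.

Section local_sum_facts.
Context (R : realType).
Variables (a t : R).
Hypotheses (a0 : 0 < a) (at2 : a *+ 2 <= t).
Local Notation Sa := (strip (torus a)).
Local Notation St := (strip (torus t)).
Local Notation tr := (translate (wrap_torus t)).
Local Notation far := (far a t).
Local Notation ring := (ring_strip a t).
Variable g : input_space Sa -> \bar R.
Hypothesis g0 : forall b, (0 <= g b)%E.

Let t0 : 0 < t.
Proof. by apply: lt_le_trans at2; rewrite (mulr2n a) addr_gt0. Qed.

(** The window around a far point sees only the ring. *)
Lemma localize_far x Z Z' W : shiftable t Z -> shiftable t Z' ->
  Z `&` ring = Z' `&` ring -> far x ->
  localize a (centred t x Z W) = localize a (centred t x Z' W).
Proof.
move=> sZ sZ' ZZ' fx; rewrite /localize /centred /centre /shiftc /= (asboolT sZ) (asboolT sZ').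
congr (_, _, _).
have h Y Y' : shiftable t Y -> Y `&` ring `<=` Y' -> restr Sa (tr (- x.1) @` Y) `<=` tr (- x.1) @` Y'.
  move=> [YS _] YY' _ [[p Yp <-] Sp]; exists p => //; apply: YY'; split => //.
  by apply: (far_window a0 at2 fx) => //; exact: YS.
apply/seteqP; split => p Sp; split; try exact: Sp.2.
  by apply: h Sp => //; rewrite ZZ'; exact: subIsetl.
by apply: h Sp => //; rewrite -ZZ'; exact: subIsetl.
Qed.

Lemma far_sum_ring Z Z' W : shiftable t Z -> shiftable t Z' ->
  Z `&` ring = Z' `&` ring -> far_sum t g Z W = far_sum t g Z' W.
Proof.
move=> sZ sZ' ZZ'; rewrite /far_sum.
have fr : far `<=` ring.
  move=> x fx; have [tx nx] := far_torus fx; have [[_ x2] _] := fx; split => //; split => // ax.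
  by apply: nx; apply: torusS ax; move: a0; rewrite (mulr2n a); lra.
have -> : (Z : set (vertex R)) `&` far = (Z' : set (vertex R)) `&` far.
  apply/seteqP; split => x [Zx fx]; split => //; have rx := fr _ fx.
    by have [] : (Z' `&` ring) x by rewrite -ZZ'.
  by have [] : (Z `&` ring) x by rewrite ZZ'.
by apply: eq_esum => x [_ fx]; rewrite (localize_far W sZ sZ').
Qed.

(** The near points are bounded by their number, and the far points are replaced by
the process on the ring, which does not see the added point. *)
Lemma local_sum_le K Z W y : (0 <= K)%R -> (forall b, g b <= K%:E)%E ->
  shiftable t Z -> Sa y ->
  (local_sum t g (ins y Z) W <=
   K%:E * (1 + cnt Z (strip (torus (a *+ 2)))) + far_sum t g (restr ring Z) W)%E.
Proof.
move=> K0 gK sZ Say.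
have [ZS lf] := sZ; have fZ := shiftable_finite sZ.
have aS : Sa `<=` St by apply: stripS; apply: torusS; move: a0 at2; rewrite (mulr2n a); lra.
have a2 : Sa `<=` strip (torus (a *+ 2)) by apply: stripS; apply: torusS; move: a0; rewrite (mulr2n a); lra.
have sI : shiftable t (y |` Z).
  by apply: finite_shiftable; rewrite ?finite_setU//; move=> p [->|/ZS//]; exact: aS.
have sR : shiftable t (restr ring Z).
  by apply: finite_shiftable; [exact: finite_setIl|move=> p [/ZS]].
have -> : ins y Z = y |` Z by rewrite /ins asboolT.
rewrite (@far_sum_ring _ (y |` Z))//; last first.
  rewrite /restr -setIA setIid setIUl (_ : [set y] `&` _ = set0) ?set0U//.
  by apply/seteqP; split => // p [->] [[_ +] _]; apply; exact: Say.1.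
rewrite /local_sum (esumID far)//= addeC; apply: leeD => //.
apply: (@le_trans _ _ (K%:E * cnt (y |` Z) (strip (torus (a *+ 2))))%E); last first.
  apply: lee_wpmul2l; first by rewrite lee_fin.
  have [Zy|nZy] := pselect (Z y).
    by rewrite (_ : y |` Z = Z) ?leeDr//; apply/setUidPr => _ ->.
  by rewrite cnt_setU1// indicE mem_set//; exact: a2.
rewrite cntE; set B := (y |` Z) `&` strip _.
have fB : finite_set B by apply: finite_setIl; rewrite finite_setU.
rewrite (esum_fset fB)// ge0_mule_fsumr//.
have -> : (\sum_(i \in B) K%:E * 1 = \esum_(i in B) K%:E)%E.
  by rewrite esum_fset ?lee_fin//; apply: eq_fsbigr => i _; rewrite mule1.
rewrite /B esum_mkcondr [leRHS]esum_mkcondr; apply: le_esum => p Yp.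
case: ifPn; last by case: ifP => // _ _; rewrite lee_fin.
rewrite inE => nf; rewrite mem_set//.
have : ~ (St p /\ ~ strip (torus (a *+ 2)) p) by [].
move=> h; apply: contrapT => np; apply: h; split => //; exact: sI.1.
Qed.

End local_sum_facts.

Section second_moment.
Context (R : realType) (d : measure_display) (Omega : measurableType d)
  (P : probability Omega R) (X : Omega -> config R) (U : Omega -> R)
  (V : Omega -> edge_family R).
Hypotheses (hX : poisson_process P X) (hU : uniform_mark P X U)
  (hV : iid_uniform_edges P X U V).
Variables (a t K : R).
Hypotheses (a0 : 0 < a) (at2 : a *+ 2 <= t) (K0 : 0 <= K).
Local Notation S u := (strip (torus u)).
Local Notation palm u := (input_of X U V (palm_input (@strip_torus_sub R u) (measurable_strip_torus u))).
Variable g : input_space (S a) -> \bar R.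
Hypotheses (mg : measurable_fun setT g) (g0 : forall b, (0 <= g b)%E)
  (gK : forall b, (g b <= K%:E)%E).
Let t0 : 0 < t.
Proof. by apply: lt_le_trans at2; rewrite (mulr2n a) addr_gt0. Qed.
Let m := (\int[P]_w g (palm a w))%E.

Lemma localize_palm w : localize a (palm t w) = palm a w.
Proof.
have sI : S a `<=` S t by apply: stripS; apply: torusS; move: a0 at2; rewrite (mulr2n a); lra.
rewrite /localize /input_of /=; congr (_, _, _).
have lf u : locally_finite (restr (S u) (X w)) by exact: (XS_locally_finite hX (@strip_torus_bounded R u)).
rewrite /ins (asboolT (lf a)) (asboolT (lf t)) /restr setIUl -setIA (setIidr sI); congr (_ `|` _).
apply/setIidPl => _ ->; split; first exact: torus0.
by rewrite /= in_itv/=; case: hU.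
Qed.

Lemma local_sum_mean :
  (\int[P]_w local_sum t g (XS X (S t) w) (V w) = t%:E * m)%E.
Proof.
have := @mecke_integral R d Omega P X U V hX hU hV t t0 (g \o localize a).
rewrite /local_sum => ->//.
- by congr (_ * _)%E; apply: eq_integral => w _; rewrite /= localize_palm.
- exact: measurableT_comp mg (measurable_localize a0 at2).
- by move=> b /=.
Qed.

(** The Mecke formula for the constant function 1 on the torus of length 2a. *)
Lemma cnt_mean : (\int[P]_w cnt (XS X (S t) w) (S (a *+ 2)) = (a *+ 2)%:E)%E.
Proof.
have a20 : 0 < a *+ 2 by rewrite (mulr2n a) addr_gt0.
have := @mecke_integral R d Omega P X U V hX hU hV _ a20 (cst 1%E).
rewrite /= integral_cst// mul1e => h.
have e1 := h (measurable_cst _) (fun _ => lee01).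
transitivity ((a *+ 2)%:E * P setT)%E; last by rewrite (probability_setT P) mule1.
apply: etrans e1; apply: eq_integral => w _.
rewrite cntE; congr esum; apply/seteqP; split => p /=.
  by move=> [[Xp _] Sp].
by move=> [Xp Sp]; split => //; split => //; apply: stripS Sp; exact: torusS.
Qed.

(** The square is expanded by the Mecke formula. The near points contribute a
constant, and the far points form a functional of the ring, independent of g at
the origin. *)
Lemma second_moment :
  (\int[P]_w (local_sum t g (XS X (S t) w) (V w) * local_sum t g (XS X (S t) w) (V w)) <=
   t%:E * ((K * K * (1 + a *+ 2))%:E + m * (t%:E * m)))%E.
Proof.
have [G [mG G0 GE]] := measurable_local_sum a0 at2 mg g0.
have mloc := measurable_localize a0 at2.
have mGg : measurable_fun setT (fun b : input_space (S t) => g (localize a b) * G b)%E.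
  by apply: emeasurable_funM => //; exact: measurableT_comp mg mloc.
have -> : (\int[P]_w (local_sum t g (XS X (S t) w) (V w) * local_sum t g (XS X (S t) w) (V w)) =
   t%:E * \int[P]_w (g (palm a w) * G (palm t w)))%E.
  transitivity (\int[P]_w \esum_(x in (XS X (S t) w : set (vertex R)))
     (g (localize a (centred t x (XS X (S t) w) (V w))) * G (centred t x (XS X (S t) w) (V w))))%E.
    by apply: eq_integral => w _; exact: (local_sum_sq t0 g0 _ (XS_shiftable hX t w) GE).
  have := @mecke_integral R d Omega P X U V hX hU hV t t0 (fun b : input_space (S t) => g (localize a b) * G b)%E mGg.
  move=> -> //; last by move=> b; rewrite mule_ge0.
  by congr (_ * _)%E; apply: eq_integral => w _; rewrite localize_palm.
apply: lee_wpmul2l; first by rewrite lee_fin ltW.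
have [H [mH H0 HE]] := measurable_far_sum a0 at2 mg g0.
have mR : measurable (ring_strip a t).
  by apply: measurable_strip; apply: measurableD; exact: measurable_torus.
have RU : ring_strip a t `<=` strip setT by move=> p [_ ?]; split.
pose outer := input_of X U V (outer_input RU mR).
have mouter : measurable_fun setT outer := measurable_input_of hX hU hV _.
have mpalm u : measurable_fun setT (palm u) := measurable_input_of hX hU hV _.
have mcnt : measurable_fun setT (fun w => cnt (XS X (S t) w) (S (a *+ 2))).
  apply: measurable_cnt => //; last exact: measurable_strip_torus.
    exact: (measurable_XS hX (measurable_strip_torus t)).
  by move=> w _; exact: (XS_shiftable hX t w).2.
have outerE w : H (outer w) = far_sum t g (restr (ring_strip a t) (XS X (S t) w)) (V w).
  have lf : locally_finite (restr (ring_strip a t) (X w)).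
    by apply: sub_locally_finite (X_locally_finite hX w); exact: subIsetl.
  rewrite /outer /input_of /= HE//; congr (far_sum t g _ _).
  by rewrite /XS /restr -setIA; congr (_ `&` _); apply/esym/setIidr => p [[]].
have bound w : (g (palm a w) * G (palm t w) <=
    K%:E * (K%:E * (1 + cnt (XS X (S t) w) (S (a *+ 2)))) + g (palm a w) * H (outer w))%E.
  have sZ := XS_shiftable hX t w.
  have GU : G (palm t w) = local_sum t g (ins (0, U w) (XS X (S t) w)) (V w).
    rewrite GE// /ins asboolT; last exact: sZ.2.
    by move=> r; rewrite setIUl finite_setU; split; [exact: finite_setIl|exact: sZ.2].
  have U01 : S a (0, U w) by split; [exact: torus0|rewrite /= in_itv/=; case: hU].
  apply: (le_trans (lee_wpmul2l (g0 _) _)).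
    by rewrite GU; exact: (local_sum_le a0 at2 g0 (V w) K0 gK sZ U01).
  rewrite -outerE ge0_muleDr ?leeD2r//.
    by apply: lee_wpmul2r => //; rewrite mule_ge0 ?lee_fin// adde_ge0// cnt_ge0.
  by rewrite mule_ge0 ?lee_fin// adde_ge0// cnt_ge0.
have mb1 : measurable_fun setT (fun w => K%:E * (K%:E * (1 + cnt (XS X (S t) w) (S (a *+ 2)))))%E.
  by do 2 apply: measurable_funeM; exact: emeasurable_funD.
have mb2 : measurable_fun setT (fun w => g (palm a w) * H (outer w))%E.
  by apply: emeasurable_funM; [exact: measurableT_comp mg (mpalm a)|exact: measurableT_comp mH mouter].
have b10 w : (0 <= K%:E * (K%:E * (1 + cnt (XS X (S t) w) (S (a *+ 2)))))%E.
  by rewrite !mule_ge0 ?lee_fin// adde_ge0// cnt_ge0.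
have b20 w : (0 <= g (palm a w) * H (outer w))%E by rewrite mule_ge0.
apply: (@le_trans _ _ (\int[P]_w (K%:E * (K%:E * (1 + cnt (XS X (S t) w) (S (a *+ 2)))) +
    g (palm a w) * H (outer w)))%E).
  apply: ge0_le_integral => //.
  - by move=> w _; rewrite mule_ge0.
  - by apply: emeasurable_funM; [exact: measurableT_comp mg (mpalm a)|exact: measurableT_comp mG (mpalm t)].
  - exact: emeasurable_funD.
rewrite ge0_integralD//; apply: leeD.
  rewrite ge0_integralZl//; last 2 first.
  - by apply: measurable_funeM; exact: emeasurable_funD.
  - by move=> w _; rewrite mule_ge0 ?lee_fin// adde_ge0// cnt_ge0.
  rewrite ge0_integralZl//; last 2 first.
  - exact: emeasurable_funD.
  - by move=> w _; rewrite adde_ge0// cnt_ge0.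
  have -> : (\int[P]_w (1 + cnt (XS X (S t) w) (S (a *+ 2))) = (1 + a *+ 2)%:E)%E.
    rewrite ge0_integralD//; last by move=> w _; exact: cnt_ge0.
    rewrite cnt_mean integral_cst// mul1e; transitivity (1 + (a *+ 2)%:E)%E => [|//]; congr (_ + _)%E; exact: probability_setT.
  by rewrite -!EFinM mulrA.
have nt : (torus t `\` torus a) !=set0.
  exists (t / 2); split; rewrite /torus /= in_itv/=.
    by rewrite lexx andbT; move: t0; lra.
  by move=> /andP[_]; move: (a0) at2; rewrite (mulr2n a); lra.
have sub : S a `|` ring_strip a t `<=` S t.
  move=> p [|[[] //]]; apply: stripS; apply: torusS; move: (a0) at2; rewrite (mulr2n a); lra.
have aS : (area (S a `|` ring_strip a t) < +oo)%E.
  apply: (@le_lt_trans _ _ (area (S t))); last by rewrite (area_torus t0) ltry.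
  by apply: le_measure; rewrite ?inE//; [apply: measurableU => //|]; exact: measurable_strip_torus.
have -> : (\int[P]_w (g (palm a w) * H (outer w)) = m * \int[P]_w H (outer w))%E.
  apply: (@integral_independent R d Omega P X U V hX hU hV _ _ (t / 2)) => //.
  - by move=> p Sp; apply: strip_torus_bounded; apply: sub; left.
  - by move=> p Sp; apply: strip_torus_bounded; apply: sub; right.
  - by apply/seteqP; split => // x [ax [_]].
  - by exists 0; exact: torus0.
apply: lee_wpmul2l; first exact: integral_ge0.
rewrite -local_sum_mean; apply: ge0_le_integral => //.
- exact: measurableT_comp mH mouter.
- have [L [mL L0 LE]] := measurable_local_sum a0 at2 mg g0.
  have StU := @strip_torus_sub R t.
  apply: (@eq_measurable_fun _ _ _ _ _ (fun w => L (input_of X U V (outer_input StU (measurable_strip_torus t)) w))).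
    by move=> w _; rewrite /input_of /= LE//; exact: (XS_shiftable hX t w).2.
  exact: measurableT_comp mL (measurable_input_of hX hU hV _).
move=> w _; rewrite outerE.
have sZ := XS_shiftable hX t w.
rewrite (@far_sum_ring _ _ _ a0 at2 g _ (XS X (S t) w))//.
- by rewrite /local_sum (esumID (far a t))//= leeDl// esum_ge0.
- by apply: finite_shiftable; [apply: finite_setIl; exact: shiftable_finite sZ|move=> p [/sZ.1]].
- by rewrite /restr -setIA setIid.
Qed.
End second_moment.

(** * Convergence in L1 from convergence in probability *)

Section clip.
Variable R : realType.
Implicit Types K L u v : R.

(** The part of u between the levels K and L. *)
Definition clip K L u : R := Num.min u L - Num.min u K.

Lemma clip_ge0 K L u : K <= L -> 0 <= clip K L u.
Proof. by rewrite /clip => KL; rewrite subr_ge0 le_min !ge_min lexx/=; case: (leP u L) => //= uL; rewrite KL orbT. Qed.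

Lemma clip_le K L u : K <= L -> clip K L u <= L - K.
Proof.
rewrite /clip => KL; have [uL|uL] := leP u L; have [uK|uK] := leP u K; lra.
Qed.

Lemma clip_lip K L u v : K <= L -> `|clip K L u - clip K L v| <= `|u - v|.
Proof.
rewrite /clip => KL; rewrite ler_norml.
have := ler_norm (u - v); have := ler_norm (v - u); rewrite distrC => h1 h2.
by apply/andP; split; have [uL|uL] := leP u L; have [uK|uK] := leP u K;
  have [vL|vL] := leP v L; have [vK|vK] := leP v K; lra.
Qed.

Lemma clip0 L u : 0 <= u -> clip 0 L u = Num.min u L.
Proof. by move=> u0; rewrite /clip (min_r u0) subr0. Qed.

Lemma measurable_clip K L : measurable_fun setT (clip K L).
Proof. by apply: measurable_funB; apply: measurable_minr. Qed.

End clip.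

Section convergence.
Context (R : realType) (d : measure_display) (Omega : measurableType d)
  (P : probability Omega R).

(** The integrand is at most e where y and z are e-close, and at most L elsewhere. *)
Lemma integral_lip_le (y z : Omega -> R) (f : R -> R) (L e : R) :
  measurable_fun setT y -> measurable_fun setT z -> measurable_fun setT f ->
  (forall u, 0 <= f u <= L) -> (forall u v, `|f u - f v| <= `|u - v|) -> 0 <= e ->
  (\int[P]_w `|f (y w) - f (z w)|%:E <= e%:E + L%:E * P [set w | (e < `|y w - z w|)%R])%E.
Proof.
move=> my mz mf fL flip e0.
pose A := [set w | e < `|y w - z w|].
have md : measurable_fun setT (fun w => `|y w - z w|).
  by apply: measurableT_comp => //; exact: measurable_funB.
have mA : measurable A.
  have := measurable_preimage md (measurable_itv `]e, +oo[); congr measurable.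
  by apply/seteqP; split => w /=; rewrite /preimage/= in_itv/= andbT.
have L0 : 0 <= L by have /andP[] := fL 0; exact: le_trans.
apply: (@le_trans _ _ (\int[P]_w (e%:E + (L * \1_A w)%:E))%E).
  apply: ge0_le_integral => //.
  - apply/measurable_EFinP; apply: measurableT_comp => //.
    by apply: measurable_funB; exact: measurableT_comp.
  - apply: emeasurable_funD => //; apply/measurable_EFinP.
    by apply: measurable_funM => //; exact: measurable_indic.
  move=> w _; rewrite -EFinD lee_fin indicE.
  have [wA|wA] := boolP (w \in A).
    have /andP[a1 a2] := fL (y w); have /andP[b1 b2] := fL (z w).
    by rewrite mulr1 ler_norml; apply/andP; split; lra.
  rewrite mulr0 addr0; apply: (le_trans (flip _ _)); rewrite leNgt; apply/negP => h.
  by move/negP: wA; apply; rewrite inE.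
rewrite ge0_integralD//.
- rewrite integral_cst//; apply: leeD.
    rewrite -[leRHS]mule1; apply: lee_wpmul2l; rewrite ?lee_fin//; exact: probability_le1.
  under eq_integral do rewrite EFinM.
  rewrite ge0_integralZl//.
  + by rewrite integral_indic// setIT.
  + by apply/measurable_EFinP; exact: measurable_indic.
- by move=> w _; rewrite lee_fin mulr_ge0.
- apply/measurable_EFinP; apply: measurable_funM => //; exact: measurable_indic.
Qed.

Lemma powR_tail (K p u : R) : 0 < K -> 1 < p -> 0 <= u ->
  u - Num.min u K <= u `^ p / K `^ (p - 1).
Proof.
move=> K0 p1 u0; have [uK|uK] := leP u K.
  by rewrite subrr divr_ge0 ?powR_ge0.
have up : 0 < u by exact: lt_trans uK.
rewrite (@le_trans _ _ u)//; first by lra.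
rewrite ler_pdivlMr ?powR_gt0//.
have -> : u `^ p = u * u `^ (p - 1).
  by rewrite -{2}(powRr1 u0) -powRD ?(gt_eqF up) ?implybT// addrC subrK.
by rewrite ler_pM2l// ge0_ler_powR// ?nnegrE ?ltW//; lra.
Qed.

Section L1.
Variables (y : R -> Omega -> R) (z : Omega -> R) (p M : R).
Hypotheses (my : forall t, 0 < t -> measurable_fun setT (y t)) (mz : measurable_fun setT z)
  (y0 : forall t w, 0 < t -> 0 <= y t w) (z0 : forall w, 0 <= z w)
  (cv : cvg_in_probability P y z) (p1 : 1 < p) (M0 : 0 <= M)
  (hM : forall t, 0 < t -> (\int[P]_w (y t w `^ p)%:E <= M%:E)%E).

Lemma cvg_prob_le (e L : R) : 0 < e -> 0 <= L ->
  exists2 T : R, 0 < T & forall t, T <= t ->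
    (L%:E * P [set w | (e < `|y t w - z w|)%R] <= e%:E)%E.
Proof.
move=> e0 L0; have Lp : 0 < L + 1 by lra.
have := cv e0 => /fine_cvgP[fin] /cvgrPdist_le /(_ (e / (L + 1)) (divr_gt0 e0 Lp)) h.
have [T [_ hT]] := filterI fin h.
exists (Num.max 1 (T + 1)); first by rewrite lt_max ltr01.
move=> t; rewrite ge_max => /andP[t1 tT].
have [f1 /= f2] := hT t ltac:(lra).
move: f2; rewrite sub0r normrN; set q := P _; rewrite -(@fineK _ q)// => f2.
rewrite -EFinM lee_fin; have q0 : 0 <= fine q by apply: fine_ge0; exact: measure_ge0.
rewrite /= ger0_norm// ler_pdivlMr// in f2; apply: le_trans f2.
by rewrite mulrC; apply: ler_wpM2l => //; lra.
Qed.

Lemma tail_le (e : R) : 0 < e -> exists2 K, 0 < K & forall t, 0 < t ->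
  (\int[P]_w (y t w - Num.min (y t w) K)%:E <= e%:E)%E.
Proof.
(* By Markov's inequality the tail above K has mean at most M / K^(p - 1). *)
move=> e0; pose c := M / e + 1; have c0 : 0 < c by rewrite ltr_wpDl// divr_ge0// ltW.
pose K := c `^ ((p - 1)^-1); have K0 : 0 < K by rewrite powR_gt0.
have p10 : p - 1 != 0 by rewrite subr_eq0 gt_eqF.
have Kc : K `^ (p - 1) = c by rewrite /K -powRrM mulVf// powRr1 ?ltW.
exists K => // t t0.
apply: (@le_trans _ _ (\int[P]_w ((c^-1)%:E * (y t w `^ p)%:E))%E).
  apply: ge0_le_integral => //.
  - by move=> w _; rewrite lee_fin subr_ge0 ge_min lexx.
  - apply/measurable_EFinP; apply: measurable_funB; first exact: my.
    by apply: measurable_minr => //; exact: my.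
  - apply: measurable_funeM; apply/measurable_EFinP.
    exact: measurableT_comp (measurable_powR p) (my t0).
  - move=> w _; rewrite -EFinM lee_fin mulrC -Kc; by apply: powR_tail => //; exact: y0.
rewrite ge0_integralZl//; last 3 first.
- by apply/measurable_EFinP; exact: measurableT_comp (measurable_powR p) (my t0).
- by move=> w _; rewrite lee_fin powR_ge0.
- by rewrite lee_fin invr_ge0 ltW.
apply: (le_trans (lee_wpmul2l _ (hM t0))); first by rewrite lee_fin invr_ge0 ltW.
rewrite -EFinM lee_fin ler_pdivrMl// /c mulrDl mul1r divfK ?gt_eqF//.
by rewrite lerDl ltW.
Qed.

(** The bound passes to the limit for the part between two fixed levels, which is a
bounded Lipschitz function; then the upper level tends to infinity. *)
Lemma tail_lim_le (K e : R) : 0 < K -> 0 < e ->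
  (forall t, 0 < t -> (\int[P]_w (y t w - Num.min (y t w) K)%:E <= e%:E)%E) ->
  (\int[P]_w (z w - Num.min (z w) K)%:E <= e%:E)%E.
Proof.
move=> K0 e0 tail.
have step (n : nat) : (\int[P]_w (clip K (K + n%:R) (z w))%:E <= e%:E)%E.
  have KL : K <= K + n%:R by rewrite lerDl.
  have mc (u : Omega -> R) : measurable_fun setT u -> measurable_fun setT (fun w => clip K (K + n%:R) (u w)).
    by move=> mu; exact: measurableT_comp (measurable_clip _ _) mu.
  apply/lee_addgt0Pr => r r0.
  have r2 : 0 < r / 2 by lra.
  have [T T0 hT] := cvg_prob_le r2 (ler0n R n).
  apply: (@le_trans _ _ (\int[P]_w ((clip K (K + n%:R) (y T w))%:E +
     (`|clip K (K + n%:R) (y T w) - clip K (K + n%:R) (z w)|)%:E))%E).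
    apply: ge0_le_integral => //.
    - by move=> w _; rewrite lee_fin clip_ge0.
    - by apply/measurable_EFinP; exact: mc.
    - apply: emeasurable_funD; apply/measurable_EFinP; first exact/mc/my.
      by apply: measurableT_comp => //; apply: measurable_funB; apply: mc => //; exact: my.
    - move=> w _; rewrite -EFinD lee_fin; rewrite distrC.
      set a := clip _ _ _; set b := clip _ _ _; have := ler_norm (a - b); lra.
  rewrite ge0_integralD//; last 3 first.
  - by move=> w _; rewrite lee_fin clip_ge0.
  - by apply/measurable_EFinP; exact/mc/my.
  - apply/measurable_EFinP; apply: measurableT_comp => //.
    by apply: measurable_funB; apply: mc => //; exact: my.
  apply: leeD.
    apply: le_trans (tail T T0); apply: ge0_le_integral => //.
    - by move=> w _; rewrite lee_fin clip_ge0.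
    - by apply/measurable_EFinP; exact/mc/my.
    - apply/measurable_EFinP; apply: measurable_funB; first exact: my.
      by apply: measurable_minr => //; exact: my.
    - by move=> w _; rewrite lee_fin /clip lerB// ge_min lexx.
  apply: (le_trans (@integral_lip_le _ _ (clip K (K + n%:R)) n%:R (r / 2) _ mz _ _ _ _)).
  - exact: my.
  - exact: measurable_clip.
  - by move=> u; rewrite clip_ge0//=; have := clip_le u KL; lra.
  - by move=> u v; exact: clip_lip.
  - exact: ltW.
  apply: (le_trans (leeD2l _ (hT T (lexx _)))).
  by rewrite -EFinD lee_fin; lra.
have cvz w : (clip K (K + n%:R) (z w))%:E @[n --> \oo] --> (z w - Num.min (z w) K)%:E.
  have [N _ hN] := nbhs_infty_ger (z w).
  apply: cvg_near_cst; exists N => // n Nn; have zn := hN n Nn.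
  by rewrite /clip (min_l (y := K + n%:R))//; rewrite (le_trans zn)// lerDr ltW.
under eq_integral => w _ do rewrite -(cvg_lim _ (cvz w))//.
rewrite monotone_convergence//.
- apply: lime_le; last by apply: nearW => n; exact: step.
  apply: ereal_nondecreasing_is_cvgn => a b ab; apply: ge0_le_integral => //.
  + by move=> w _; rewrite lee_fin clip_ge0// lerDl.
  + by apply/measurable_EFinP; exact: measurableT_comp (measurable_clip _ _) mz.
  + by apply/measurable_EFinP; exact: measurableT_comp (measurable_clip _ _) mz.
  + move=> w _; rewrite lee_fin /clip lerB// le_min ge_min lexx/= ge_min.
    by rewrite lerD2l ler_nat ab orbT.
- by move=> n; apply/measurable_EFinP; exact: measurableT_comp (measurable_clip _ _) mz.
- by move=> n w _; rewrite lee_fin clip_ge0// lerDl.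
- move=> w _ a b ab; rewrite lee_fin /clip lerB// le_min ge_min lexx/= ge_min.
  by rewrite lerD2l ler_nat ab orbT.
Qed.

(** Above the level K both variables have a small mean by uniform integrability;
below it, convergence in probability is enough. *)
Lemma cvg_L1 (e : R) : 0 < e -> exists2 T : R, 0 < T & forall t, T <= t ->
  (\int[P]_w `|y t w - z w|%:E <= e%:E)%E.
Proof.
move=> e0; have e4 : 0 < e / 4 by lra.
have [K K0 tail] := tail_le e4.
have ztail := tail_lim_le K0 e4 tail.
have [T T0 hT] := cvg_prob_le e4 (ltW K0).
exists T => // t tT; have t0 : 0 < t by exact: lt_le_trans tT.
pose f u := clip 0 K u.
have mf : measurable_fun setT f by exact: measurable_clip.
have mfy := measurableT_comp mf (my t0); have mfz := measurableT_comp mf mz.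
have i1 := @integral_lip_le _ _ f K (e / 4) (my t0) mz mf.
have {}i1 : (\int[P]_w `|f (y t w) - f (z w)|%:E <= (e / 4)%:E + (e / 4)%:E)%E.
  apply: (le_trans (i1 _ _ (ltW e4))) => [u|u v|].
  - by rewrite /f (clip_ge0 u (ltW K0))/=; have := clip_le u (ltW K0); rewrite subr0.
  - exact: clip_lip (ltW K0).
  - by apply: leeD2l; exact: hT.
have mt (u : Omega -> R) : measurable_fun setT u ->
    measurable_fun setT (fun w => (u w - Num.min (u w) K)%:E).
  move=> mu; apply/measurable_EFinP; apply: measurable_funB => //.
  exact: measurable_minr.
have mn : measurable_fun setT (fun w => `|f (y t w) - f (z w)|%:E).
  apply/measurable_EFinP; apply: measurableT_comp => //; exact: measurable_funB.
have tl0 (u : R) : (0 <= (u - Num.min u K)%:E)%E by rewrite lee_fin subr_ge0 ge_min lexx.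
apply: (@le_trans _ _ (\int[P]_w ((y t w - Num.min (y t w) K)%:E + (z w - Num.min (z w) K)%:E +
    `|f (y t w) - f (z w)|%:E))%E).
  apply: ge0_le_integral => //.
  - apply/measurable_EFinP; apply: measurableT_comp => //.
    by apply: measurable_funB => //; exact: my.
  - by apply: emeasurable_funD => //; apply: emeasurable_funD; apply: mt => //; exact: my.
  move=> w _; rewrite -!EFinD lee_fin /f !clip0 ?y0//.
  have /= := tl0 (y t w); have /= := tl0 (z w); rewrite !lee_fin.
  set a := Num.min _ _; set b := Num.min _ _ => h1 h2.
  have := ler_norm (b - a); have := ler_norm (a - b); rewrite distrC => h3 h4.
  by rewrite ler_norml; apply/andP; split; lra.
rewrite ge0_integralD//; last 2 first.
- by move=> w _; rewrite adde_ge0.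
- by apply: emeasurable_funD; apply: mt => //; exact: my.
rewrite ge0_integralD//; last 2 first.
- exact/mt/my.
- exact: mt.
apply: (le_trans (leeD (leeD (tail t t0) ztail) i1)).
by rewrite -!EFinD lee_fin; lra.
Qed.

(** The limit is at most K plus a tail of mean at most 1. *)
Lemma limit_integrable : (\int[P]_w (z w)%:E < +oo)%E.
Proof.
have [K K0 tail] := tail_le (ltr01 : (0 : R) < 1).
have ztail := tail_lim_le K0 ltr01 tail.
have m1 : measurable_fun setT (fun w => (z w - Num.min (z w) K)%:E).
  by apply/measurable_EFinP; apply: measurable_funB => //; exact: measurable_minr.
apply: (@le_lt_trans _ _ (\int[P]_w ((z w - Num.min (z w) K)%:E + K%:E))%E).
  apply: ge0_le_integral => //.
  - by move=> w _; rewrite lee_fin.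
  - exact/measurable_EFinP.
  - exact: emeasurable_funD.
  - by move=> w _; rewrite -EFinD lee_fin -addrA lerDl addrC subr_ge0 ge_min lexx orbT.
rewrite ge0_integralD//.
- apply: (le_lt_trans (leeD2r _ ztail)).
  by rewrite integral_cst// lte_add_pinfty ?ltry// lte_mul_pinfty ?lee_fin ?ltW// ?ltry//; exact: probability_lty.
- by move=> w _; rewrite lee_fin subr_ge0 ge_min lexx.
- by move=> w _; rewrite lee_fin ltW.
Qed.

End L1.
End convergence.

(** * The law of large numbers for local sums *)

Section local_law.
Context (R : realType) (d : measure_display) (Omega : measurableType d)
  (P : probability Omega R) (X : Omega -> config R) (U : Omega -> R)
  (V : Omega -> edge_family R).
Hypotheses (hX : poisson_process P X) (hU : uniform_mark P X U)
  (hV : iid_uniform_edges P X U V).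
Variables (a t K : R).
Hypotheses (a0 : 0 < a) (at2 : a *+ 2 <= t) (K0 : 0 <= K).
Local Notation S u := (strip (torus u)).
Local Notation palm u := (input_of X U V (palm_input (@strip_torus_sub R u) (measurable_strip_torus u))).
Variable g : input_space (S a) -> \bar R.
Hypotheses (mg : measurable_fun setT g) (g0 : forall b, (0 <= g b)%E)
  (gK : forall b, (g b <= K%:E)%E).
Let t0 : 0 < t.
Proof. by apply: lt_le_trans at2; rewrite (mulr2n a) addr_gt0. Qed.
Let m := (\int[P]_w g (palm a w))%E.

Lemma bounded_fin_num b : g b \is a fin_num.
Proof. by rewrite ge0_fin_numE// (le_lt_trans (gK b))// ltry. Qed.

Lemma local_mean_fin : m \is a fin_num.
Proof.
rewrite ge0_fin_numE; last exact: integral_ge0.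
apply: (@le_lt_trans _ _ (\int[P]_w K%:E)%E).
  apply: ge0_le_integral => //.
  exact: measurableT_comp mg (measurable_input_of hX hU hV _).
by rewrite integral_cst// lte_mul_pinfty ?lee_fin//; exact: probability_lty.
Qed.

Definition local_mean_of (w : Omega) : R :=
  t^-1 * \sum_(x \in XS X (S t) w) fine (g (localize a (centred t x (XS X (S t) w) (V w)))).

Lemma local_mean_ofE w :
  (local_mean_of w)%:E = (t^-1%:E * local_sum t g (XS X (S t) w) (V w))%E.
Proof.
have fZ := shiftable_finite (XS_shiftable hX t w).
rewrite /local_mean_of EFinM /local_sum esum_fset// -fsumEFin//.
by congr (_ * _)%E; apply: eq_fsbigr => x _; rewrite fineK// bounded_fin_num.
Qed.

Lemma measurable_local_mean_of : measurable_fun setT local_mean_of.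
Proof.
apply/measurable_EFinP.
have [L [mL L0 LE]] := measurable_local_sum a0 at2 mg g0.
pose f := outer_input (@strip_torus_sub R t) (measurable_strip_torus t).
apply: (@eq_measurable_fun _ _ _ _ _ (fun w => t^-1%:E * L (input_of X U V f w))%E).
  move=> w _; rewrite /= local_mean_ofE /input_of /= LE//.
  exact: (XS_shiftable hX t w).2.
apply: measurable_funeM; exact: measurableT_comp mL (measurable_input_of hX hU hV _).
Qed.

(** From |v| <= e + v^2 / e with v the deviation from the mean, and the second
moment bound. The square is expanded and its cross term moved to the
left-hand side, so that only nonnegative functions are integrated. *)
Lemma local_law (e : R) : 0 < e ->
  (\int[P]_w `|local_mean_of w - fine m|%:E <=
   (e + K * K * (1 + a *+ 2) / (t * e))%:E)%E.
Proof.
move=> e0; pose mu := fine m; pose C := K * K * (1 + a *+ 2).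
have mE : m = mu%:E by rewrite fineK// local_mean_fin.
have mG := measurable_local_mean_of.
have G0 w : 0 <= local_mean_of w.
  rewrite -lee_fin local_mean_ofE; apply: mule_ge0; last exact: esum_ge0.
  by rewrite lee_fin invr_ge0 ltW.
have mu0 : 0 <= mu by apply: fine_ge0; exact: integral_ge0.
have EG : (\int[P]_w (local_mean_of w)%:E = mu%:E)%E.
  under eq_integral do rewrite local_mean_ofE.
  have mls : measurable_fun setT (fun w => local_sum t g (XS X (S t) w) (V w)).
    apply: (@eq_measurable_fun _ _ _ _ _ (fun w => t%:E * (local_mean_of w)%:E)%E).
      by move=> w _; rewrite local_mean_ofE muleA -EFinM divff ?mul1e// gt_eqF.
    by apply: measurable_funeM; exact/measurable_EFinP.
  rewrite ge0_integralZl//; last 2 first.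
  - by move=> w _; apply: esum_ge0.
  - by rewrite lee_fin invr_ge0 ltW.
  rewrite (local_sum_mean hX hU hV a0 at2 mg g0) muleA -EFinM mulVf ?gt_eqF// mul1e.
  exact: mE.
have EG2 : (\int[P]_w (local_mean_of w * local_mean_of w)%:E <= (C / t + mu * mu)%:E)%E.
  have -> : (\int[P]_w (local_mean_of w * local_mean_of w)%:E =
     (t^-1 * t^-1)%:E * \int[P]_w (local_sum t g (XS X (S t) w) (V w) * local_sum t g (XS X (S t) w) (V w)))%E.
    rewrite -ge0_integralZl//.
    - by apply: eq_integral => w _; rewrite EFinM !local_mean_ofE EFinM muleACA.
    - apply: (@eq_measurable_fun _ _ _ _ _ (fun w => (t * t)%:E * (local_mean_of w * local_mean_of w)%:E)%E).
        move=> w _; rewrite (EFinM (local_mean_of w)) local_mean_ofE [X in (_ * X)%E]muleACA !muleA -!EFinM.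
        have -> : t * t * t^-1 * t^-1 = 1 by field; rewrite gt_eqF.
        by rewrite mul1e.
      by apply: measurable_funeM; apply/measurable_EFinP; exact: measurable_funM.
    - by move=> w _; rewrite mule_ge0//; apply: esum_ge0.
    - by rewrite lee_fin mulr_ge0// invr_ge0 ltW.
  have := second_moment hX hU hV a0 at2 K0 mg g0 gK; rewrite -/m mE => h.
  apply: (le_trans (lee_wpmul2l _ h)); first by rewrite lee_fin mulr_ge0// invr_ge0 ltW.
  rewrite -(EFinM t mu) -(EFinM mu) -EFinD -!EFinM lee_fin.
  have tn : t != 0 by rewrite gt_eqF.
  by rewrite le_eqVlt; apply/orP; left; apply/eqP; rewrite /C; field.
set I := (\int[P]_w _)%E.
have mI : measurable_fun setT (fun w => `|local_mean_of w - mu|%:E).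
  by apply/measurable_EFinP; apply: measurableT_comp => //; exact: measurable_funB.
have key : (I + (2 * mu * mu / e)%:E <= (e + (C / t + mu * mu + mu * mu) / e)%:E)%E.
  have -> : (I + (2 * mu * mu / e)%:E = \int[P]_w (`|local_mean_of w - mu|%:E + (2 * mu / e)%:E * (local_mean_of w)%:E))%E.
    rewrite ge0_integralD//; last 2 first.
    - by move=> w _; rewrite mule_ge0// lee_fin// !mulr_ge0// invr_ge0 ltW.
    - by apply: measurable_funeM; exact/measurable_EFinP.
    congr (_ + _)%E; rewrite ge0_integralZl//.
    - by rewrite EG -EFinM; congr (_%:E); field; rewrite gt_eqF.
    - exact/measurable_EFinP.
    - by move=> w _; rewrite lee_fin.
    - by rewrite lee_fin !mulr_ge0// invr_ge0 ltW.
  apply: (@le_trans _ _ (\int[P]_w ((e + mu * mu / e)%:E + e^-1%:E * (local_mean_of w * local_mean_of w)%:E))%E).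
    apply: ge0_le_integral => //.
    - by move=> w _; rewrite adde_ge0// mule_ge0// lee_fin// !mulr_ge0// invr_ge0 ltW.
    - by apply: emeasurable_funD => //; apply: measurable_funeM; exact/measurable_EFinP.
    - apply: emeasurable_funD => //; apply: measurable_funeM; apply/measurable_EFinP; exact: measurable_funM.
    move=> w _; rewrite -!EFinM -!EFinD lee_fin.
    set u := local_mean_of w.
    (* The square of |u - mu| - e is nonnegative. *)
    have h : `|u - mu| * e <= e * e + (u - mu) * (u - mu).
      rewrite -[(u - mu) * (u - mu)]ger0_norm ?sqr_ge0 -?expr2 ?sqr_ge0// normrX.
      have : 0 <= (`|u - mu| - e) ^+ 2 by exact: sqr_ge0.
      have := normr_ge0 (u - mu); rewrite sqrrB; move: `|u - mu| => v v0.
      by have : 0 <= v * e by [rewrite mulr_ge0// ltW]; rewrite !expr2 mulr2n; lra.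
    move: h; set A := `|u - mu| => h; rewrite -subr_ge0.
    have -> : e + mu * mu / e + e^-1 * (u * u) - (A + 2 * mu / e * u) =
      (e * e + (u - mu) * (u - mu) - A * e) / e by field; rewrite gt_eqF.
    by rewrite divr_ge0 ?(ltW e0)// subr_ge0.
  have mG2 : measurable_fun setT (fun w => (local_mean_of w * local_mean_of w)%:E).
    by apply/measurable_EFinP; exact: measurable_funM.
  have e1 : 0 <= e^-1 by rewrite invr_ge0 ltW.
  rewrite ge0_integralD//; last 3 first.
  - by move=> w _; rewrite lee_fin; apply: addr_ge0; [exact: ltW|rewrite !mulr_ge0].
  - by move=> w _; rewrite mule_ge0// lee_fin mulr_ge0.
  - exact: measurable_funeM.
  rewrite ge0_integralZl//; last by move=> w _; rewrite lee_fin mulr_ge0.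
  have c1 : (\int[P]_w (e + mu * mu / e)%:E = (e + mu * mu / e)%:E)%E.
    rewrite integral_cst//; apply: etrans (mule1 _); congr (_ * _)%E; exact: probability_setT.
  rewrite c1; apply: (le_trans (leeD2l _ (lee_wpmul2l _ EG2))); first by rewrite lee_fin.
  rewrite -EFinM -EFinD lee_fin.
  by rewrite le_eqVlt; apply/orP; left; apply/eqP; field; rewrite !gt_eqF.
move: key; rewrite -leeBrDr// => /le_trans; apply; rewrite -EFinB lee_fin.
by rewrite le_eqVlt; apply/orP; left; apply/eqP; rewrite /C; field; rewrite !gt_eqF.
Qed.

End local_law.

(** * Comparing the scores with a local function *)

Section compare.
Context (R : realType) (d : measure_display) (Omega : measurableType d)
  (P : probability Omega R) (X : Omega -> config R) (U : Omega -> R)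
  (V : Omega -> edge_family R).
Hypotheses (hX : poisson_process P X) (hU : uniform_mark P X U)
  (hV : iid_uniform_edges P X U V).
Local Notation S u := (strip (torus u)).
Local Notation palm u := (input_of X U V (palm_input (@strip_torus_sub R u) (measurable_strip_torus u))).

(** Only the selected points enter, and each of them gives a random input. *)
Lemma measurable_centred_sum (t : R) (F : input_space (S t) -> \bar R) : 0 < t ->
  measurable_fun setT F -> (forall b, 0 <= F b)%E ->
  measurable_fun setT (fun w => \esum_(x in (XS X (S t) w : set (vertex R)))
    F (centred t x (XS X (S t) w) (V w)))%E.
Proof.
move=> t0 mF F0.
apply: (@eq_measurable_fun _ _ _ _ _ (fun w => \sum_(n <oo)
  if `[< selects n (XS X (S t) w) >] then F (input_of X U V (centre_input t0 n) w) else 0)%E).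
  by move=> w _; rewrite sum_sel//; exact: (XS_shiftable hX t w).2.
apply: (ge0_emeasurable_sum (P := predT)) => [n w _ _|n _]; first by case: ifP.
apply: measurable_fun_ifT => //; last exact: measurableT_comp mF (measurable_input_of hX hU hV _).
apply: measurable_fun_asbool => //; rewrite setTI.
exact: measurable_preimage (measurable_XS hX (measurable_strip_torus t)) (measurable_selects n).
Qed.

Section score.
Variables (t : R) (xi : point_functional R) (F : input_space (S t) -> \bar R).
Hypotheses (t0 : 0 < t) (hxi : proper_functional (torus t) (wrap_torus t) xi)
  (mF : measurable_fun setT F) (F0 : forall b, (0 <= F b)%E)
  (FE : forall x Z W, admissible (S t) x Z W -> F ((x, Z), W) = (xi x Z W)%:E).

Definition score_mean (w : Omega) : R := t^-1 * \sum_(x \in restrict_points t X w)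
  xi x (restrict_points t X w) (restrict_family t V w).

Lemma score_meanE w : (score_mean w)%:E = (t^-1%:E *
  \esum_(x in (XS X (S t) w : set (vertex R))) F (centred t x (XS X (S t) w) (V w)))%E.
Proof.
have fZ := shiftable_finite (XS_shiftable hX t w).
rewrite /score_mean EFinM esum_fset// -fsumEFin//; congr (_ * _)%E.
by apply: eq_fsbigr => x; rewrite inE => Zx; exact: (centred_functional hX hV t0 hxi mF FE Zx).
Qed.

Lemma measurable_score_mean : measurable_fun setT score_mean.
Proof.
apply/measurable_EFinP; apply: (eq_measurable_fun _ (fun w _ => esym (score_meanE w))).
by apply: measurable_funeM; exact: measurable_centred_sum.
Qed.

Variables (a K : R) (g : input_space (S a) -> \bar R).
Hypotheses (a0 : 0 < a) (at2 : a *+ 2 <= t)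
  (mg : measurable_fun setT g) (g0 : forall b, (0 <= g b)%E)
  (gK : forall b, (g b <= K%:E)%E).

(** The difference is at most the average over the points of the absolute
difference of the two functions of the centred input, and the Mecke formula
computes the mean of that average. *)
Lemma score_mean_local : (\int[P]_w `|score_mean w - local_mean_of X V t g w|%:E <=
  \int[P]_w `|with_point xi (0%R, U w) (restrict_points t X w) (restrict_family t V w) -
     fine (g (palm a w))|%:E)%E.
Proof.
have gf := bounded_fin_num g0 gK.
pose H (b : input_space (S t)) := `|F b - g (localize a b)|%E.
have mH : measurable_fun setT H.
  apply: measurableT_comp => //; apply: emeasurable_funB => //.
  exact: measurableT_comp mg (measurable_localize a0 at2).
have H0 b : (0 <= H b)%E by exact: abse_ge0.
have mcs := measurable_centred_sum t0 mH H0.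
apply: (@le_trans _ _ (\int[P]_w (t^-1%:E * \esum_(x in (XS X (S t) w : set (vertex R)))
    H (centred t x (XS X (S t) w) (V w))))%E).
  apply: ge0_le_integral => //.
  - apply/measurable_EFinP; apply: measurableT_comp => //; apply: measurable_funB.
      exact: measurable_score_mean.
    exact: (measurable_local_mean_of hX hU hV a0 at2 mg g0 gK).
  - exact: measurable_funeM.
  move=> w _; have fZ := shiftable_finite (XS_shiftable hX t w).
  rewrite /score_mean /local_mean_of -mulrBr normrM ger0_norm ?invr_ge0 ?(ltW t0)// EFinM.
  apply: lee_wpmul2l; first by rewrite lee_fin invr_ge0 ltW.
  rewrite -/(XS X (S t) w) esum_fset//.
  have HE x : x \in (XS X (S t) w : set (vertex R)) -> H (centred t x (XS X (S t) w) (V w)) =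
      `|xi x (XS X (S t) w) (restrict_family t V w) -
        fine (g (localize a (centred t x (XS X (S t) w) (V w))))|%:E.
    rewrite inE => Zx; rewrite /H -(centred_functional hX hV t0 hxi mF FE Zx).
    by rewrite -[in LHS](fineK (gf _)).
  rewrite (eq_fsbigr _ _ HE) fsumEFin// lee_fin.
  rewrite !fsbig_finite//= -sumrB; exact: ler_norm_sum.
rewrite ge0_integralZl//; last 2 first.
- by move=> w _; apply: esum_ge0.
- by rewrite lee_fin invr_ge0 ltW.
rewrite (mecke_integral hX hU hV t0 mH H0) muleA -EFinM mulVf ?gt_eqF// mul1e.
rewrite le_eqVlt; apply/orP; left; apply/eqP; apply: eq_integral => w _.
rewrite /H -(palm_functional hX hU hV t0 mF FE) (localize_palm V hX hU a0 at2).
by rewrite -[in LHS](fineK (gf _)).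
Qed.

End score.
End compare.

(** * The limit theorem *)

Section main.
Context (R : realType) (d : measure_display) (Omega : measurableType d)
  (P : probability Omega R) (X : Omega -> config R) (U : Omega -> R)
  (V : Omega -> edge_family R).
Hypotheses (hX : poisson_process P X) (hU : uniform_mark P X U)
  (hV : iid_uniform_edges P X U V).
Local Notation S u := (strip (torus u)).
Local Notation palm u := (input_of X U V (palm_input (@strip_torus_sub R u) (measurable_strip_torus u))).

Lemma integral_mark (h : R -> \bar R) : measurable_fun setT h -> (forall s, 0 <= h s)%E ->
  (\int[P]_u h (U u) = \int[lebesgue_measure]_(s in `]0%R, 1%R]) h s)%E.
Proof.
move=> mh h0; have mI : measurable (`]0%R, 1%R] : set R) by exact: measurable_itv.
have mU : measurable_fun setT (U : Omega -> measurableTypeR R) := measurable_U hU.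
have mh' : measurable_fun setT (h : measurableTypeR R -> \bar R) := mh.
rewrite -(integral_mrestr (@lebesgue_measure R) mI mh' h0).
transitivity (\int[law P mU measurableT]_s h s)%E.
  by rewrite integral_law.
apply: eq_measure_integral => A mA _; have [_ _ hB _] := hU.
by apply: etrans (hB A mA); rewrite -[in RHS](setIT (U @^-1` A)).
Qed.

Section torus_functionals.
Variables (xi : R -> point_functional R)
  (hxi : forall t : R, 0 < t -> proper_functional (torus t) (wrap_torus t) (xi t)).
Let y t w := with_point (xi t) (0, U w) (restrict_points t X w) (restrict_family t V w).

Lemma torus_score_measurable t : 0 < t -> measurable_fun setT (y t) /\ forall w, 0 <= y t w.
Proof.
move=> t0; have [x0 inv mx] := hxi t0.
have [F [mF F0 FE]] := represent x0 mx.
have yE w := palm_functional hX hU hV t0 mF FE w.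
split; last by move=> w; rewrite -lee_fin yE.
apply/measurable_EFinP; apply: (eq_measurable_fun _ (fun w _ => esym (yE w))).
exact: measurableT_comp mF (measurable_input_of hX hU hV _).
Qed.

Variables (z : Omega -> R) (p M : R).
Hypotheses (mz : measurable_fun setT z) (z0 : forall w, 0 <= z w)
  (cv : cvg_in_probability P y z) (p1 : 1 < p) (M0 : 0 <= M)
  (hM : forall t, 0 < t -> (\int[P]_w (y t w `^ p)%:E <= M%:E)%E).

(** Three approximations: the scores on the torus of length t by the truncated
local score (small by [cvg_L1] at the times t and a, and by truncation), the
average of the latter by its mean, and this mean by the limit. *)
Lemma score_mean_L1 (e : R) : 0 < e -> exists2 T, 0 < T & forall t, T <= t ->
  (\int[P]_w `|score_mean X V t (xi t) w - fine (\int[P]_w (z w)%:E)|%:E <= e%:E)%E.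
Proof.
move=> e0.
(* The three approximations cost 3, 2 and 2 times e / 7. *)
have e7 : 0 < e / 7 by lra.
have my t (t0 : 0 < t) := (torus_score_measurable t0).1.
have y0 t w (t0 : 0 < t) := (torus_score_measurable t0).2 w.
have [T0 T00 hT0] := cvg_L1 my mz y0 z0 cv p1 M0 hM e7.
have [K K0 tail] := tail_le my y0 p1 M0 hM e7.
pose a := T0; have a0 : 0 < a by [].
have [x0 inv mx] := hxi a0.
have [F [mF F0 FE]] := represent x0 mx.
pose g b := mine (F b) K%:E.
have mg : measurable_fun setT g by exact: measurable_mine.
have g0 b : (0 <= g b)%E by rewrite le_min F0 lee_fin ltW.
have gK b : (g b <= K%:E)%E by rewrite ge_min lexx orbT.
have gE w : g (palm a w) = (Num.min (y a w) K)%:E.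
  by rewrite /g -(palm_functional hX hU hV a0 mF FE) EFin_min.
pose nu := fine (\int[P]_w g (palm a w)).
pose C := K * K * (1 + a *+ 2).
(* The second term makes the variance bound C / (t * (e / 7)) at most e / 7. *)
pose T := a *+ 2 + C / (e / 7) ^+ 2.
have C0 : 0 <= C by rewrite !mulr_ge0 ?(ltW K0)// addr_ge0// mulrn_wge0// ltW.
have T1 : a *+ 2 <= T by rewrite lerDl divr_ge0 ?sqr_ge0.
exists T; first by apply: lt_le_trans T1; rewrite (mulr2n a) addr_gt0.
move=> t tT; have at2 : a *+ 2 <= t by exact: le_trans tT.
have at_ : a <= t by apply: le_trans at2; rewrite (mulr2n a) lerDl ltW.
have t0 : 0 < t by exact: lt_le_trans at_.
have [xt0 invt mxt] := hxi t0.
have [Ft [mFt Ft0 FtE]] := represent xt0 mxt.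
have mS := measurable_score_mean hX hU hV t0 (hxi t0) mFt Ft0 FtE.
have mL := measurable_local_mean_of hX hU hV a0 at2 mg g0 gK.
have mnorm (u v : Omega -> R) : measurable_fun setT u -> measurable_fun setT v ->
    measurable_fun setT (fun w => `|u w - v w|%:E).
  move=> mu mv; apply/measurable_EFinP; apply: measurableT_comp => //; exact: measurable_funB.
have mya : measurable_fun setT (fun w => Num.min (y a w) K).
  by apply: measurable_minr => //; exact: my.
have tri (f1 f2 f3 : Omega -> R) c1 c2 : measurable_fun setT f1 -> measurable_fun setT f2 ->
    measurable_fun setT f3 -> (\int[P]_w `|f1 w - f2 w|%:E <= c1%:E)%E ->
    (\int[P]_w `|f2 w - f3 w|%:E <= c2%:E)%E -> (\int[P]_w `|f1 w - f3 w|%:E <= (c1 + c2)%:E)%E.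
  move=> m1 m2 m3 h1 h2.
  apply: (@le_trans _ _ (\int[P]_w (`|f1 w - f2 w|%:E + `|f2 w - f3 w|%:E))%E).
    apply: ge0_le_integral => //; first exact: mnorm.
      by apply: emeasurable_funD; exact: mnorm.
    by move=> w _; rewrite -EFinD lee_fin; exact: ler_distD.
  by rewrite ge0_integralD//; [rewrite EFinD; exact: leeD|exact: mnorm|exact: mnorm].
have sym (f1 f2 : Omega -> R) : (\int[P]_w `|f1 w - f2 w|%:E = \int[P]_w `|f2 w - f1 w|%:E)%E.
  by apply: eq_integral => w _; rewrite distrC.
have za : (\int[P]_w `|z w - Num.min (y a w) K|%:E <= (e / 7 + e / 7)%:E)%E.
  apply: (tri _ (y a)) => //; first exact: my.
    by rewrite sym; exact: hT0.
  rewrite (eq_integral (fun w => (y a w - Num.min (y a w) K)%:E)); first exact: tail.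
  by move=> w _; rewrite ger0_norm// subr_ge0 ge_min lexx.
have h1 : (\int[P]_w `|score_mean X V t (xi t) w - local_mean_of X V t g w|%:E <=
    (e / 7 + (e / 7 + e / 7))%:E)%E.
  apply: (le_trans (score_mean_local hX hU hV t0 (hxi t0) mFt Ft0 FtE a0 at2 mg g0 gK)).
  rewrite (eq_integral (fun w => `|y t w - Num.min (y a w) K|%:E)); last by move=> w _; rewrite gE.
  by apply: (tri _ z) => //; [exact: my|exact: hT0].
have h2 : (\int[P]_w `|local_mean_of X V t g w - nu|%:E <= (e / 7 + e / 7)%:E)%E.
  apply: (le_trans (local_law hX hU hV a0 at2 (ltW K0) mg g0 gK e7)).
  rewrite lee_fin lerD2l -/C ler_pdivrMr ?mulr_gt0//.
  have : C / (e / 7) ^+ 2 <= t by apply: le_trans tT; rewrite lerDr mulrn_wge0// ltW.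
  by rewrite ler_pdivrMr ?exprn_gt0// expr2; lra.
have zoo := limit_integrable my mz y0 z0 cv p1 M0 hM.
set mu := fine _.
have zE : (\int[P]_w (z w)%:E = mu%:E)%E.
  by rewrite fineK// ge0_fin_numE//; apply: integral_ge0 => w _; rewrite lee_fin.
have nuE : (\int[P]_w (Num.min (y a w) K)%:E = nu%:E)%E.
  rewrite /nu fineK; last exact: (local_mean_fin hX hU hV (ltW K0) mg g0 gK).
  by apply: eq_integral => w _; rewrite gE.
have h3 : `|nu - mu| <= e / 7 + e / 7.
  have w0 w : (0 <= (Num.min (y a w) K)%:E)%E by rewrite lee_fin le_min y0//= ltW.
  have w1 w : (0 <= (z w)%:E)%E by rewrite lee_fin.
  have mK : measurable_fun setT (fun w => (Num.min (y a w) K)%:E) by exact/measurable_EFinP.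
  have mzE : measurable_fun setT (fun w => (z w)%:E) by exact/measurable_EFinP.
  have b1 : (nu%:E <= mu%:E + (e / 7 + e / 7)%:E)%E.
    rewrite -nuE -zE; apply: le_trans (leeD2l _ za).
    rewrite -ge0_integralD//; last exact: mnorm.
    apply: ge0_le_integral => //; first by apply: emeasurable_funD => //; exact: mnorm.
    move=> w _; rewrite -EFinD lee_fin distrC.
    have := ler_norm (Num.min (y a w) K - z w); lra.
  have b2 : (mu%:E <= nu%:E + (e / 7 + e / 7)%:E)%E.
    rewrite -nuE -zE; apply: le_trans (leeD2l _ za).
    rewrite -ge0_integralD//; last exact: mnorm.
    apply: ge0_le_integral => //; first by apply: emeasurable_funD => //; exact: mnorm.
    move=> w _; rewrite -EFinD lee_fin.
    have := ler_norm (z w - Num.min (y a w) K); lra.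
  move: b1 b2; rewrite -!EFinD !lee_fin => b1 b2.
  by rewrite ler_norml; apply/andP; split; lra.
have h4 : (\int[P]_w `|nu - mu|%:E <= (e / 7 + e / 7)%:E)%E.
  rewrite integral_cst//; apply: (@le_trans _ _ (`|nu - mu|%:E * 1)%E); last by rewrite mule1 lee_fin.
  apply: lee_wpmul2l; rewrite ?lee_fin//; exact: probability_le1.
have := tri _ _ _ _ _ mS mL (measurable_cst nu) h1 h2.
move=> /(tri _ _ (cst mu) _ _ mS (measurable_cst nu) (measurable_cst mu)) /(_ h4).
move=> /le_trans; apply; rewrite lee_fin; lra.
Qed.

End torus_functionals.
End main.

Theorem theorem7 (R : realType) (d : measure_display)
  (Omega : measurableType d) (P : probability Omega R)
  (X : Omega -> config R) (V : Omega -> edge_family R) (U : Omega -> R)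
  (hX : poisson_process P X)
  (hU : uniform_mark P X U)
  (hV : iid_uniform_edges P X U V)
  (xi_inf : point_functional R) (xi : R -> point_functional R)
  (hxi_inf : proper_functional [set: R] id xi_inf)
  (hxi : forall t : R, 0 < t ->
     proper_functional (torus t) (wrap_torus t) (xi t))
  (hA : cvg_in_probability P
     (fun t w => with_point (xi t) (0, U w)
                   (restrict_points t X w) (restrict_family t V w))
     (fun w => with_point xi_inf (0, U w) (X w) (V w)))
  (hB : exists2 p : R, 1 < p &
     (ereal_sup [set 'E_P[fun w => (with_point (xi t) (0, U w)
                   (restrict_points t X w) (restrict_family t V w) `^ p)%R]
                | t in `]0%R, +oo[%classic] < +oo)%E) :
  let mean : \bar R := 'E_P[fun w => with_point xi_inf (0%R, U w) (X w) (V w)]%E in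
  [/\ (\int[P]_w
         `| (t^-1 * \sum_(x \in restrict_points t X w)
               xi t x (restrict_points t X w) (restrict_family t V w))%:E
            - mean |)%E @[t --> +oo] --> 0%E,
      mean = (\int[lebesgue_measure]_(s in `]0%R, 1%R])
                'E_P[fun w => with_point xi_inf (0%R, s) (X w) (V w)])%E &
      measurable_fun ([set z : R * Omega | 0 < z.1 <= 1])
        (fun z : R * Omega =>
           with_point xi_inf (0, z.1) (X z.2) (V z.2)) ->
      mean = (\int[P]_w averaged xi_inf (X w) (V w))%E].
Proof.
move=> mean.
have [x0 inv mx] := hxi_inf.
have [F [mF F0 FE]] := represent x0 mx.
have SUT : strip [set: R] `<=` strip setT by [].
have mST : measurable (strip [set: R]) by exact: measurable_strip.
pose z w := with_point xi_inf (0, U w) (X w) (V w).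
pose y t w := with_point (xi t) (0, U w) (restrict_points t X w) (restrict_family t V w).
have U01 w : 0 < U w <= 1 by case: hU.
have lineE s w : 0 < s <= 1 -> (with_point xi_inf (0, s) (X w) (V w))%:E =
    F (input_of X U V (fixed_input SUT mST s) w).
  by move=> s01; apply: (line_functional hX hV).
have zE w : (z w)%:E = F (input_of X U V (palm_input SUT mST) w).
  by rewrite line_palm -lineE.
have z0 w : 0 <= z w by rewrite -lee_fin zE.
have mz : measurable_fun setT z.
  apply/measurable_EFinP; apply: (eq_measurable_fun _ (fun w _ => esym (zE w))).
  exact: measurableT_comp mF (measurable_input_of hX hU hV _).
have meanE : mean = (\int[P]_w (z w)%:E)%E by rewrite /mean unlock.
have [p p1 hp] := hB.
have [M M0 hM] : exists2 M : R, 0 <= M & forall t, 0 < t ->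
    (\int[P]_w (y t w `^ p)%:E <= M%:E)%E.
  set s := ereal_sup _ in hp.
  have hs t : 0 < t -> (\int[P]_w (y t w `^ p)%:E <= s)%E.
    move=> t0; apply: ereal_sup_ubound; exists t; last by rewrite unlock.
    by rewrite /= in_itv/= t0.
  have s0 : (0 <= s)%E.
    apply: le_trans (hs 1 ltr01); apply: integral_ge0 => w _; rewrite lee_fin; exact: powR_ge0.
  exists (fine s); first exact: fine_ge0.
  by move=> t t0; rewrite fineK ?ge0_fin_numE//; exact: hs.
have zoo : (\int[P]_w (z w)%:E < +oo)%E.
  apply: (@limit_integrable R d Omega P y z p M _ mz _ z0 hA p1 M0 hM).
    by move=> t t0; exact: (torus_score_measurable hX hU hV hxi t0).1.
  by move=> t w t0; exact: (torus_score_measurable hX hU hV hxi t0).2.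
have meanF : mean = (fine (\int[P]_w (z w)%:E)%E)%:E.
  rewrite fineK//; rewrite ge0_fin_numE//.
  by apply: integral_ge0 => w _; rewrite lee_fin.
have [mfix disint] := integral_disintegrate hX hU hV mF F0.
have hfix0 s : (0 <= \int[P]_w F (input_of X U V (fixed_input SUT mST s) w))%E.
  exact: integral_ge0.
have mean2 : mean = (\int[lebesgue_measure]_(s in `]0%R, 1%R])
    'E_P[fun w => with_point xi_inf (0%R, s) (X w) (V w)])%E.
  rewrite meanE (eq_integral (fun w => F (input_of X U V (palm_input SUT mST) w))); last first.
    by move=> w _; exact: zE.
  apply: (etrans disint); apply: (etrans (integral_mark hU mfix hfix0)).
  apply: eq_integral => s; rewrite inE /= in_itv/= => s01.
  rewrite unlock; apply: eq_integral => w _; exact/esym/lineE.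
split => //.
- apply/fine_cvgP; split.
    have [T T0 hT] := score_mean_L1 hX hU hV hxi mz z0 hA p1 M0 hM ltr01.
    exists T; split => [|t /ltW/hT h]; first exact: num_real.
    rewrite ge0_fin_numE; last exact: integral_ge0.
    by rewrite meanF; apply: le_lt_trans h _; rewrite ltry.
  apply/cvgrPdist_le => e e0.
  have [T T0 hT] := score_mean_L1 hX hU hV hxi mz z0 hA p1 M0 hM e0.
  exists T; split => [|t /ltW/hT h]; first exact: num_real.
  have I0 : (0 <= \int[P]_w `|score_mean X V t (xi t) w - fine (\int[P]_w (z w)%:E)|%:E)%E.
    exact: integral_ge0.
  rewrite /= meanF sub0r normrN ger0_norm; last exact: fine_ge0.
  rewrite -lee_fin; apply: le_trans (h); rewrite [leLHS]fineK; first exact: lexx.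
  rewrite ge0_fin_numE; last exact: I0.
  exact: le_lt_trans h (ltry _).
move=> mjoint.
pose D := [set q : R * Omega | 0 < q.1 <= 1].
have mD : measurable D.
  rewrite (_ : D = `]0%R, 1%R] `*` setT); first exact: measurableX.
  by apply/seteqP; split => [[s w]|[s w] []] //=; rewrite in_itv/=.
(* Joint measurability is available for birth times in ]0, 1] only, so the
   score is extended by zero before exchanging the integrals. *)
pose f : R * Omega -> \bar R :=
  (fun q => (with_point xi_inf (0%R, q.1) (X q.2) (V q.2))%:E) \_ D.
have mf : measurable_fun setT f.
  by apply/measurable_restrict => //; rewrite setTI; exact/measurable_EFinP.
have f0 q : (0 <= f q)%E.
  rewrite /f patchE; case: ifPn => //; rewrite inE => Dq.
  by rewrite lineE.
have Dmem s w : ((s, w) \in D) = (s \in `]0%R, 1%R]%classic).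
  by rewrite /D; apply/idP/idP => /set_mem h; apply: mem_set; move: h; rewrite /= in_itv.
rewrite mean2 integral_mkcond; under [RHS]eq_integral do rewrite /averaged integral_mkcond.
transitivity (\int[lebesgue_measure]_s \int[P]_w f (s, w))%E.
  apply: eq_integral => s _; rewrite patchE.
  case: ifPn => sD.
    by rewrite unlock; apply: eq_integral => w _; rewrite /f patchE Dmem sD.
  by rewrite integral0_eq// => w _; rewrite /f patchE Dmem (negbTE sD).
transitivity (\int[P]_w \int[lebesgue_measure]_s f (s, w))%E; last first.
  apply: eq_integral => w _; apply: eq_integral => s _.
  by rewrite /f !patchE Dmem.
have mf' : measurable_fun setT (f : measurableTypeR R * Omega -> \bar R) := mf.
exact: fubini_tonelli mf' f0.
Qed.
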